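(* (Formal shape derivative.) The shape derivative $\delta J[\Gamma;\boldsymbol V]$ of $J[\Gamma]$ in the direction $\boldsymbol V$ is given by $$\delta J[\Gamma;\boldsymbol V]=\int_{\Gamma_1\cup\Gamma_2}\boldsymbol T(\boldsymbol u,p)\boldsymbol n\cdot\partial_n\boldsymbol z\,V+\nu\int_{\Gamma_1\cup\Gamma_2}(\nabla^s\boldsymbol u)\boldsymbol n\cdot\boldsymbol e_\omega\,|V|+\int_{\Gamma_1\cup\Gamma_2}\boldsymbol f\cdot\boldsymbol z\,V .$$
   Context: Geometry. $D\subset\mathbb R^2$ is a rectangle (the channel) with sides parallel to the axes, whose upper and lower edges are rigid walls; $\boldsymbol o=(x_{\boldsymbol o},y_{\boldsymbol o})$ is a fixed point on the upper edge (the hinge). Polar coordinates $(r,\omega)$ centered at $\boldsymbol o$ are such that $\boldsymbol x=\boldsymbol o+r\,\boldsymbol e_\omega$ with $\boldsymbol e_\omega=(\sin\omega,-\cos\omega)$, and $\boldsymbol e_\omega^\perp=(\cos\omega,\sin\omega)$. Fix $\epsilon_0>0$, $0<\epsilon\le\epsilon_0/2$, $I_{\epsilon_0}=[-\frac\pi2+\epsilon_0,\frac\pi2-\epsilon_0]$ and $\theta\in I_{\epsilon_0}$. The leaflet is $L=\{\boldsymbol o+r\boldsymbol e_\omega:\ 0\le r\le R,\ |\omega-\theta|\le\epsilon\}$, where $R$ is smaller than the vertical size of $D$, and the distance between $L$ and the vertical sides of $D$ is uniformly positive for all configurations. Put $\Gamma=\partial L$, $\Omega=D\setminus L$, and let $\boldsymbol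 n$ be the outward unit normal to $\partial\Omega$ (on $\Gamma$, $\boldsymbol n=\boldsymbol n_\Gamma$ points into $L$). $\Gamma_1$ and $\Gamma_2$ are the straight sides of $\Gamma$, where $0\le r\le R$ and $\omega=\theta-\epsilon$, respectively $\omega=\theta+\epsilon$. $\partial D=\partial D_D\cup\partial D_N$ is a partition into disjoint parts with $\partial D_N\neq\emptyset$; on the upper and lower walls no-slip conditions are imposed (they belong to $\partial D_D$ and $\boldsymbol g=\boldsymbol 0$ there). Stokes problem. $\nu>0$ is the viscosity, $\nabla^s$ is the symmetric gradient, $\boldsymbol T(\boldsymbol u,p)=\nu\nabla^s\boldsymbol u+p\boldsymbol I$. The pair $(\boldsymbol u,p)$ solves $-\operatorname{div}\boldsymbol T(\boldsymbol u,p)=\boldsymbol f$, $\operatorname{div}\boldsymbol u=0$ in $\Omega$, $\boldsymbol u=\boldsymbol 0$ on $\Gamma$, $\boldsymbol u=\boldsymbol g$ on $\partial D_D$, $\boldsymbol T(\boldsymbol u,p)\boldsymbol n=\boldsymbol h$ on $\partial D_N$, with data $\boldsymbol f$, $\boldsymbol g$, $\boldsymbol h$. Adjoint problem. $\boldsymbol\Phi(r,\omega)=r\,\boldsymbol e_\omega^\perp$, i.e. $\boldsymbol\Phi(x,y)=(y_{\boldsymbol o}-y,\,x-x_{\boldsymbol o})$. The pair $(\boldsymbol z,q)$ solves $-\operatorname{div}\boldsymbol T(\boldsymbol z,q)=\boldsymbol 0$, $\operatorname{div}\boldsymbol z=0$ in $\Omega$, $\boldsymbol z=\boldsymbol\Phi$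 on $\Gamma$, $\boldsymbol z=\boldsymbol 0$ on $\partial D_D$, $\boldsymbol T(\boldsymbol z,q)\boldsymbol n=\boldsymbol 0$ on $\partial D_N$. Functional. $J[\Gamma]=-\int_\Gamma r\,\boldsymbol e_\omega^\perp\cdot\boldsymbol T(\boldsymbol u,p)\boldsymbol n_\Gamma$ is the torque exerted by the fluid on the leaflet; equivalently, $J[\Gamma]=-\nu\int_\Omega\nabla^s\boldsymbol u:\nabla^s\boldsymbol z+\int_\Omega\boldsymbol f\cdot\boldsymbol z+\int_{\partial D_N}\boldsymbol h\cdot\boldsymbol z$. Shape derivative. $\boldsymbol V=\boldsymbol\Phi$ is the velocity of the rigid rotation about $\boldsymbol o$, $V=\boldsymbol V\cdot\boldsymbol n_\Gamma$ is the normal velocity on $\Gamma$, and $\partial_n$ is the normal derivative. The shape derivative of $J[\Gamma]$ in the direction $\boldsymbol V$ is (formally) defined by $$\delta J[\Gamma;\boldsymbol V]=-\nu\int_\Gamma\nabla^s\boldsymbol u:\nabla^s\boldsymbol z\,V+\int_\Gamma\boldsymbol f\cdot\boldsymbol z\,V-\nu\int_\Omega\nabla^s\boldsymbol u':\nabla^s\boldsymbol z-\nu\int_\Omega\nabla^s\boldsymbol u:\nabla^s\boldsymbol z'+\int_\Omega\boldsymbol f\cdot\boldsymbol z'+\int_{\partial D_N}\boldsymbol h\cdot\boldsymbol z',$$ where $(\boldsymbol u',p')$ solves $-\operatorname{div}\boldsymbol T(\boldsymbol u',p')=\boldsymbol0$, $\operatorname{div}\boldsymbol u'=0$ in $\Omega$,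 $\boldsymbol u'=-(\nabla\boldsymbol u)\boldsymbol V$ on $\Gamma$, $\boldsymbol u'=\boldsymbol0$ on $\partial D_D$, $\boldsymbol T(\boldsymbol u',p')\boldsymbol n=\boldsymbol0$ on $\partial D_N$, and $(\boldsymbol z',q')$ solves $-\operatorname{div}\boldsymbol T(\boldsymbol z',q')=\boldsymbol0$, $\operatorname{div}\boldsymbol z'=0$ in $\Omega$, $\boldsymbol z'=-(\nabla(\boldsymbol z-\boldsymbol\Phi))\boldsymbol V$ on $\Gamma$, $\boldsymbol z'=\boldsymbol0$ on $\partial D_D$, $\boldsymbol T(\boldsymbol z',q')\boldsymbol n=\boldsymbol0$ on $\partial D_N$. The formula in the claim is a formal expression; finiteness of its integrals is not part of the statement. *)

(* Defs.v *)
From HB Require Import structures.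
From mathcomp Require Export all_boot all_order all_algebra.
From mathcomp Require Export all_classical all_reals all_analysis.

Set Implicit Arguments.
Unset Strict Implicit.
Unset Printing Implicit Defensive.

Export Order.TTheory GRing.Theory Num.Theory.
Export numFieldNormedType.Exports.

Local Open Scope classical_set_scope.
Local Open Scope ring_scope.

(* Points of the plane live in R * R (which carries the product Lebesgue
   measure); values of vector fields live in 'cV[R]_2 and values of tensor
   fields in 'M[R]_2. *)

Section vector_calculus.
Variable R : realType.

Definition col2 (a b : R) : 'cV[R]_2 := \col_(i < 2) (if i == 0 then a else b).

Definition axis (j : 'I_2) : R * R := if j == 0 then (1, 0) else (0, 1).

Definition dot (a b : 'cV[R]_2) : R := \sum_(i < 2) a i 0 * b i 0.

Definition ddot (A B : 'M[R]_2) : R := \sum_(i < 2) \sum_(j < 2) A i j * B i j.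

(* (grad v) i j is the j-th partial derivative of the i-th component, so that
   grad v x *m n is the derivative of v at x along n. *)
Definition grad (v : R * R -> 'cV[R]_2) (x : R * R) : 'M[R]_2 :=
  \matrix_(i < 2, j < 2) 'D_(axis j) (fun y => v y i 0) x.

(* The factor 1/2 is what makes symgrad v : grad w = symgrad v : symgrad w. *)
Definition symgrad (v : R * R -> 'cV[R]_2) (x : R * R) : 'M[R]_2 :=
  2^-1 *: (grad v x + (grad v x)^T).

Definition divv (v : R * R -> 'cV[R]_2) (x : R * R) : R := \tr (grad v x).

Definition divt (T : R * R -> 'M[R]_2) (x : R * R) : 'cV[R]_2 :=
  \col_(i < 2) \sum_(j < 2) 'D_(axis j) (fun y => T y i j) x.

Definition stress (nu : R) (v : R * R -> 'cV[R]_2) (p : R * R -> R)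
    (x : R * R) : 'M[R]_2 :=
  nu *: symgrad v x + (p x)%:M.

Definition C1_near (f : R * R -> R) (x : R * R) : Prop :=
  \forall y \near x, differentiable f y /\
    forall j : 'I_2, {for y, continuous (fun w => 'D_(axis j) f w)}.

Definition C2_near (f : R * R -> R) (x : R * R) : Prop :=
  C1_near f x /\ forall j : 'I_2, C1_near (fun w => 'D_(axis j) f w) x.

End vector_calculus.

(* The channel is ]xl, xr[ x ]yb, yt[; len is the length of the leaflet (R in
   the polar description of L), theta its angle and eps its half-aperture. *)
Record config (R : realType) := Config {
  xl : R; xr : R; yb : R; yt : R;
  hinge : R * R;
  eps0 : R; eps : R; theta : R; len : R }.

Section geometry.
Variables (R : realType) (c : config R).

Definition e_ (w : R) : 'cV[R]_2 := col2 (sin w) (- cos w).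

Definition eperp (w : R) : 'cV[R]_2 := col2 (cos w) (sin w).

Definition polar (r w : R) : R * R :=
  ((hinge c).1 + r * sin w, (hinge c).2 - r * cos w).

(* The channel is taken open, so that Omega below is open. *)
Definition channel : set (R * R) :=
  [set x | xl c < x.1 < xr c /\ yb c < x.2 < yt c].

Definition leaflet_at (t : R) : set (R * R) :=
  [set x | exists r w, [/\ 0 <= r <= len c, `|w - t| <= eps c & x = polar r w]].

Definition leaflet : set (R * R) := leaflet_at (theta c).

Definition angles : set R :=
  [set t | - (pi / 2) + eps0 c <= t <= pi / 2 - eps0 c].

Definition frontier (A : set (R * R)) : set (R * R) := closure A `\` interior A.

Definition Gam : set (R * R) := frontier leaflet.

Definition Omega : set (R * R) := channel `\` leaflet.

Definition walls : set (R * R) :=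
  [set x | xl c <= x.1 <= xr c /\ (x.2 = yb c \/ x.2 = yt c)].

Definition admissible : Prop :=
  [/\ 0 < eps0 c, 0 < eps c <= eps0 c / 2 & angles (theta c)] /\
  [/\ xl c <= (hinge c).1 <= xr c, (hinge c).2 = yt c,
      0 < len c & len c < yt c - yb c] /\
  exists2 d, 0 < d &
    forall t x, angles t -> leaflet_at t x -> xl c + d <= x.1 <= xr c - d.

Definition boundary_partition (DD DN : set (R * R)) : Prop :=
  [/\ DD `|` DN = frontier channel, DD `&` DN = set0, DN !=set0,
      measurable DN & walls `<=` DD].

(* The outward normal to the channel; at the four corners the value is
   conventional. *)
Definition normal_channel (x : R * R) : 'cV[R]_2 :=
  if x.1 == xl c then col2 (-1) 0 else
  if x.1 == xr c then col2 1 0 else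
  if x.2 == yb c then col2 0 (-1) else col2 0 1.

(* The velocity of the rigid rotation about the hinge: Phi (polar r w) equals
   r *: eperp w. *)
Definition Phi (x : R * R) : 'cV[R]_2 :=
  col2 ((hinge c).2 - x.2) (x.1 - (hinge c).1).

Definition Vn (x : R * R) (n : 'cV[R]_2) : R := dot (Phi x) n.

Definition int_Omega (F : R * R -> R) : R :=
  \int[(lebesgue_measure \x lebesgue_measure)%E]_(x in Omega) F x.

(* Integrals over Gam with respect to arc length.  The integrand receives the
   polar coordinates r, w of the point and the unit normal n, which points
   into the leaflet (outward for Omega). *)

(* The two straight sides, w = theta - eps and w = theta + eps. *)
Definition int_sides (F : R -> R -> 'cV[R]_2 -> R) : R :=
  \int[lebesgue_measure]_(r in `[0, len c])
     F r (theta c - eps c) (eperp (theta c - eps c))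
  + \int[lebesgue_measure]_(r in `[0, len c])
     F r (theta c + eps c) (- eperp (theta c + eps c)).

(* The tip, r = len, whose arc length element is len dw. *)
Definition int_tip (F : R -> R -> 'cV[R]_2 -> R) : R :=
  \int[lebesgue_measure]_(w in `[theta c - eps c, theta c + eps c])
     (F (len c) w (- e_ w) * len c).

Definition int_Gam (F : R -> R -> 'cV[R]_2 -> R) : R := int_sides F + int_tip F.

(* Integral with respect to arc length over a part A of the boundary of the
   channel. *)
Definition int_outer (A : set (R * R)) (F : R * R -> R) : R :=
  \int[lebesgue_measure]_(y in [set y | yb c <= y <= yt c /\ A (xl c, y)])
     F (xl c, y)
  + \int[lebesgue_measure]_(y in [set y | yb c <= y <= yt c /\ A (xr c, y)])
     F (xr c, y)
  + \int[lebesgue_measure]_(x in [set x | xl c <= x <= xr c /\ A (x, yb c)])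
     F (x, yb c)
  + \int[lebesgue_measure]_(x in [set x | xl c <= x <= xr c /\ A (x, yt c)])
     F (x, yt c).

End geometry.

Section stokes.
Variables (R : realType) (c : config R) (DD DN : set (R * R)).

(* The solutions are classical away from a finite set S of boundary points
   (reentrant corners of the leaflet, hinge, corners of the channel, points
   where the type of boundary condition changes), at which Stokes flows are in
   general singular.  Fields are total functions on the plane; smoothness up
   to the boundary means smoothness in a neighbourhood of each point of
   closure Omega off S, so that boundary values of derivatives make sense. *)
Variable S : seq (R * R).

Definition blowup (a : R) (x : R * R) : R := 1 + \sum_(s <- S) `|x - s| `^ a.

(* v is C^2 and p is C^1 up to the boundary off S, and near s in S the fields
   behave at worst as v = O(1 + |x - s|^a) and
   grad v, p = O(1 + |x - s|^(a - 1)). *)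
Definition regular (a : R) (v : R * R -> 'cV[R]_2) (p : R * R -> R) : Prop :=
  (forall x, closure (Omega c) x -> x \notin S ->
     (forall i : 'I_2, C2_near (fun y => v y i 0) x) /\ C1_near p x) /\
  exists C : R, forall x, Omega c x ->
    [/\ `|v x| <= C * blowup a x,
        `|grad v x| <= C * blowup (a - 1) x
      & `|p x| <= C * blowup (a - 1) x].

Definition regular_force (a : R) (f : R * R -> 'cV[R]_2) : Prop :=
  {within closure (Omega c) `\` [set` S], continuous f} /\
  exists C : R, forall x, Omega c x -> `|f x| <= C * blowup (a - 1) x.

(* The mixed Stokes problem with force f, velocity b on Gam and g on DD, and
   traction h on DN. *)
Definition mixed_stokes (nu : R) (f b g h : R * R -> 'cV[R]_2)
    (v : R * R -> 'cV[R]_2) (p : R * R -> R) : Prop :=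
  [/\ forall x, Omega c x -> - divt (stress nu v p) x = f x /\ divv v x = 0,
      forall x, Gam c x -> x \notin S -> v x = b x,
      forall x, DD x -> x \notin S -> v x = g x
    & forall x, DN x -> x \notin S ->
        stress nu v p x *m normal_channel c x = h x].

End stokes.

Section shape_derivative.
Variables (R : realType) (c : config R) (DN : set (R * R)) (nu : R).

(* The (formal) shape derivative in the direction Phi, where du and dz are the
   shape derivatives of u and z. *)
Definition shape_derivative (f h u z du dz : R * R -> 'cV[R]_2) : R :=
  - nu * int_Gam c (fun r w n => let x := polar c r w in
           ddot (symgrad u x) (symgrad z x) * Vn c x n)
  + int_Gam c (fun r w n => let x := polar c r w in
           dot (f x) (z x) * Vn c x n)
  - nu * int_Omega c (fun x => ddot (symgrad du x) (symgrad z x))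
  - nu * int_Omega c (fun x => ddot (symgrad u x) (symgrad dz x))
  + int_Omega c (fun x => dot (f x) (dz x))
  + int_outer c DN (fun x => dot (h x) (dz x)).

End shape_derivative.

(* Main.v *)
Require Import Defs.
From mathcomp Require Import measurable_realfun ring lra.

(** Green's formula for the Stokes operator carries the proof.  Let (v, p) be a
Stokes flow with force f and traction h, and let w be solenoidal and vanish off
S on the Dirichlet part of the outer boundary and on the tip of the leaflet.
Then, T being the stress of (v, p) ([green_formula]),
  nu int_Omega (symgrad v : symgrad w) - int_Omega (f . w)
     = int_DN (h . w) + int_sides (T n . w).
It is applied to v = z, w = du and to v = u, w = dz, and turns the two volume
terms of the shape derivative into integrals over the boundary.

On the tip the rotation velocity Phi is tangent to the boundary.  The normal
velocity V is therefore zero there; and since u and z - Phi vanish along the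
tip, so do their derivatives along Phi, which are - du and - dz
([grad_arc]).  Only the two straight sides contribute.

On a side Phi = V n.  There u = 0 forces grad u = g n^T, where g is the normal
derivative of u, and div u = 0 forces g . n = 0.  Hence the pressure q drops out
of T(z, q) n . du = - V T(z, q) n . g, which is - nu V (symgrad u : symgrad z)
([side_strain_work]).  This cancels the explicit term in V.  Likewise
dz = - V (grad z) n + (grad Phi) Phi, where (grad Phi) Phi = - |V| e_ because
grad Phi is the rotation by a right angle; as e_ is orthogonal to n, the
pressure p drops out of T(u, p) n . e_ ([side_traction_split]).  The two
resulting terms are the first two of the claim, and the terms in f agree on both
sides.

Green's formula is reduced to the divergence theorem for the flux T w, whose
components are singular at the points of S.  For smooth fields that vanish on
the tip (and whose second component vanishes on the walls), the theorem follows
from Fubini: a horizontal or vertical line meets the sector L in a segment whose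
ends lie on the straight sides or on the arc, so that the fundamental theorem of
calculus on each line, followed by an affine change of variables, gives integrals
over the sides ([vertical_flux], [horizontal_flux], [smooth_flux]).  In the
singular case the field is multiplied by cut-off functions that vanish near S and
tend to 1 ([singular_flux]).  Near s the flux is O(|x - s|^g) with g > -1, and
the gradient of the cut-off is O(1 / |x - s|) uniformly, so that the error is
dominated by |x - s|^(g - 1), which is integrable in the plane since g - 1 > -2;
the boundary terms are dominated by |x - s|^g, which is integrable on lines. *)

Set Implicit Arguments.
Unset Strict Implicit.
Unset Printing Implicit Defensive.

Local Open Scope classical_set_scope.
Local Open Scope ring_scope.

(** * Measurability and integrability *)

(** The measurable sets of the plane are those of the product sigma-algebra, which
is not generated by open sets by definition; an open set is a countable union of
squares with rational centre and radius. *)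
Lemma open_measurable_plane (R : realType) (U : set (R * R)) :
  open U -> measurable U.
Proof.
move=> oU.
pose box (k : rat * rat * rat) : set (R * R) :=
  ball (ratr k.1.1 : R) (ratr k.2) `*` ball (ratr k.1.2 : R) (ratr k.2).
pose B (k : rat * rat * rat) := if `[< box k `<=` U >] then box k else set0.
have -> : U = \bigcup_k B k.
  apply/seteqP; split=> [x Ux|x [k _]]; last first.
    by rewrite /B; case: asboolP => // + xk; apply.
  have /nbhs_ballP[e /= e0 eU] : nbhs x U by exact: (open_nbhs_nbhs (conj oU Ux)).
  have [q1 /andP[q10 q1e]] : exists q, 0 < (ratr q : R) < e / 2.
    have [q] := @rat_in_itvoo R 0 (e / 2) ltac:(by rewrite divr_gt0).
    by rewrite in_itv/=; exists q.
  have near_rat (t : R) : exists q, `|t - ratr q| < (ratr q1 : R).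
    have [q] := @rat_in_itvoo R (t - ratr q1) (t + ratr q1) ltac:(lra).
    rewrite in_itv/= => /andP[? ?]; exists q.
    by rewrite ltr_norml; apply/andP; split; lra.
  have [q2 h2] := near_rat x.1.
  have [q3 h3] := near_rat x.2.
  exists (q2, q3, q1) => //; rewrite /B asboolT.
    by split; rewrite /ball/= distrC.
  move=> y [/= y1 y2]; apply: eU; split; rewrite /ball/=.
    move: y1; rewrite /ball/= => y1.
    by rewrite -(subrKA (ratr q2)); apply: le_lt_trans (ler_normD _ _) _; lra.
  move: y2; rewrite /ball/= => y2.
  by rewrite -(subrKA (ratr q3)); apply: le_lt_trans (ler_normD _ _) _; lra.
apply: countable_bigcupT_measurable => [|k]; first exact: countableP.
rewrite /B; case: asboolP => // _.
by apply: measurableX; apply: open_measurable; exact: ball_open.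
Qed.

Lemma open_continuous_measurable_plane (R : realType) (U : set (R * R))
    (f : R * R -> R) : open U -> (forall x, U x -> {for x, continuous f}) ->
  measurable_fun U f.
Proof.
move=> oU cf.
apply: (measurability _ (RGenOpens.measurableE R)).
move=> _ [_ [a [b ->] <-]]; apply: open_measurable_plane.
rewrite openE => x [Ux fx]; rewrite /interior.
have ofx : nbhs (f x) `]a, b[%classic.
  by apply: (open_nbhs_nbhs (conj _ _)) => //; exact: interval_open.
apply: filterI; first exact: (open_nbhs_nbhs (conj oU Ux)).
exact: cf Ux _ ofx.
Qed.

(** The monotone convergence theorem, for a nonnegative function with a bounded
antiderivative on an increasing union of compact intervals. *)
Lemma integrable_antiderivative (R : realType) (a b : nat -> R)
    (f F : R -> R) (K : R) :
  (forall n, a n < b n) ->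
  (forall m n, (m <= n)%N -> a n <= a m /\ b m <= b n) ->
  (forall n x, a n <= x <= b n ->
    [/\ 0 <= f x, {for x, continuous f}, is_derive x 1 F (f x) & `|F x| <= K]) ->
  lebesgue_measure.-integrable (\bigcup_n `[a n, b n]%classic) (EFin \o f).
Proof.
move=> ab mono H.
have mE : measurable (\bigcup_n `[a n, b n]%classic : set R).
  by apply: bigcup_measurable => n _; exact: measurable_itv.
have cf n : {within `[a n, b n], continuous f}.
  apply: continuous_in_subspaceT => x; rewrite inE/= in_itv/= => /H.
  by case.
have mf n : measurable_fun `[a n, b n]%classic f.
  by apply: subspace_continuous_measurable_fun => //; exact: measurable_itv.
have f0 n x : `[a n, b n]%classic x -> 0 <= f x.
  by rewrite /= in_itv/= => /H[].
have mfE : measurable_fun (\bigcup_n `[a n, b n]%classic : set R) (EFin \o f).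
  apply/measurable_EFinP/measurable_fun_bigcup => // n; exact: measurable_itv.
apply/integrableP; split=> //.
have -> : (\int[lebesgue_measure]_(x in \bigcup_n `[a n, b n]%classic)
    `|(EFin \o f) x| = \int[lebesgue_measure]_(x in \bigcup_n `[a n, b n]%classic)
    (EFin \o f) x)%E.
  apply: eq_integral => x; rewrite inE => -[n _ /f0 h] /=.
  by rewrite ger0_norm.
have h : (\int[lebesgue_measure]_(x in `[a n, b n]%classic) (EFin \o f) x)%E
    @[n --> \oo] -->
    (\int[lebesgue_measure]_(x in \bigcup_n `[a n, b n]%classic) (EFin \o f) x)%E.
  apply: ge0_nondecreasing_set_cvg_integral.
  - move=> m n mn; apply/subsetPset => x /=; rewrite !in_itv/=.
    by have [? ?] := mono _ _ mn; move=> /andP[? ?]; apply/andP; split; lra.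
  - by move=> n; exact: measurable_itv.
  - by move=> n; apply/measurable_EFinP; exact: mf.
  - by move=> n x /f0; rewrite lee_fin.
rewrite -(cvg_lim _ h)//.
apply: (@le_lt_trans _ _ (K + K)%:E); last exact: ltry.
apply: lime_le; first by apply/cvg_ex; eexists; exact: h.
apply: nearW => n /=.
rewrite (@continuous_FTC2 _ f F (a n) (b n)) //.
- rewrite -EFinB lee_fin.
  have [|_ _ _] := H n (a n); first by rewrite lexx ltW.
  have [|_ _ _] := H n (b n); first by rewrite lexx ltW.
  by rewrite !ler_norml => /andP[? ?] /andP[? ?]; lra.
- have dF x : a n <= x <= b n -> F y @[y --> x] --> F x.
    move=> /H[_ _ [? _] _].
    by apply: differentiable_continuous; apply/derivable1_diffP.
  split.
  + move=> x; rewrite in_itv/= => /andP[? ?].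
    by have [|_ _ [] //] := H n x; lra.
  + by apply: cvg_at_right_filter; apply: dF; rewrite lexx ltW.
  + by apply: cvg_at_left_filter; apply: dF; rewrite lexx ltW.
- move=> x; rewrite in_itv/= => /andP[? ?].
  have [|_ _ [_ +] _] := H n x; first lra.
  by rewrite derive1E.
Qed.

(** * Finite sets of exceptions and powers on the line *)

Lemma integrable_setU (R : realType) d (T : measurableType d)
    (mu : {measure set T -> \bar R}) (A B : set T) (f : T -> \bar R) :
  measurable A -> measurable B ->
  mu.-integrable A f -> mu.-integrable B f -> mu.-integrable (A `|` B) f.
Proof.
move=> mA mB /integrableP[mfA fA] /integrableP[mfB fB].
have mf : measurable_fun (A `|` B) f by apply/measurable_funU.
apply/integrableP; split => //.
apply: le_lt_trans (lte_add_pinfty fA fB).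
have -> : A `|` B = A `|` (B `\` A).
  by apply/seteqP; split=> x /=; have [?|?] := pselect (A x); tauto.
have mBA : measurable (B `\` A) by exact: measurableD.
rewrite ge0_integral_setU //.
- apply: leeD => //; apply: ge0_subset_integral => //.
  by apply: measurableT_comp.
- apply: measurableT_comp => //; apply: measurable_funS mf; last by move=> x /= [|[]]; tauto.
  exact: measurableU.
- by rewrite /disj_set; apply/eqP/seteqP; split=> x //= -[? []].
Qed.

Lemma integrable_scale (R : realType) d (T : measurableType d)
    (mu : {measure set T -> \bar R}) (D : set T) (k : R) (f : T -> R) :
  measurable D -> mu.-integrable D (EFin \o f) ->
  mu.-integrable D (EFin \o (fun x => k * f x)).
Proof. by move=> mD i; exact: (integrableZl mD k i). Qed.

Section finite_exceptions.
Variable R : realType.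
Implicit Types (D N : set R) (f g : R -> R).

Lemma finite_set_measurable N : finite_set N -> measurable N.
Proof.
move=> fN; apply: countable_measurable; first exact: measurable_set1.
exact: finite_set_countable.
Qed.

(** This and the next lemmas allow one to ignore the parameters at which a path
passes through a singular point: the integrands have arbitrary values there. *)
Lemma measurable_fun_finite_exceptions D N f : measurable D -> finite_set N ->
  measurable_fun (D `\` N) f -> measurable_fun D f.
Proof.
move=> mD fN mf.
have mA A : A `<=` N -> measurable A.
  by move=> AN; apply: finite_set_measurable; exact: sub_finite_set fN.
rewrite -(setUIDK D N); apply/measurable_funU.
- by apply: mA => x [].
- by apply: measurableD => //; exact: mA.
- by split=> // _ Y mY; apply: mA => x [[]].
Qed.

Lemma lebesgue_measure_finite_set N : finite_set N ->
  lebesgue_measure N = 0 :> \bar R.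
Proof.
by move=> fN; apply: countable_lebesgue_measure0; exact: finite_set_countable.
Qed.

Lemma Rintegral_finite_exceptions D N f g : measurable D -> finite_set N ->
  measurable_fun D f -> (forall x, D x -> ~ N x -> f x = g x) ->
  \int[lebesgue_measure]_(x in D) f x = \int[lebesgue_measure]_(x in D) g x.
Proof.
move=> mD fN mf fg.
have mg : measurable_fun (D `\` N) g.
  have mDN : measurable_fun (D `\` N) f by apply: measurable_funS mf => // x [].
  by apply: eq_measurable_fun mDN => x; rewrite inE => -[? ?]; exact: fg.
congr fine; apply: ae_eq_integral => //.
- exact/measurable_EFinP.
- by apply/measurable_EFinP; exact: measurable_fun_finite_exceptions mg.
exists N; split => //.
- exact: finite_set_measurable.
- exact: lebesgue_measure_finite_set.
- by move=> x /= H; apply: contrapT => Nx; apply: H => Dx; rewrite fg.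
Qed.

End finite_exceptions.

Section powers.
Variable R : realType.

Lemma is_derive_powR (g x : R) : 0 < x ->
  is_derive x 1 (fun y => y `^ g) (g * x `^ (g - 1)).
Proof.
move=> x0; have xin : x \in `]0, +oo[ by rewrite in_itv/= x0.
split; first exact: derivable_powR.
by rewrite -derive1E powR_derive1.
Qed.

Lemma powR_le_neg (g u v : R) : g <= 0 -> 0 < u -> u <= v -> v `^ g <= u `^ g.
Proof.
move=> g0 u0 uv; rewrite -(opprK g) !(powRN _ (- g)).
rewrite lef_pV2 ?posrE ?powR_gt0//; last by rewrite (lt_le_trans u0).
by apply: ge0_ler_powR; rewrite ?nnegrE; lra.
Qed.

Lemma continuous_powR_comp (T : topologicalType) (f : T -> R) (g : R) (x : T) :
  {for x, continuous f} -> 0 < f x -> {for x, continuous (fun y => f y `^ g)}.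
Proof.
move=> cf fx.
have c1 : {for f x, continuous (fun y : R => y `^ g)}.
  by apply: differentiable_continuous; apply/derivable1_diffP; case: (is_derive_powR g fx).
exact: (continuous_comp cf c1).
Qed.

Lemma continuous_dist (V : normedModType R) (s x : V) :
  {for x, continuous (fun y => `|y - s|)}.
Proof.
apply: cvg_norm; apply: cvgB; [exact: cvg_id|exact: cvg_cst].
Qed.

Lemma continuous_powR_dist (V : normedModType R) (g : R) (s x : V) : x != s ->
  {for x, continuous (fun y => `|y - s| `^ g)}.
Proof.
move=> xs; apply: continuous_powR_comp; first exact: continuous_dist.
by rewrite normr_gt0 subr_eq0.
Qed.

(** The antiderivative (r - r0)^(g + 1) / (g + 1) stays bounded up to r0 since
g > -1.  The values k = 1 and k = -1 are the two sides of r0. *)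
Lemma integrable_powR_side (k r0 M g : R) : `|k| = 1 -> -1 < g -> 2 <= M ->
  lebesgue_measure.-integrable [set r | 0 < k * (r - r0) <= M]
    (fun r => (`|r - r0| `^ g)%:E).
Proof.
move=> k1 g1 M2.
have kk : k * k = 1 by rewrite -expr2 -real_normK ?num_real// k1 expr1n.
have k11 : k = 1 \/ k = -1.
  by move: k1; case: (ler0P k) => k0 h; [right|left]; lra.
pose h (n : nat) : R := n.+1%:R^-1.
have h0 n : 0 < h n by rewrite /h invr_gt0.
have h1 n : h n <= 1 by rewrite /h invf_le1 // ler1n.
have hm m n : (m <= n)%N -> h n <= h m by move=> mn; rewrite /h lef_pV2 ?posrE// ler_nat.
pose a n := if k == 1 then r0 + h n else r0 - M.
pose b n := if k == 1 then r0 + M else r0 - h n.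
have abE n x : (a n <= x <= b n) = (h n <= k * (x - r0) <= M).
  rewrite /a /b; case: k11 => ->; rewrite ?eqxx ?mul1r ?mulN1r.
    by apply/andP/andP => -[? ?]; split; lra.
  have -> : (-1 == 1 :> R) = false by apply/negbTE/eqP => ?; lra.
  by apply/andP/andP => -[? ?]; split; lra.
pose F r := (g + 1)^-1 * (k * (k * (r - r0)) `^ (g + 1)).
have -> : [set r | 0 < k * (r - r0) <= M] = \bigcup_n `[a n, b n]%classic.
  apply/seteqP; split => r /=.
    move=> /andP[r1 r2]; have [n _ hn] := near_infty_natSinv_lt (PosNum r1).
    exists n => //=; rewrite in_itv/= abE r2 andbT ltW//.
    by have := hn n (leqnn n).
  by move=> [n _] /=; rewrite in_itv/= abE => /andP[? ->]; rewrite andbT (lt_le_trans (h0 n)).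
apply: (@integrable_antiderivative R a b _ F ((g + 1)^-1 * (M `^ (g+1)))).
- move=> n; have := h1 n; have := h0 n; rewrite /a /b; case: ifP => _; lra.
- by move=> m n /hm; rewrite /a /b; case: ifP => _; split; lra.
move=> n x; rewrite abE => /andP[x1 x2].
have kx : 0 < k * (x - r0) by rewrite (lt_le_trans (h0 n)).
have xE : `|x - r0| = k * (x - r0).
  by rewrite -[LHS]mul1r -k1 -normrM gtr0_norm.
have g10 : 0 < g + 1 by lra.
split; first exact: powR_ge0.
- by apply: continuous_powR_dist; rewrite -subr_eq0 -normr_gt0 xE.
- have dl : is_derive x 1 (fun r => k * (r - r0)) k.
    by apply: is_derive_eq; rewrite subr0 scaler1 ?mulr1.
  have := @is_derive1_comp _ (fun y => y `^ (g + 1)) (fun r => k * (r - r0)) x _ _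
    (is_derive_powR (g + 1) kx) dl.
  rewrite addrK => dd.
  have -> : F = ((g + 1)^-1 * k) *: ((fun y => y `^ (g + 1)) \o (fun r => k * (r - r0))).
    by apply/funext => r; exact: mulrA.
  apply: is_derive_eq; rewrite xE /GRing.scale/=.
  set p := _ `^ _; transitivity ((g + 1)^-1 * (g + 1) * (k * k) * p); first by ring.
  by rewrite kk mulVf ?gt_eqF// !mul1r.
- rewrite /F !normrM k1 mul1r gtr0_norm ?invr_gt0//.
  rewrite ler_pM2l ?invr_gt0// ger0_norm ?powR_ge0//.
  by apply: ge0_ler_powR; rewrite ?nnegrE; lra.
Qed.

Lemma integrable_powR_dist (A B r0 g : R) : -1 < g ->
  lebesgue_measure.-integrable `[A, B]%classic (fun r => (`|r - r0| `^ g)%:E).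
Proof.
move=> g1.
pose M := 2 + `|A - r0| + `|B - r0|.
have M2 : 2 <= M by rewrite /M -addrA lerDl addr_ge0.
have mS k : measurable [set r : R | 0 < k * (r - r0) <= M].
  rewrite (_ : [set _ | _] = (fun r => k * (r - r0)) @^-1` `]0, M]%classic); last first.
    by apply/seteqP; split=> r /=; rewrite in_itv.
  rewrite -[X in measurable X]setTI; apply: (continuous_measurable_fun _) => //.
  move=> x; apply: cvgM; first exact: cvg_cst.
  by apply: cvgB; [exact: cvg_id|exact: cvg_cst].
pose P k := [set r | 0 < k * (r - r0) <= M].
have i1 : lebesgue_measure.-integrable (P 1 `|` P (-1)) (fun r => (`|r - r0| `^ g)%:E).
  apply: integrable_setU; [exact: mS|exact: mS|apply: integrable_powR_side|apply: integrable_powR_side] => //.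
    by rewrite normr1.
  by rewrite normrN1.
have i2 : lebesgue_measure.-integrable [set r0] (fun r => (`|r - r0| `^ g)%:E).
  apply: null_set_integrable => //; last exact: lebesgue_measure_set1.
  by apply: measurable_fun_set1.
have : lebesgue_measure.-integrable (P 1 `|` P (-1) `|` [set r0])
    (fun r => (`|r - r0| `^ g)%:E).
  by apply: integrable_setU => //; apply: measurableU; exact: mS.
apply: integrableS => //; first by apply: measurableU => //; apply: measurableU; exact: mS.
move=> r /=; rewrite in_itv/= => /andP[Ar rB].
have rM : `|r - r0| <= M.
  rewrite /M ler_norml; apply/andP; split.
    by have := ler_norm (- (A - r0)); rewrite normrN; have := normr_ge0 (B - r0); lra.
  by have := ler_norm (B - r0); have := normr_ge0 (A - r0); lra.
have [?|] := eqVneq r r0; first by right.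
rewrite -subr_eq0 => rr0; left.
move: rM; rewrite ler_norml => /andP[? ?].
have [h|h] := ltP 0 (r - r0); [left|right]; rewrite /P/= ?mul1r ?mulN1r; apply/andP; split; try lra.
Qed.

End powers.

(** * Powers of the distance in the plane *)

Section plane.
Variable R : realType.
Local Notation mu := (@lebesgue_measure R).
Local Notation mu2 := (mu \x mu)%E.

Lemma Rintegral_dominated_cvg d (T : measurableType d)
    (m : {measure set T -> \bar R}) (D : set T) (f_ : nat -> T -> R)
    (f g : T -> R) :
  measurable D -> (forall n, measurable_fun D (f_ n)) -> measurable_fun D f ->
  (forall x, D x -> f_ n x @[n --> \oo] --> f x) ->
  m.-integrable D (EFin \o g) ->
  (forall n x, D x -> `|f_ n x| <= g x) ->
  \int[m]_(x in D) f_ n x @[n --> \oo] --> \int[m]_(x in D) f x.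
Proof.
move=> mD mf_ mf ff ig fg.
have [|||||i1 _ c] := @dominated_convergence _ _ _ m D mD
  (fun n => EFin \o f_ n) (EFin \o f) (EFin \o g) => //.
- by move=> n; apply/measurable_EFinP.
- exact/measurable_EFinP.
- by apply: aeW => x Dx; apply: cvg_EFin; [exact: nearW|exact: ff].
- by apply: aeW => x n Dx; rewrite /= lee_fin; exact: fg.
apply: fine_cvg; rewrite fineK //.
exact: integrable_fin_num.
Qed.

Lemma open_setC1_plane (s : R * R) : open (~` [set s]).
Proof.
by apply: closed_openC; apply: accessible_closed_set1; apply: hausdorff_accessible; exact: norm_hausdorff.
Qed.

Lemma measurable_fun_powR_dist (U : set (R * R)) (s : R * R) (g : R) :
  open U -> ~ U s -> measurable_fun U (fun x => `|x - s| `^ g).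
Proof.
move=> oU Us; apply: open_continuous_measurable_plane => // x Ux.
have xs : x != s by apply/eqP => xs; apply: Us; rewrite -xs.
exact: continuous_powR_dist.
Qed.

(** On these two lines the product bound used in the next lemma fails: one of its
factors is a power of 0, which is 0 by convention unless the exponent is 0. *)
Lemma plane_lines_null (s : R * R) :
  mu2 ([set s.1] `*` setT `|` setT `*` [set s.2]) = 0.
Proof.
apply: null_set_setU; [by apply: measurableX|by apply: measurableX| |].
- apply: etrans (product_measure1E mu mu (measurable_set1 s.1) measurableT) _.
  exact: etrans (congr1 (fun t => t * _)%E (lebesgue_measure_set1 _)) (mul0e _).
- apply: etrans (product_measure1E mu mu measurableT (measurable_set1 s.2)) _.
  exact: etrans (congr1 (fun t => _ * t)%E (lebesgue_measure_set1 _)) (mule0 _).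
Qed.

(** Off the two axes through s, both coordinates of x - s are at most |x - s|, so
that |x - s|^g is at most the product of their powers with exponent g / 2 > -1.
This product is integrable by Tonelli's theorem. *)
Lemma integrable_powR_plane (A B C D g : R) (s : R * R) : -2 < g -> g <= 0 ->
  mu2.-integrable (`[A, B]%classic `*` `[C, D]%classic)
    (fun x => (`|x - s| `^ g)%:E).
Proof.
move=> g2 g0.
have g1 : -1 < g / 2 by lra.
set Q := _ `*` _.
have mQ : measurable Q by apply: measurableX; exact: measurable_itv.
pose N := [set s.1] `*` setT `|` setT `*` [set s.2].
have mN : measurable N by apply: measurableU; apply: measurableX.
have mf U : U `<=` ~` [set s] -> measurable_fun U (fun x : R * R => `|x - s| `^ g).
  move=> Us; apply: measurable_funS Us _; last first.
    apply: measurable_fun_powR_dist; last by move=> /=; apply.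
    exact: open_setC1_plane.
  by apply: open_measurable_plane; exact: open_setC1_plane.
have mfQ : measurable_fun Q (fun x : R * R => (`|x - s| `^ g)%:E).
  apply/measurable_EFinP; rewrite -(setUIDK Q [set s]).
  have ms : measurable [set s].
    rewrite -[X in measurable X]setCK; apply: measurableC.
    by apply: open_measurable_plane; exact: open_setC1_plane.
  apply/measurable_funU; [exact: measurableI|exact: measurableD|split].
    have [Qs|Qs] := pselect (Q s).
      by rewrite (_ : Q `&` _ = [set s]); [exact: measurable_fun_set1|apply/seteqP; split=> x /=; [case|move=> ->]].
    by rewrite (_ : Q `&` _ = set0); [exact: measurable_fun_set0|apply/seteqP; split=> x //= -[] /[swap] ->].
  by apply: mf => x [].
have := @negligible_integrable _ _ R mu2 Q N (fun x => (`|x - s| `^ g)%:E) mN mQ mfQ (plane_lines_null s).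
move=> HH; apply HH.
pose w1 := (fun t => `|t - s.1| `^ (g / 2)) \_ `[A, B].
pose w2 := (fun t => `|t - s.2| `^ (g / 2)) \_ `[C, D].
have iw1 : mu.-integrable setT (EFin \o w1).
  by rewrite -restrict_EFin; apply/(integrable_mkcond _ _).1 => //; exact: integrable_powR_dist.
have iw2 : mu.-integrable setT (EFin \o w2).
  by rewrite -restrict_EFin; apply/(integrable_mkcond _ _).1 => //; exact: integrable_powR_dist.
have mw1 : measurable_fun setT w1 by apply/measurable_EFinP; exact: measurable_int iw1.
have mw2 : measurable_fun setT w2 by apply/measurable_EFinP; exact: measurable_int iw2.
have iw : mu2.-integrable setT (EFin \o (fun x => w1 x.1 * w2 x.2)).
  apply/integrable12ltyP.
    apply/measurable_EFinP/measurable_funM.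
      by apply: measurableT_comp => //.
    by apply: measurableT_comp => //.
  have /integrableP[_ l1] := iw1.
  have /integrableP[_ l2] := iw2.
  have n1 := integrable_norm iw1.
  have n2 := integrable_norm iw2.
  pose K := (\int[mu]_y `|(w2 y)%:E|)%E.
  have KE : K = (fine K)%:E.
    by rewrite fineK//; apply: (integrable_fin_num _ n2).
  have -> : (fun x => \int[mu]_y `|(w1 x * w2 y)%:E|)%E =
      (fun x => (`|w1 x|)%:E * (fine K)%:E)%E.
    apply/funext => x; rewrite -KE /K -integralZl//=.
    by apply: eq_integral => y _; rewrite normrM EFinM.
  rewrite integralZr// KE; apply: lte_mul_pinfty => //.
    by apply: integral_ge0 => x _; rewrite lee_fin.
  exact: (integrable_fin_num _ n1).
  exact: ltry.
have mQN : measurable (Q `\` N) by exact: measurableD.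
have mfN : measurable_fun (Q `\` N) (fun x : R * R => (`|x - s| `^ g)%:E).
  by apply: measurable_funS mfQ => // x [].
have iwN : mu2.-integrable (Q `\` N) (EFin \o (fun x => w1 x.1 * w2 x.2)).
  by apply: integrableS iw.
have HL := @le_integrable _ _ R mu2 (Q `\` N) mQN (fun x => (`|x - s| `^ g)%:E) _ mfN _ iwN.
apply HL; clear HL.
move=> x [[/= x1 x2] nN]; rewrite lee_fin.
have n1 : x.1 != s.1 by apply/eqP => h; apply: nN; left.
have n2 : x.2 != s.2 by apply/eqP => h; apply: nN; right.
rewrite /w1 /w2 !patchE !mem_set//.
rewrite ger0_norm ?powR_ge0// ger0_norm ?mulr_ge0 ?powR_ge0//.
have p1 : 0 < `|x.1 - s.1| by rewrite normr_gt0 subr_eq0.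
have p2 : 0 < `|x.2 - s.2| by rewrite normr_gt0 subr_eq0.
have mm (u v : R) : 0 < u -> u <= v -> v `^ (g / 2) <= u `^ (g / 2).
  by move=> u0 uv; apply: powR_le_neg => //; lra.
rewrite {1}(splitr g) powRD; last by apply/implyP => _; rewrite normr_eq0 subr_eq0; apply/eqP => h; move: n1; rewrite h eqxx.
by apply: ler_pM; rewrite ?powR_ge0//; apply: mm => //; rewrite le_max lexx ?orbT.
Qed.

End plane.

(** * Fubini's theorem on slices *)

Section slices.
Variable R : realType.
Local Notation mu := (@lebesgue_measure R).
Local Notation mu2 := (mu \x mu)%E.

Lemma Rintegral_off_finite_set (F : R -> \bar R) (phi : R -> R) (N : set R) :
  finite_set N -> measurable_fun setT F -> (forall x, ~ N x -> F x = (phi x)%:E) ->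
  fine (\int[mu]_x F x)%E = \int[mu]_x phi x.
Proof.
move=> fN mF h.
have mphi : measurable_fun setT phi.
  apply: (measurable_fun_finite_exceptions measurableT fN).
  apply/measurable_EFinP.
  apply: eq_measurable_fun (measurable_funTS mF) => x; rewrite inE => -[_ Nx].
  exact: h.
congr fine; apply: ae_eq_integral => //.
  exact/measurable_EFinP.
exists N; split; [exact: finite_set_measurable|exact: lebesgue_measure_finite_set|].
by move=> x /= H2; apply: contrapT => Nx; apply: H2 => _; exact: h.
Qed.

(** The slice integrals need only be known for all but finitely many abscissas: the
line through the hinge is excluded in the applications. *)
Lemma Rintegral_vertical_slices (D : set (R * R)) (f : R * R -> R)
    (phi : R -> R) (N : set R) :
  measurable D -> mu2.-integrable D (EFin \o f) -> finite_set N ->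
  (forall x, ~ N x ->
    (\int[mu]_(y in [set y | D (x, y)]) (f (x, y))%:E = (phi x)%:E)%E) ->
  \int[mu2]_(x in D) f x = \int[mu]_x phi x.
Proof.
move=> mD iF fN H.
have iFD : mu2.-integrable setT ((EFin \o f) \_ D).
  by apply/(integrable_mkcond _ _).1.
rewrite /Rintegral integral_mkcond -integral12_prod_meas1//.
apply: (Rintegral_off_finite_set fN (measurable_fubini_F iFD)) => x Nx.
rewrite -H// integral_mkcond /fubini_F.
by apply: eq_integral => y _; rewrite !patchE.
Qed.

Lemma Rintegral_horizontal_slices (D : set (R * R)) (f : R * R -> R)
    (phi : R -> R) (N : set R) :
  measurable D -> mu2.-integrable D (EFin \o f) -> finite_set N ->
  (forall y, ~ N y ->
    (\int[mu]_(x in [set x | D (x, y)]) (f (x, y))%:E = (phi y)%:E)%E) ->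
  \int[mu2]_(x in D) f x = \int[mu]_y phi y.
Proof.
move=> mD iF fN H.
have iFD : mu2.-integrable setT ((EFin \o f) \_ D).
  by apply/(integrable_mkcond _ _).1.
rewrite /Rintegral integral_mkcond -integral21_prod_meas1//.
apply: (Rintegral_off_finite_set fN (measurable_fubini_G iFD)) => y Ny.
rewrite -H// integral_mkcond /fubini_G.
by apply: eq_integral => x _; rewrite !patchE.
Qed.

Lemma Rintegral_open_itv (a b : R) (phi : R -> R) :
  (forall x, a <= x <= b -> {for x, continuous phi}) ->
  mu.-integrable `]a, b[%classic (EFin \o phi) /\
  \int[mu]_(x in `]a, b[) phi x = \int[mu]_(x in `[a, b]) phi x.
Proof.
move=> c; have i : mu.-integrable `[a, b]%classic (EFin \o phi).
  apply: continuous_compact_integrable; first exact: segment_compact.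
  by apply: continuous_in_subspaceT => x; rewrite inE/= in_itv/=; exact: c.
have io : mu.-integrable `]a, b[%classic (EFin \o phi).
  by apply: integrableS i => //; exact: subset_itv_oo_cc.
have ic : mu.-integrable `[a, b[%classic (EFin \o phi).
  by apply: integrableS i => //; exact: subset_itv_co_cc.
split; first exact: io.
by rewrite (Rintegral_itv_obnd_cbnd io) (Rintegral_itv_bndo_bndc ic).
Qed.

(** The set of x is the open interval with end points p and p + k l, in the order
given by the sign of k; describing it by (x - p) / k treats both signs alike. *)
Lemma Rintegral_affine (p k l : R) (phi : R -> R) : 0 < l -> k != 0 ->
  (forall r, 0 <= r <= l -> {for p + k * r, continuous phi}) ->
  mu.-integrable [set x | 0 < (x - p) / k < l] (EFin \o phi) /\
  \int[mu]_(x in [set x | 0 < (x - p) / k < l]) phi x =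
    `|k| * \int[mu]_(r in `[0, l]) phi (p + k * r).
Proof.
move=> l0 k0 cphi.
pose F r := p + k * r.
have FK x : F ((x - p) / k) = x by rewrite /F mulrC divfK// subrKC.
have dF (r : R) : is_derive r 1 F k.
  by rewrite /F; apply: is_derive_eq; rewrite add0r mul1r [LHS]mulr1.
have F'E : F^`()%classic = cst k.
  by apply/funext => r; rewrite derive1E; case: (dF r).
have cF r : {for r, continuous F}.
  by apply: differentiable_continuous; apply/derivable1_diffP; case: (dF r).
have cphiF r : 0 <= r <= l -> {for r, continuous (phi \o F)}.
  by move=> rl; apply: continuous_comp; [exact: cF|exact: cphi].
have iphi : mu.-integrable `[0, l]%classic (EFin \o (phi \o F)).
  apply: continuous_compact_integrable; first exact: segment_compact.
  by apply: continuous_in_subspaceT => x; rewrite inE/= in_itv/=; exact: cphiF.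
have dLR : derivable_oo_LRcontinuous F 0 l.
  split=> [x _||].
  - by case: (dF x).
  - by apply: cvg_at_right_filter; exact: cF.
  - by apply: cvg_at_left_filter; exact: cF.
have cc r : `|k| = r -> \int[mu]_(x in `[0, l]) ((phi \o F) x * r) =
    `|k| * \int[mu]_(x in `[0, l]) phi (F x).
  move=> <-; rewrite RintegralZr//; first exact: mulrC.
have [kp|kn|k00] := ltgtP 0 k; last by move: k0; rewrite -k00 eqxx.
- have Fr x : 0 <= (x - p) / k <= l = (F 0 <= x <= F l).
    by rewrite /F mulr0 addr0 ler_pdivlMr// ler_pdivrMr// mul0r subr_ge0 lerBlDl [l * k]mulrC.
  have -> : [set x | 0 < (x - p) / k < l] = `]F 0, F l[%classic.
    apply/seteqP; split=> x /=; rewrite in_itv/= /F mulr0 addr0;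
    by rewrite ltr_pdivlMr// ltr_pdivrMr// mul0r subr_gt0 ltrBlDl [l * k]mulrC.
  have cE x : F 0 <= x <= F l -> {for x, continuous phi}.
    by rewrite -Fr => h; rewrite -(FK x); exact: cphi.
  have [mo moE] := Rintegral_open_itv cE; split; first exact: mo.
  rewrite -(cc k (gtr0_norm kp)) moE.
  congr fine; rewrite integration_by_substitution_increasing ?F'E//.
  + exact: ltW.
  + by move=> x y _ _ xy; rewrite /F ltrD2l ltr_pM2l.
  + by move=> x _; exact: cvg_cst.
  + exact: is_cvg_cst.
  + exact: is_cvg_cst.
  + by apply: continuous_in_subspaceT => x; rewrite inE/= in_itv/=; exact: cE.
- have Fr x : 0 <= (x - p) / k <= l = (F l <= x <= F 0).
    rewrite /F mulr0 addr0 ler_ndivlMr// ler_ndivrMr// mul0r subr_le0 lerBrDl [l * k]mulrC.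
    by rewrite andbC.
  have -> : [set x | 0 < (x - p) / k < l] = `]F l, F 0[%classic.
    apply/seteqP; split=> x /=; rewrite in_itv/= /F mulr0 addr0;
    by rewrite ltr_ndivlMr// ltr_ndivrMr// mul0r subr_lt0 ltrBrDl [l * k]mulrC andbC.
  have cE x : F l <= x <= F 0 -> {for x, continuous phi}.
    by rewrite -Fr => h; rewrite -(FK x); exact: cphi.
  have [mo moE] := Rintegral_open_itv cE; split; first exact: mo.
  rewrite -(cc (- k) (ltr0_norm kn)) moE.
  congr fine; rewrite integration_by_substitution_decreasing ?F'E//.
  + exact: ltW.
  + by move=> x y _ _ xy; rewrite /F ltrD2l ltr_nM2l.
  + by move=> x _; exact: cvg_cst.
  + exact: is_cvg_cst.
  + exact: is_cvg_cst.
  + by apply: continuous_in_subspaceT => x; rewrite inE/= in_itv/=; exact: cE.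
Qed.

(** The abscissas (or ordinates) of the points of a ray of length l, with direction
cosine k: a ray orthogonal to the axis has k = 0 and contributes nothing, and the
sign of k tells on which side of the ray the region of integration lies. *)
Lemma Rintegral_ray (p k l : R) (phi : R -> R) : 0 < l ->
  (k != 0 -> forall r, 0 <= r <= l -> {for p + k * r, continuous phi}) ->
  let g x := Num.sg k * (if 0 < (x - p) / k < l then phi x else 0) in
  mu.-integrable setT (EFin \o g) /\
  \int[mu]_x g x = k * \int[mu]_(r in `[0, l]) phi (p + k * r).
Proof.
move=> l0 cphi g.
have [k0|k0] := eqVneq k 0.
  have -> : g = cst 0 by apply/funext => x; rewrite /g k0 sgr0 mul0r.
  split; first exact: integrable0.
  by rewrite k0 mul0r Rintegral_cst ?mul0r.
pose J := [set x | 0 < (x - p) / k < l].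
have [iJ eJ] := Rintegral_affine l0 k0 (cphi k0).
have mJ : measurable J.
  have c : continuous (fun x => (x - p) / k).
    by move=> x; apply: cvgM; [apply: cvgB; [exact: cvg_id|exact: cvg_cst]|exact: cvg_cst].
  rewrite (_ : J = (fun x => (x - p) / k) @^-1` `]0, l[%classic); last first.
    by apply/seteqP; split=> x /=; rewrite in_itv.
  by rewrite -[X in measurable X]setTI; apply: (continuous_measurable_fun c).
have gE : g = (fun x => Num.sg k * (phi \_ J) x).
  apply/funext => x; rewrite /g patchE; congr (_ * _).
  by case: ifPn => h; [rewrite mem_set|rewrite memNset//; apply/negP].
have iJT : mu.-integrable setT (EFin \o (phi \_ J)).
  by rewrite -restrict_EFin; apply/(integrable_mkcond _ _).1.
split.
  rewrite gE (_ : EFin \o _ = (fun x => (Num.sg k)%:E * (EFin \o (phi \_ J)) x)%E)//.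
  exact: integrableZl.
rewrite gE RintegralZl// -Rintegral_mkcond -/J eJ mulrA; congr (_ * _).
by rewrite -numEsg.
Qed.

End slices.

(** * Calculus of functions that are C1 near a point *)

Section near_equality.

Lemma near_eq_continuous (T U : topologicalType) (h k : T -> U) (y : T) :
  (\near y, h y = k y) -> {for y, continuous k} -> {for y, continuous h}.
Proof.
move=> hk ck.
have e : h y = k y by exact: nbhs_singleton hk.
rewrite /prop_for /continuous_at e; apply: cvg_trans ck.
by apply: near_eq_cvg; apply: filterS hk => z /= ->.
Qed.

Lemma near0_differentiable (R : realType) (V : normedModType R) (h : V -> R) (x : V) :
  (\near x, h x = 0) -> differentiable h x.
Proof.
move=> h0.
have e : h \o shift x = cst (h x) + (\0 : {linear V -> R}) +o_0 id.
  apply/eqaddoP => eps eps0.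
  have : \forall y \near (0 : V), h (y + x) = 0.
    have := h0; rewrite (near_shift 0 x) /=; apply: filterS => y /=.
    by rewrite subr0.
  apply: filterS => y hy.
  rewrite /= !fctE /= hy (nbhs_singleton h0) addr0 subr0 normr0.
  by apply: mulr_ge0 => //; exact: ltW.
have c0 : continuous (\0 : {linear V -> R}) by move=> y; exact: cvg_cst.
apply/diff_locallyP; rewrite (diff_unique c0 e); split => //.
Qed.

Lemma near_eq_differentiable (R : realType) (V : normedModType R) (f g : V -> R) (x : V) :
  (\near x, f x = g x) -> differentiable g x -> differentiable f x.
Proof.
move=> fg dg; have -> : f = g + (f - g) by apply/funext => y; rewrite !fctE subrKC.
apply: differentiableD => //; apply: near0_differentiable.
by apply: filterS fg => y; rewrite !fctE => ->; rewrite subrr.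
Qed.

End near_equality.

Section C1_near_theory.
Variable R : realType.
Implicit Types (f g : R * R -> R) (x y v : R * R).

Lemma C1_near_differentiable f x : C1_near f x -> differentiable f x.
Proof. by move=> /nbhs_singleton[]. Qed.

Lemma C1_near_continuous f x : C1_near f x -> {for x, continuous f}.
Proof. by move=> /C1_near_differentiable /differentiable_continuous. Qed.

Lemma C1_near_partial f x j : C1_near f x ->
  {for x, continuous (fun w => 'D_(axis R j) f w)}.
Proof. by move=> /nbhs_singleton[]. Qed.

Lemma C1_near_derivable f x v : C1_near f x -> derivable f x v.
Proof. by move=> /C1_near_differentiable h; exact: diff_derivable. Qed.

(** Continuity of the partial derivatives has to be transported along an equality
that holds only near x, hence the passage to a neighbourhood of each nearby y. *)
Lemma C1_near_intro f (D : 'I_2 -> R * R -> R) x :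
  (\forall y \near x, differentiable f y /\
    forall j, 'D_(axis R j) f y = D j y /\ {for y, continuous (D j)}) ->
  C1_near f x.
Proof.
move=> h; have := near_join h; apply: filterS => y hy.
have [df _] := nbhs_singleton hy; split=> // j.
apply: (@near_eq_continuous _ _ _ (D j)).
  by apply: filterS hy => w [_ /(_ j)[]].
by have [_ /(_ j)[]] := nbhs_singleton hy.
Qed.

Lemma C1_near_eq f g x : (\near x, f x = g x) -> C1_near g x -> C1_near f x.
Proof.
move=> fg cg; apply: (@C1_near_intro _ (fun j w => 'D_(axis R j) g w)).
apply: filterS2 (near_join fg) cg => y fgy [dg cgy].
split; first exact: near_eq_differentiable fgy dg.
by move=> j; split; [exact: near_eq_derive|exact: cgy].
Qed.

(** This and the next lemma fix the filter of neighbourhoods in the product R * R,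
which unification does not find. *)
Lemma near_everywhere (P : R * R -> Prop) x : (forall y, P y) -> \forall y \near x, P y.
Proof. by move=> h; exact: (@filterE _ (nbhs x) _ P h). Qed.

Lemma near_imply (P Q : R * R -> Prop) x : (forall y, P y -> Q y) ->
  (\forall y \near x, P y) -> \forall y \near x, Q y.
Proof. by move=> h; exact: (@filterS _ (nbhs x) _ P Q h). Qed.

Lemma C1_near_cst (a : R) x : C1_near (fun=> a) x.
Proof.
apply: (@C1_near_intro _ (fun _ _ => 0)); apply: near_everywhere => y.
split; first exact: differentiable_cst.
by move=> j; split; [exact: derive_cst|exact: cvg_cst].
Qed.

Lemma C1_nearD f g x : C1_near f x -> C1_near g x ->
  C1_near (fun y => f y + g y) x.
Proof.
move=> cf cg.
apply: (@C1_near_intro _ (fun j w => 'D_(axis R j) f w + 'D_(axis R j) g w)).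
apply: filterS2 cf cg => y [df pf] [dg pg].
split; first exact: differentiableD.
move=> j; split; last by apply: cvgD; [exact: pf|exact: pg].
by apply: deriveD; exact: diff_derivable.
Qed.

Lemma derive_mul f g x v : differentiable f x -> differentiable g x ->
  'D_v (fun y => f y * g y) x = f x * 'D_v g x + g x * 'D_v f x.
Proof. by move=> df dg; apply: deriveM; exact: diff_derivable. Qed.

Lemma C1_nearM f g x : C1_near f x -> C1_near g x ->
  C1_near (fun y => f y * g y) x.
Proof.
move=> cf cg.
apply: (@C1_near_intro _ (fun j w => f w * 'D_(axis R j) g w + g w * 'D_(axis R j) f w)).
apply: filterS2 cf cg => y [df pf] [dg pg].
split; first exact: differentiableM.
move=> j; split; first exact: derive_mul.
apply: cvgD; apply: cvgM; [exact: differentiable_continuous|exact: pg|exact: differentiable_continuous|exact: pf].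
Qed.

Lemma C1_near_prod (I : Type) (s : seq I) (F : I -> R * R -> R) x :
  (forall i, C1_near (F i) x) -> C1_near (fun y => \prod_(i <- s) F i y) x.
Proof.
move=> cF; elim: s => [|i s IH].
  by apply: C1_near_eq (C1_near_cst 1 x); apply: near_everywhere => y; rewrite big_nil.
apply: C1_near_eq (C1_nearM (cF i) IH); apply: near_everywhere => y; exact: big_cons.
Qed.

Lemma C1_near_sum2 (F : 'I_2 -> R * R -> R) x :
  (forall i, C1_near (F i) x) -> C1_near (fun y => \sum_(i < 2) F i y) x.
Proof.
move=> cF; apply: C1_near_eq (C1_nearD (cF ord0) (cF (lift ord0 ord0))).
by apply: near_everywhere => y; rewrite big_ord_recl big_ord1.
Qed.

Lemma derive_comp1 f (h : R -> R) (dh : R) x v :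
  differentiable f x -> is_derive (f x) (1 : R) h dh ->
  differentiable (fun y => h (f y)) x /\ 'D_v (fun y => h (f y)) x = dh * 'D_v f x.
Proof.
move=> df [/derivable1_diffP dfh dhE].
have dc : differentiable (h \o f) x by exact: differentiable_comp.
split => //.
rewrite -[fun y => h (f y)]/(h \o f) deriveE// diff_comp//= diff1E// derive1E dhE.
by rewrite -deriveE// mulrC.
Qed.

Lemma C1_near_comp1 f (h dh : R -> R) x :
  C1_near f x -> (forall t : R, is_derive t (1 : R) h (dh t)) -> continuous dh ->
  C1_near (fun y => h (f y)) x.
Proof.
move=> cf hh cdh.
apply: (@C1_near_intro _ (fun j w => dh (f w) * 'D_(axis R j) f w)).
apply: filterS cf => y [df pf]; split.
  by have [] := derive_comp1 (axis R 0) df (hh (f y)).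
move=> j; split; first by have [] := derive_comp1 (axis R j) df (hh (f y)).
apply: cvgM; last exact: pf.
by apply: continuous_comp; [exact: differentiable_continuous|exact: cdh].
Qed.

Lemma differentiable_fst x : differentiable (fun y : R * R => y.1) x.
Proof.
by apply: (@linear_differentiable _ _ _ (@fst R R : {linear (R * R)%type -> R})) => y; exact: cvg_fst.
Qed.

Lemma differentiable_snd x : differentiable (fun y : R * R => y.2) x.
Proof.
by apply: (@linear_differentiable _ _ _ (@snd R R : {linear (R * R)%type -> R})) => y; exact: cvg_snd.
Qed.

Lemma derive_fst x v : 'D_v (fun y : R * R => y.1) x = v.1.
Proof.
rewrite deriveE; last exact: differentiable_fst.
rewrite (@diff_lin _ _ _ (@fst R R : {linear (R * R)%type -> R}))//.
by move=> y; exact: cvg_fst.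
Qed.

Lemma derive_snd x v : 'D_v (fun y : R * R => y.2) x = v.2.
Proof.
rewrite deriveE; last exact: differentiable_snd.
rewrite (@diff_lin _ _ _ (@snd R R : {linear (R * R)%type -> R}))//.
by move=> y; exact: cvg_snd.
Qed.

Lemma C1_near_fst x : C1_near (fun y => y.1) x.
Proof.
apply: (@C1_near_intro _ (fun j _ => (axis R j).1)); apply: near_everywhere => y.
split; first exact: differentiable_fst.
by move=> j; split; [exact: derive_fst|exact: cvg_cst].
Qed.

Lemma C1_near_snd x : C1_near (fun y => y.2) x.
Proof.
apply: (@C1_near_intro _ (fun j _ => (axis R j).2)); apply: near_everywhere => y.
split; first exact: differentiable_snd.
by move=> j; split; [exact: derive_snd|exact: cvg_cst].
Qed.

Lemma derive_partials f x v : differentiable f x ->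
  'D_v f x = v.1 * 'D_(axis R 0) f x + v.2 * 'D_(axis R 1) f x.
Proof.
move=> df; rewrite !deriveE//.
have e : v = v.1 *: axis R 0 + v.2 *: axis R 1.
  by case: v => a b; congr (_, _); rewrite /axis /= /GRing.scale/= ?mulr1 ?mulr0 ?addr0 ?add0r.
by rewrite {1}e linearD !linearZ.
Qed.

End C1_near_theory.

(** * Line sections of a circular sector *)

Section sector.
Variable R : realType.
Implicit Types w l X t : R.

(** The leaflet in Cartesian coordinates, with X horizontal and t downwards from the
hinge: the first two conditions say that the polar angle lies between w1 and w2,
and the tangent is avoided so that the vertex is included. *)
Definition sector (w1 w2 l X t : R) :=
  [/\ 0 <= X * cos w1 - t * sin w1, 0 <= t * sin w2 - X * cos w2
    & X ^+ 2 + t ^+ 2 <= l ^+ 2].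

(** The reflection across the vertical axis, which reduces the case X < 0 to X > 0. *)
Lemma sector_opp (w1 w2 l X t : R) :
  sector w1 w2 l X t <-> sector (- w2) (- w1) l (- X) t.
Proof.
rewrite /sector !cosN !sinN sqrrN; split=> -[h1 h2 h3]; split => //; lra.
Qed.

Variables (w1 w2 l : R).
Hypotheses (w1N : - (pi / 2) < w1) (w12 : w1 < w2) (w2N : w2 < pi / 2) (l0 : 0 < l).

Lemma cos1_gt0 : 0 < cos w1.
Proof. by apply: cos_gt0_pihalf; rewrite w1N (lt_trans w12). Qed.

Lemma cos2_gt0 : 0 < cos w2.
Proof. by apply: cos_gt0_pihalf; rewrite w2N (lt_trans _ w12). Qed.

(** The left-hand side is the sine of the aperture w2 - w1, between 0 and pi. *)
Lemma sector_aperture : 0 < sin w2 * cos w1 - cos w2 * sin w1.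
Proof.
rewrite -sinB; apply: sin_gt0_pi; apply/andP; split.
  by rewrite subr_gt0.
have := pi_gt0 R; have := w1N; have := w2N; lra.
Qed.

Lemma sector_t_ge0 X t : sector w1 w2 l X t -> 0 <= t.
Proof.
move=> [h1 h2 _]; have := sector_aperture; have := cos1_gt0; have := cos2_gt0 => c2 c1 s.
have : 0 <= t * (sin w2 * cos w1 - cos w2 * sin w1).
  have -> : t * (sin w2 * cos w1 - cos w2 * sin w1) =
    (t * sin w2 - X * cos w2) * cos w1 + (X * cos w1 - t * sin w1) * cos w2 by ring.
  by apply: addr_ge0; apply: mulr_ge0 => //; exact: ltW.
by rewrite pmulr_lge0.
Qed.

Let sqr_lt (a b : R) : 0 <= b -> (a ^+ 2 < b ^+ 2) = (- b < a < b).
Proof. by move=> b0; rewrite -(@real_normK _ a) ?num_real// ltr_sqr ?nnegrE// ltr_norml. Qed.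

Let sqr_le (a b : R) : 0 <= b -> (a ^+ 2 <= b ^+ 2) = (- b <= a <= b).
Proof. by move=> b0; rewrite -(@real_normK _ a) ?num_real// ler_sqr ?nnegrE// ler_norml. Qed.

(** A horizontal line meets the sector in a segment [A, B] (empty if B < A), whose
ends are on the two straight sides or on the arc.  If phi vanishes on the arc,
the difference of its values at the ends only sees the points where the line
meets the straight sides, at distance t / cos w from the vertex.  This also holds
when both ends are on the arc or the segment is empty, where all terms vanish. *)
Lemma sector_horizontal t : 0 < t -> exists A B,
  (forall X, sector w1 w2 l X t <-> A <= X <= B) /\
  forall phi : R -> R,
    (forall X, sector w1 w2 l X t -> X ^+ 2 + t ^+ 2 = l ^+ 2 -> phi X = 0) ->
    (if A <= B then phi A - phi B else 0) =
    (if 0 < t / cos w1 < l then phi (t / cos w1 * sin w1) else 0)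
    - (if 0 < t / cos w2 < l then phi (t / cos w2 * sin w2) else 0).
Proof.
move=> t0.
have c1 := cos1_gt0; have c2 := cos2_gt0; have ap := sector_aperture.
have l0' := l0.
have r0 w : 0 < cos w -> 0 < t / cos w by move=> c0; exact: divr_gt0.
have E w : 0 < cos w -> (t / cos w * sin w) ^+ 2 + t ^+ 2 = (t / cos w) ^+ 2.
  move=> c0; have := cos2Dsin2 w.
  have {2}-> : t = t / cos w * cos w by rewrite divfK// gt_eqF.
  by move=> h; rewrite -[RHS]mulr1 -h !exprMn; ring.
have tl w : 0 < cos w -> t <= t / cos w.
  move=> c0; rewrite ler_pdivlMr// -[leRHS]mulr1 ler_pM2l//; exact: cos_le1.
rewrite !r0//=.
pose a w := t / cos w * sin w.
have P1 X : (0 <= X * cos w1 - t * sin w1) = (a w1 <= X).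
  by rewrite subr_ge0 /a mulrAC ler_pdivrMr.
have P2 X : (0 <= t * sin w2 - X * cos w2) = (X <= a w2).
  by rewrite subr_ge0 /a mulrAC ler_pdivlMr.
have a12 : a w1 < a w2.
  rewrite -subr_gt0 /a.
  have -> : t / cos w2 * sin w2 - t / cos w1 * sin w1 =
     t / (cos w1 * cos w2) * (sin w2 * cos w1 - cos w2 * sin w1).
    by field; rewrite !gt_eqF.
  by apply: mulr_gt0 => //; apply: divr_gt0 => //; exact: mulr_gt0.
have [tl0|tl0] := ltP l t.
  exists 1, 0; split.
    move=> X; split; last by move=> /andP[? ?]; lra.
    by move=> [_ _ h]; have := sqr_ge0 X; nra.
  move=> phi _; have -> : (1 <= 0 :> R) = false by apply/negbTE; rewrite -ltNge; lra.
  have := tl _ c1; have := tl _ c2 => ? ?.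
  by rewrite !ifF; [lra|apply/negbTE; rewrite -leNgt; lra|apply/negbTE; rewrite -leNgt; lra].
pose s := Num.sqrt (l ^+ 2 - t ^+ 2).
have s2 : s ^+ 2 = l ^+ 2 - t ^+ 2 by rewrite sqr_sqrtr// subr_ge0; nra.
have s0 : 0 <= s by exact: sqrtr_ge0.
have I w : 0 < cos w -> (t / cos w < l) = (- s < a w < s).
  move=> c0; rewrite -sqr_lt// s2 /a ltrBrDr E// ltr_sqr ?nnegrE ?(ltW (r0 _ c0)) ?(ltW l0')//.
have P3 X : (X ^+ 2 + t ^+ 2 <= l ^+ 2) = (- s <= X <= s).
  by rewrite -lerBrDr -s2 sqr_le.
pose A : R := Num.max (a w1) (- s).
pose B : R := Num.min (a w2) s.
exists A, B; rewrite /A /B; split.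
  move=> X; rewrite /sector P1 P2 P3 ge_max le_min; split.
    by move=> [-> -> /andP[-> ->]].
  by move=> /andP[/andP[-> ->] /andP[-> ->]].
move=> phi H; rewrite !I// -/(a w1) -/(a w2).
have arc X : a w1 <= X -> X <= a w2 -> X = s \/ X = - s -> phi X = 0.
  move=> X1 X2 Xs; have Xs2 : X ^+ 2 = s ^+ 2 by case: Xs => ->; rewrite ?sqrrN.
  apply: H; last by rewrite Xs2 s2 subrK.
  rewrite /sector P1 P2 P3 X1 X2; split => //.
  by case: Xs => ->; rewrite ?lexx ?andbT /=; lra.
have F1 : Num.max (a w1) (- s) <= Num.min (a w2) s ->
    phi (Num.max (a w1) (- s)) = if - s < a w1 < s then phi (a w1) else 0.
  rewrite le_min !ge_max => /andP[/andP[_ h2] /andP[h3 h4]].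
  case: ifP => [/andP[u _]|u]; first by rewrite max_l// ltW.
  have [v|v] := leP (a w1) (- s); first by apply: arc => //; right.
  apply: arc => //; first exact: ltW.
  left; apply/eqP; rewrite eq_le h3/= leNgt; apply/negP => ?.
  by move/negP: u; apply; apply/andP.
have F2 : Num.max (a w1) (- s) <= Num.min (a w2) s ->
    phi (Num.min (a w2) s) = if - s < a w2 < s then phi (a w2) else 0.
  rewrite le_min !ge_max => /andP[/andP[_ h2] /andP[h3 h4]].
  case: ifP => [/andP[_ u]|u]; first by rewrite min_l// ltW.
  have [v|v] := leP (a w2) s; last by apply: arc; rewrite ?(ltW v)//; left.
  apply: arc => //; first exact: ltW.
  have [vs|vs] := ltP (a w2) s; last by left; apply/eqP; rewrite eq_le v.
  right; apply/eqP; rewrite eq_le h2 andbT leNgt; apply/negP => ?.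
  by move/negP: u; apply; apply/andP.
case: ifP => [h|/negP h]; first by rewrite F1// F2.
rewrite le_min !ge_max in h.
rewrite !ifF ?subrr//; apply/negP => /andP[? ?]; apply: h; apply/andP; split; apply/andP; split; lra.
Qed.

Let le_sqrt (t d : R) : 0 < t -> (t <= Num.sqrt d) = (t ^+ 2 <= d).
Proof.
move=> t0; have [d0|d0] := leP d 0.
  rewrite ler0_sqrtr// leNgt t0; apply/esym/negbTE; rewrite -ltNge.
  by apply: le_lt_trans d0 _; exact: exprn_gt0.
rewrite -[in LHS](ger0_norm (ltW t0)) -sqrtr_sqr ler_sqrt//; exact: ltW.
Qed.

Let lt_sqrt (t d : R) : 0 < t -> (t < Num.sqrt d) = (t ^+ 2 < d).
Proof.
move=> t0; have [d0|d0] := leP d 0.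
  rewrite ler0_sqrtr// ltNge (ltW t0); apply/esym/negbTE; rewrite -leNgt.
  by apply: le_trans d0 _; rewrite exprn_ge0// ltW.
by rewrite -[in LHS](ger0_norm (ltW t0)) -sqrtr_sqr ltr_sqrt.
Qed.

(** For a vertical line at X > 0 the upper end of the segment, where t is least, is
always on the side w2 (which X > 0 meets only if sin w2 > 0); the lower end is on
the side w1 if this side leans to the right and is met before the arc, and on the
arc otherwise. *)
Lemma sector_vertical_pos X : 0 < X -> exists A B,
  (forall t, sector w1 w2 l X t <-> A <= t <= B) /\
  forall phi : R -> R,
    (forall t, sector w1 w2 l X t -> X ^+ 2 + t ^+ 2 = l ^+ 2 -> phi t = 0) ->
    (if A <= B then phi A - phi B else 0) =
    (if 0 < X / sin w2 < l then phi (X / sin w2 * cos w2) else 0)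
    - (if 0 < X / sin w1 < l then phi (X / sin w1 * cos w1) else 0).
Proof.
move=> X0.
have c1 := cos1_gt0; have c2 := cos2_gt0; have ap := sector_aperture.
have l0' := l0.
have [s2|s2] := leP (sin w2) 0.
  have s1 : sin w1 <= 0.
    have : sin w2 * cos w1 <= 0 by rewrite pmulr_lle0.
    move=> h; have : cos w2 * sin w1 <= 0 by lra.
    by rewrite pmulr_rle0.
  exists 1, 0; split.
    move=> t; split; last by move=> /andP[? ?]; lra.
    move=> h; have t0 := sector_t_ge0 h; case: h => _ h _.
    have : t * sin w2 <= 0 by rewrite mulr_ge0_le0.
    have : 0 < X * cos w2 by exact: mulr_gt0.
    lra.
  move=> phi _; have -> : (1 <= 0 :> R) = false by apply/negbTE; rewrite -ltNge; lra.
  have q w : sin w <= 0 -> (0 < X / sin w < l) = false.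
    by move=> sw; apply/negbTE/negP => /andP[h _]; move: h; rewrite pmulr_rgt0// invr_gt0 ltNge sw.
  by rewrite !q// subrr.
have E w : 0 < sin w -> (X / sin w * cos w) ^+ 2 + X ^+ 2 = (X / sin w) ^+ 2.
  move=> c0; have := cos2Dsin2 w.
  have {2}-> : X = X / sin w * sin w by rewrite divfK// gt_eqF.
  by move=> h; rewrite -[RHS]mulr1 -h !exprMn; ring.
have r0 w : 0 < sin w -> 0 < X / sin w by move=> h; exact: divr_gt0.
pose b w := X / sin w * cos w.
pose q := Num.sqrt (l ^+ 2 - X ^+ 2).
have q0 : 0 <= q by exact: sqrtr_ge0.
have P3 t : 0 < t -> (X ^+ 2 + t ^+ 2 <= l ^+ 2) = (t <= q).
  by move=> t0; rewrite addrC -lerBrDr /q le_sqrt.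
have I w : 0 < sin w -> 0 < cos w -> (X / sin w < l) = (b w < q).
  move=> sw cw; have bw : 0 < b w by apply: mulr_gt0 => //; exact: r0.
  rewrite /q lt_sqrt// ltrBrDr /b E// ltr_sqr ?nnegrE ?(ltW (r0 _ sw)) ?(ltW l0')//.
have P2 t : (0 <= t * sin w2 - X * cos w2) = (b w2 <= t).
  by rewrite subr_ge0 /b mulrAC ler_pdivrMr.
have P1 t : 0 < sin w1 -> (0 <= X * cos w1 - t * sin w1) = (t <= b w1).
  by move=> s1; rewrite subr_ge0 /b mulrAC ler_pdivlMr.
have P1' t : 0 <= t -> sin w1 <= 0 -> 0 <= X * cos w1 - t * sin w1.
  move=> t0 s1; have : t * sin w1 <= 0 by rewrite mulr_ge0_le0.
  have : 0 < X * cos w1 by exact: mulr_gt0.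
  lra.
have b20 : 0 < b w2 by apply: mulr_gt0 => //; exact: r0.
have b21 : 0 < sin w1 -> b w2 < b w1.
  move=> s1; rewrite -subr_gt0 /b.
  have -> : X / sin w1 * cos w1 - X / sin w2 * cos w2 =
     X / (sin w1 * sin w2) * (sin w2 * cos w1 - cos w2 * sin w1).
    by field; rewrite !gt_eqF.
  by apply: mulr_gt0 => //; apply: divr_gt0 => //; exact: mulr_gt0.
pose B := if 0 < sin w1 then Num.min (b w1) q else q.
have secE t : sector w1 w2 l X t <-> b w2 <= t <= B.
  rewrite /sector P2 /B; split.
    move=> [h1 h2 h3]; rewrite h2/=; move: h3; rewrite P3; last by lra.
    by case: ifP => // s1; rewrite P1// in h1; rewrite le_min h1.
  move=> /andP[h2]; rewrite P3; last by lra.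
  case: ifPn => s1.
    by rewrite le_min P1// => /andP[-> ->].
  by rewrite -leNgt in s1; move=> ->; split=> //; apply: P1' => //; lra.
exists (b w2), B; split => // phi H.
have arc t : b w2 <= t <= B -> t = q -> phi t = 0.
  move=> tB tq; apply: H; first exact/secE.
  rewrite tq sqr_sqrtr; first by rewrite subrKC.
  rewrite leNgt; apply/negP => h; have : q = 0 by apply: ltr0_sqrtr.
  by rewrite -tq => t0; move: tB; rewrite t0 => /andP[? _]; lra.
rewrite (r0 w2)//= (I w2)// -/(b w2) -/(b w1).
have i1 : (0 < X / sin w1 < l) = (0 < sin w1) && (b w1 < q).
  have [s1|s1] := ltP 0 (sin w1); first by rewrite r0//= I.
  apply/negbTE/negP => /andP[h _]; move: h; rewrite pmulr_rgt0// invr_gt0 ltNge s1 //.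
rewrite i1.
have [u2|u2] := ltP (b w2) q.
  have bB : b w2 <= B.
    by rewrite /B; case: ifP => s1; rewrite ?le_min ?(ltW u2) ?andbT // ltW// b21.
  rewrite bB; congr (_ - _).
  have BB : b w2 <= B <= B by rewrite bB lexx.
  case: ifP => [/andP[s1 u1]|u1].
    by rewrite /B s1 min_l// ltW.
  apply: (arc _ BB); rewrite /B; case: ifP => // s1.
  by move: u1; rewrite s1 /= => /negbT; rewrite -leNgt => ?; rewrite min_r.
have Bq : B <= q by rewrite /B; case: ifP => // _; rewrite ge_min lexx orbT.
have n1 : (0 < sin w1) && (b w1 < q) = false.
  by apply/negbTE/negP => /andP[/b21 ? ?]; lra.
rewrite n1 subr0; case: ifP => // bB.
have e1 : b w2 = q by apply/eqP; rewrite eq_le u2 (le_trans bB Bq).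
have e2 : B = q by apply/eqP; rewrite eq_le Bq -e1.
by rewrite e2 e1 subrr.
Qed.

End sector.

(** The signs account for the side of each ray on which the sector lies, according to
whether the ray leans to the left or to the right. *)
Lemma sector_vertical (R : realType) (w1 w2 l X : R) :
  - (pi / 2) < w1 -> w1 < w2 -> w2 < pi / 2 -> 0 < l -> X != 0 -> exists A B,
  (forall t, sector w1 w2 l X t <-> A <= t <= B) /\
  forall phi : R -> R,
    (forall t, sector w1 w2 l X t -> X ^+ 2 + t ^+ 2 = l ^+ 2 -> phi t = 0) ->
    (if A <= B then phi A - phi B else 0) =
    Num.sg (sin w2) * (if 0 < X / sin w2 < l then phi (X / sin w2 * cos w2) else 0)
    - Num.sg (sin w1) * (if 0 < X / sin w1 < l then phi (X / sin w1 * cos w1) else 0).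
Proof.
move=> h1 h2 h3 l0.
have S (Y w a : R) : 0 < Y -> Num.sg (sin w) * (if 0 < Y / sin w < l then a else 0) =
   if 0 < Y / sin w < l then a else 0.
  move=> Y0; case: ifP; last by rewrite mulr0.
  by rewrite pmulr_rgt0// invr_gt0 => /andP[s0 _]; rewrite gtr0_sg// mul1r.
move=> Xn0; have [X0|X0|X0] := ltgtP X 0; last first.
- by rewrite X0 eqxx in Xn0.
- have [A [B [H1 H2]]] := sector_vertical_pos h1 h2 h3 l0 X0.
  by exists A, B; split => // phi Hphi; rewrite !S//; exact: H2.
have X0' : 0 < - X by rewrite oppr_gt0.
have h1' : - (pi / 2) < - w2 by rewrite ltrN2.
have h3' : - w1 < pi / 2 by rewrite ltrNl.
have h2' : - w2 < - w1 by rewrite ltrN2.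
have [A [B [H1 H2]]] := sector_vertical_pos h1' h2' h3' l0 X0'.
exists A, B; split.
  by move=> t; rewrite sector_opp.
move=> phi Hphi; rewrite H2; last first.
  by move=> t /sector_opp; rewrite !opprK sqrrN; exact: Hphi.
rewrite -(S (- X) (- w1))// -(S (- X) (- w2))// !sinN !cosN !sgrN.
by rewrite !invrN !mulrNN !mulNr opprK addrC.
Qed.

(** * The fundamental theorem of calculus on a slice *)

Section slice.
Variable R : realType.
Local Notation mu := (@lebesgue_measure R).
Implicit Types (phi psi : R -> R).

Lemma FTC_open_interval phi psi (a b : R) : a < b ->
  (forall s : R, a <= s <= b -> is_derive s (1 : R) phi (psi s) /\ {for s, continuous psi}) ->
  mu.-integrable `]a, b[%classic (EFin \o psi) /\
  (\int[mu]_(s in `]a, b[%classic) (psi s)%:E = (phi b - phi a)%:E)%E.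
Proof.
move=> ab H.
have cpsi : {within `[a, b], continuous psi}.
  by apply: continuous_in_subspaceT => x; rewrite inE/= in_itv/= => /H[].
have mpsi : measurable_fun `[a, b]%classic psi.
  by apply: subspace_continuous_measurable_fun; first exact: measurable_itv.
have iab : mu.-integrable `[a, b]%classic (EFin \o psi).
  by apply: continuous_compact_integrable => //; exact: segment_compact.
split.
  by apply: integrableS iab => //; exact: subset_itv_oo_cc.
have mo : measurable_fun `]a, b[%classic psi.
  by apply: measurable_funS mpsi; [exact: measurable_itv|exact: subset_itv_oo_cc].
have mc : measurable_fun `[a, b[%classic psi.
  by apply: measurable_funS mpsi; [exact: measurable_itv|exact: subset_itv_co_cc].
rewrite integral_itv_obnd_cbnd; last exact/measurable_EFinP.
rewrite integral_itv_bndo_bndc; last exact/measurable_EFinP.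
have cphi (s : R) : a <= s <= b -> phi x @[x --> s] --> phi s.
  by move=> /H[[/derivable1_diffP d _] _]; exact: differentiable_continuous.
rewrite (@continuous_FTC2 _ psi phi a b)// ?EFinB//.
- split.
  + by move=> x; rewrite in_itv/= => /andP[h1 h2]; have [|[]] := H x; first by rewrite !ltW.
  + by apply: cvg_at_right_filter; apply: cphi; rewrite lexx ltW.
  + by apply: cvg_at_left_filter; apply: cphi; rewrite lexx ltW.
- move=> x; rewrite in_itv/= => /andP[h1 h2].
  by have [|[_ <-] _] := H x; rewrite ?derive1E// !ltW.
Qed.

(** A line of the channel from which its segment in the leaflet has been removed; the
segment is empty if B < A. *)
Definition punctured (l r A B : R) : set R := [set s | l < s < r /\ ~ (A <= s <= B)].

(** Used to identify the end points of slices as points of closure Omega, where the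
fields are smooth. *)
Lemma closure_near (D : set R) (a b s : R) : a < b -> a <= s <= b ->
  `]a, b[%classic `<=` D -> closure D s.
Proof.
move=> ab /andP[h1 h2] sub V /nbhs_ballP[e /= e0 eV].
pose u := Num.max a (s - e / 2); pose v := Num.min b (s + e / 2).
have uv : u < v.
  by rewrite /u /v lt_min !gt_max; apply/andP; split; apply/andP; split; lra.
exists ((u + v) / 2); have h : u < (u + v) / 2 < v by apply/andP; split; lra.
move: h; rewrite {1}/u {3}/v lt_min gt_max.
set m := (_ / 2) => /andP[/andP[m1 m2] /andP[m3 m4]].
split; first by apply: sub; rewrite /= in_itv/= m1.
by apply: eV; rewrite /ball/= ltr_norml; apply/andP; split; lra.
Qed.

(** The fundamental theorem of calculus on both components of the slice. *)
Lemma slice_FTC (l r A B : R) phi psi : l < r -> (A <= B -> l < A /\ B < r) ->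
  (forall s, closure (punctured l r A B) s ->
     is_derive s (1 : R) phi (psi s) /\ {for s, continuous psi}) ->
  (\int[mu]_(s in punctured l r A B) (psi s)%:E =
    (phi r - phi l + (if A <= B then phi A - phi B else 0))%:E)%E.
Proof.
move=> lr hAB H; case: ifPn => AB; last first.
  have -> : punctured l r A B = `]l, r[%classic.
    apply/seteqP; split => s /=; rewrite in_itv/=; first by case.
    by move=> ?; split => // /andP[? ?]; move/negP: AB; apply; lra.
  have [|_ ->] := @FTC_open_interval phi psi l r lr; last by rewrite addr0.
  move=> s ls; apply: H; apply: (closure_near lr ls).
  move=> x /=; rewrite in_itv/= => ?; split => // /andP[? ?].
  by move/negP: AB; apply; lra.
have [lA Br] := hAB AB.
have E : punctured l r A B = `]l, A[%classic `|` `]B, r[%classic.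
  apply/seteqP; split => s /=; rewrite !in_itv/=.
    move=> [/andP[s1 s2] s3]; have [sA|sA] := ltP s A; first by left; rewrite s1.
    right; rewrite s2 andbT ltNge; apply/negP => sB; apply: s3; by rewrite sA.
  case=> /andP[s1 s2]; split; first by rewrite s1 (lt_le_trans s2)// ltW// (le_lt_trans AB).
  - by move=> /andP[]; rewrite leNgt s2.
  - by rewrite s2 andbT (lt_trans _ s1)// (lt_le_trans lA).
  - by move=> /andP[_]; rewrite leNgt s1.
have [|i1 e1] := @FTC_open_interval phi psi l A lA.
  by move=> s ls; apply: H; apply: (closure_near lA ls); rewrite E; exact: subsetUl.
have [|i2 e2] := @FTC_open_interval phi psi B r Br.
  by move=> s ls; apply: H; apply: (closure_near Br ls); rewrite E; exact: subsetUr.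
rewrite E integral_setU//; last 2 first.
- apply/measurable_EFinP/measurable_funU; [exact: measurable_itv|exact: measurable_itv|].
  by split; apply/measurable_EFinP; [exact: measurable_int i1|exact: measurable_int i2].
- apply/eqP/seteqP; split=> s //= -[]; rewrite !in_itv/= => /andP[_ ?] /andP[? _]; lra.
by rewrite e1 e2 -EFinD; congr _%:E; ring.
Qed.

End slice.

(** * Geometry of the leaflet and of the fluid *)

Section leaflet_geometry.
Variable R : realType.
Implicit Type c : config R.

Definition lower_angle c : R := theta c - eps c.
Definition upper_angle c : R := theta c + eps c.

Lemma angle_bounds c : admissible c ->
  [/\ - (pi / 2) < lower_angle c, lower_angle c < upper_angle c
    & upper_angle c < pi / 2].
Proof.
rewrite /lower_angle /upper_angle.
by move=> [[e0 /andP[e1 e2] /andP[/= t1 t2]] _]; split; lra.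
Qed.

Lemma len_gt0 c : admissible c -> 0 < len c.
Proof. by move=> [_ [[]]]. Qed.

(** The polar description of the leaflet is converted by the identities
X cos w1 - t sin w1 = r sin (w - w1) and t sin w2 - X cos w2 = r sin (w2 - w).
Conversely the angle is the arc tangent of X / t, which is monotone, the case
t = 0 being that of the vertex. *)
Lemma leafletE c x : admissible c ->
  leaflet c x <-> sector (lower_angle c) (upper_angle c) (len c)
    (x.1 - (hinge c).1) ((hinge c).2 - x.2).
Proof.
move=> hc; have [a1 a12 a2] := angle_bounds hc; have l0 := len_gt0 hc.
have [_ /andP[e0 e0'] /andP[/= t1 t2]] := hc.1.
split=> [[r [w [/andP[r0 rl] wt ->]]]|S].
  rewrite /polar/=.
  have -> : (hinge c).1 + r * sin w - (hinge c).1 = r * sin w by ring.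
  have -> : (hinge c).2 - ((hinge c).2 - r * cos w) = r * cos w by ring.
  move: wt; rewrite ler_norml => /andP[w1 w2].
  have sin_ge0 v : 0 <= v <= 2 * eps c -> 0 <= sin v.
    move=> /andP[v0 v1]; have [->|vn] := eqVneq v 0; first by rewrite sin0.
    apply: sin_ge0_pi; rewrite v0/=; have := pi_gt0 R; lra.
  split.
  - have -> : r * sin w * cos (lower_angle c) - r * cos w * sin (lower_angle c) =
      r * sin (w - lower_angle c) by rewrite (sinB w); ring.
    by apply: mulr_ge0 => //; apply: sin_ge0; rewrite /lower_angle; apply/andP; split; lra.
  - have -> : r * cos w * sin (upper_angle c) - r * sin w * cos (upper_angle c) =
      r * sin (upper_angle c - w) by rewrite (sinB _ w); ring.
    by apply: mulr_ge0 => //; apply: sin_ge0; rewrite /upper_angle; apply/andP; split; lra.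
  - have -> : (r * sin w) ^+ 2 + (r * cos w) ^+ 2 = r ^+ 2.
      by rewrite !exprMn -mulrDr addrC cos2Dsin2 mulr1.
    by rewrite ler_sqr ?nnegrE ?(ltW l0).
have t0 := sector_t_ge0 a1 a12 a2 S.
have c1 := cos1_gt0 a1 a12 a2; have c2 := cos2_gt0 a1 a12 a2.
case: x S t0 => x y /=; set X := x - _; set t := _ - y => -[S1 S2 S3].
have -> : x = (hinge c).1 + X by rewrite /X; ring.
have -> : y = (hinge c).2 - t by rewrite /t; ring.
rewrite le_eqVlt => /predU1P[t0|t0].
  have X0 : X = 0.
    apply/eqP; rewrite eq_le; move: S1 S2; rewrite -t0 !mul0r subr0 sub0r.
    by rewrite pmulr_lge0// oppr_ge0 pmulr_lle0// => -> ->.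
  exists 0, (theta c); split; rewrite ?lexx ?(ltW l0)//.
    by rewrite subrr normr0 ltW.
  by rewrite /polar X0 -t0 !mul0r.
pose w := atan (X / t).
have cw : 0 < cos w by apply: cos_gt0_pihalf; rewrite atan_gtNpi2 atan_ltpi2.
have tw : sin w / cos w = X / t by rewrite -[LHS]/(tan w) atanK.
exists (t / cos w), w.
have r0 : 0 < t / cos w by exact: divr_gt0.
have e1 : t / cos w * cos w = t by rewrite divfK// gt_eqF.
have e2 : t / cos w * sin w = X by rewrite mulrAC -mulrA tw mulrC divfK// gt_eqF.
split.
- rewrite (ltW r0)/=.
  have h : (t / cos w) ^+ 2 <= len c ^+ 2.
    apply: le_trans S3; rewrite -e2 -{3}e1 ![(_ * _) ^+ 2]exprMn -mulrDr addrC.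
    by rewrite cos2Dsin2 mulr1.
  by move: h; rewrite ler_sqr ?nnegrE ?(ltW l0)// ltW.
- have tanw (v : R) : v \in `]- (pi / 2), pi / 2[ -> atan (sin v / cos v) = v by move=> ?; exact: tanK.
  rewrite ler_norml; apply/andP; split.
    rewrite lerBrDr addrC -/(lower_angle c).
    rewrite -(tanw (lower_angle c)); last by rewrite in_itv/= a1 (lt_trans a12).
    rewrite /w; apply: le_atan.
    by rewrite ler_pdivrMr// mulrAC ler_pdivlMr// mulrC; lra.
  rewrite lerBlDr addrC -/(upper_angle c).
  rewrite -(tanw (upper_angle c)); last by rewrite in_itv/= a2 (lt_trans _ a12).
  rewrite /w; apply: le_atan.
  by rewrite ler_pdivrMr// mulrAC ler_pdivlMr// [sin _ * t]mulrC; lra.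
- by rewrite /polar e2 e1.
Qed.

Lemma continuous_fst (x : R * R) : {for x, continuous (fun y : R * R => y.1)}.
Proof. exact: C1_near_continuous (C1_near_fst x). Qed.

Lemma continuous_snd (x : R * R) : {for x, continuous (fun y : R * R => y.2)}.
Proof. exact: C1_near_continuous (C1_near_snd x). Qed.

Lemma closed_ge0 (f : R * R -> R) : (forall x, C1_near f x) ->
  closed [set x | 0 <= f x].
Proof.
move=> cf; rewrite (_ : [set _ | _] = f @^-1` [set y | 0 <= y])//.
by apply: closed_comp => [x _|]; [exact: C1_near_continuous|exact: closed_ge].
Qed.

Lemma C1_near_affine (a b k x : R * R) (d : R) :
  C1_near (fun y => a.1 * (y.1 - b.1) + a.2 * (y.2 - b.2) + d) x.
Proof.
apply: C1_nearD (C1_near_cst d x); apply: C1_nearD; apply: C1_nearM; try exact: C1_near_cst.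
  by apply: C1_nearD; [exact: C1_near_fst|exact: C1_near_cst].
by apply: C1_nearD; [exact: C1_near_snd|exact: C1_near_cst].
Qed.

Lemma C1_near_sqdist (s x : R * R) :
  C1_near (fun y => (y.1 - s.1) ^+ 2 + (y.2 - s.2) ^+ 2) x.
Proof.
have c1 : C1_near (fun y : R * R => y.1 - s.1) x.
  by apply: C1_nearD; [exact: C1_near_fst|exact: C1_near_cst].
have c2 : C1_near (fun y : R * R => y.2 - s.2) x.
  by apply: C1_nearD; [exact: C1_near_snd|exact: C1_near_cst].
by apply: C1_nearD; [exact: C1_nearM|exact: C1_nearM].
Qed.

Lemma leaflet_closed c : admissible c -> closed (leaflet c).
Proof.
move=> hc.
pose f1 (x : R * R) := cos (lower_angle c) * (x.1 - (hinge c).1)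
    + sin (lower_angle c) * (x.2 - (hinge c).2) + 0.
pose f2 (x : R * R) := - cos (upper_angle c) * (x.1 - (hinge c).1)
    + - sin (upper_angle c) * (x.2 - (hinge c).2) + 0.
pose f3 (x : R * R) := len c ^+ 2 + -1 * ((x.1 - (hinge c).1) ^+ 2 + (x.2 - (hinge c).2) ^+ 2).
have -> : leaflet c = [set x | 0 <= f1 x] `&` [set x | 0 <= f2 x] `&` [set x | 0 <= f3 x].
  apply/seteqP; split=> x /=.
    by move=> /(leafletE _ hc)[h1 h2 h3]; rewrite /f1 /f2 /f3; split; [split|]; lra.
  rewrite /f1 /f2 /f3 => -[[h1 h2] h3].
  by apply/(leafletE _ hc); split; lra.
apply: closedI; first apply: closedI; apply: closed_ge0 => x.
- exact: (C1_near_affine (cos _, sin _) _ 0).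
- exact: (C1_near_affine (- cos _, - sin _) _ 0).
- apply: C1_nearD; first exact: C1_near_cst.
  by apply: C1_nearM; [exact: C1_near_cst|exact: C1_near_sqdist].
Qed.

Lemma channel_open c : open (channel c).
Proof.
have o (f : R * R -> R) (a : R) : (forall x, {for x, continuous f}) ->
    open [set x | a < f x] /\ open [set x | f x < a].
  move=> cf; split.
    rewrite (_ : [set _ | _] = f @^-1` [set y | a < y])//.
    by apply: open_comp => [x _|]; [exact: cf|exact: open_gt].
  rewrite (_ : [set _ | _] = f @^-1` [set y | y < a])//.
  by apply: open_comp => [x _|]; [exact: cf|exact: open_lt].
have -> : channel c = ([set x | xl c < x.1] `&` [set x | x.1 < xr c]) `&`
    ([set x | yb c < x.2] `&` [set x | x.2 < yt c]).
  apply/seteqP; split=> x /=.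
    by move=> [/andP[? ?] /andP[? ?]].
  by move=> [[a b] [d e]]; split; apply/andP.
apply: openI; apply: openI.
- exact: (o _ _ continuous_fst).1.
- exact: (o _ _ continuous_fst).2.
- exact: (o _ _ continuous_snd).1.
- exact: (o _ _ continuous_snd).2.
Qed.

Lemma Omega_open c : admissible c -> open (Omega c).
Proof.
move=> hc; rewrite /Omega setDE; apply: openI; first exact: channel_open.
by apply: closed_openC; exact: leaflet_closed.
Qed.

(** The leaflet meets the top wall in the hinge only, for its angles are strictly
between - pi / 2 and pi / 2. *)
Lemma leaflet_bounds c x : admissible c -> leaflet c x ->
  [/\ xl c < x.1 < xr c, yb c < x.2 <= yt c &
     x.2 = yt c -> x.1 = (hinge c).1].
Proof.
move=> hc Lx; have [a1 a12 a2] := angle_bounds hc; have l0 := len_gt0 hc.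
have c1 := cos1_gt0 a1 a12 a2; have c2 := cos2_gt0 a1 a12 a2.
have [[_ _ at_] [[_ hy _ lH] [d d0 Hd]]] := hc.
have /andP[x1 x2] := Hd _ _ at_ Lx.
have S := (leafletE x hc).1 Lx; have t0 := sector_t_ge0 a1 a12 a2 S.
case: S => S1 S2 S3.
have t1 : (hinge c).2 - x.2 <= len c.
  rewrite leNgt; apply/negP => h; have := sqr_ge0 (x.1 - (hinge c).1); nra.
split; try (apply/andP; split); try lra.
move=> xy; have e : (hinge c).2 - x.2 = 0 by lra.
move: S1 S2; rewrite e !mul0r subr0 sub0r.
by rewrite pmulr_lge0// oppr_ge0 pmulr_lle0// => ? ?; lra.
Qed.

Lemma polar_leaflet c r w : 0 <= r <= len c -> `|w - theta c| <= eps c ->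
  leaflet c (polar c r w).
Proof. by move=> rl wt; exists r, w. Qed.

Lemma eps_gt0 c : admissible c -> 0 < eps c.
Proof. by move=> [[_ /andP[]]]. Qed.

Lemma lower_side_leaflet c r : admissible c -> 0 <= r <= len c ->
  leaflet c (polar c r (lower_angle c)).
Proof.
move=> hc rl; apply: polar_leaflet => //; have e0 := eps_gt0 hc.
by rewrite /lower_angle addrAC subrr sub0r normrN gtr0_norm.
Qed.

Lemma upper_side_leaflet c r : admissible c -> 0 <= r <= len c ->
  leaflet c (polar c r (upper_angle c)).
Proof.
move=> hc rl; apply: polar_leaflet => //; have e0 := eps_gt0 hc.
by rewrite /upper_angle addrAC subrr add0r gtr0_norm.
Qed.

Lemma channel_bounds c : admissible c -> xl c < xr c /\ yb c < yt c.
Proof.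
move=> hc; have l0 := len_gt0 hc.
have [|/andP[h1 h2] /andP[h3 h4] _] := leaflet_bounds hc (lower_side_leaflet (r := 0) hc _).
  by rewrite lexx ltW.
by split; [exact: lt_trans h1 h2|exact: lt_le_trans h3 h4].
Qed.

(** A point of the leaflet is in the closure of the fluid if it can be pushed out of
the leaflet along a direction v.  The condition v.2 < 0 ensures that points of
the top wall enter the channel. *)
Lemma leaflet_closure_Omega c x (v : R * R) : admissible c -> leaflet c x ->
  v.2 < 0 -> (forall d, 0 < d -> ~ leaflet c (x.1 + d * v.1, x.2 + d * v.2)) ->
  closure (Omega c) x.
Proof.
move=> hc Lx v2 H V /nbhs_ballP[e /= e0 eV].
have [/andP[x1 x2] /andP[x3 x4] _] := leaflet_bounds hc Lx.
pose M := 1 + `|v.1| + `|v.2|.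
have M0 : 0 < M by rewrite /M -addrA ltr_pwDl// addr_ge0.
pose m := Num.min (Num.min e (x.1 - xl c)) (Num.min (xr c - x.1) (x.2 - yb c)).
have m0 : 0 < m by rewrite /m !lt_min; apply/andP; split; apply/andP; split; lra.
have [m1 m2 m3 m4] : [/\ m <= e, m <= x.1 - xl c, m <= xr c - x.1 & m <= x.2 - yb c].
  by rewrite /m; split; rewrite !ge_min lexx ?orbT.
(* The step d is such that d |v| is less than the distance m to the walls that
   could be reached and to the complement of V. *)
pose d := m / (2 * M).
have d0 : 0 < d by rewrite /d; apply: divr_gt0 => //; exact: mulr_gt0.
have dM : d * M < m.
  rewrite /d invfM mulrA mulfVK ?gt_eqF//; lra.
have b1 : `|d * v.1| < m.
  rewrite normrM gtr0_norm//; apply: le_lt_trans dM; rewrite ler_pM2l// /M.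
  by have := normr_ge0 v.2; lra.
have b2 : `|d * v.2| < m.
  rewrite normrM gtr0_norm//; apply: le_lt_trans dM; rewrite ler_pM2l// /M.
  by have := normr_ge0 v.1; lra.
exists (x.1 + d * v.1, x.2 + d * v.2); split.
  split; last exact: H.
  move: b1 b2; rewrite !ltr_norml => /andP[? ?] /andP[? ?].
  have : d * v.2 < 0 by rewrite pmulr_rlt0.
  by split; apply/andP; split => /=; lra.
apply: eV; split; rewrite /ball/= opprD addNKr normrN; lra.
Qed.

(** The side is left in the direction of its outward normal; a multiple of the
direction of the ray is added so that the resulting direction points downwards. *)
Lemma sides_closure_Omega c r : admissible c -> 0 <= r <= len c ->
  closure (Omega c) (polar c r (lower_angle c)) /\
  closure (Omega c) (polar c r (upper_angle c)).
Proof.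
move=> hc rl; have [a1 a12 a2] := angle_bounds hc.
have c1 := cos1_gt0 a1 a12 a2; have c2 := cos2_gt0 a1 a12 a2.
split.
- set w := lower_angle c.
  apply: (@leaflet_closure_Omega _ _ (2 / cos w * sin w - cos w, - (2 / cos w * cos w) - sin w)) => //.
  + exact: lower_side_leaflet.
  + by rewrite /= divfK ?gt_eqF//; have := sin_geN1 w; lra.
  + move=> d d0 /(leafletE _ hc)[h _ _]; move: h; rewrite /polar /= -/w.
    set k := 2 / cos w.
    have -> : ((hinge c).1 + r * sin w + d * (k * sin w - cos w) - (hinge c).1) * cos w
        - ((hinge c).2 - ((hinge c).2 - r * cos w + d * (- (k * cos w) - sin w))) * sin w
        = - d * (cos w ^+ 2 + sin w ^+ 2) by ring.
    by rewrite cos2Dsin2; lra.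
- set w := upper_angle c.
  apply: (@leaflet_closure_Omega _ _ (2 / cos w * sin w + cos w, - (2 / cos w * cos w) + sin w)) => //.
  + exact: upper_side_leaflet.
  + by rewrite /= divfK ?gt_eqF//; have := sin_le1 w; lra.
  + move=> d d0 /(leafletE _ hc)[_ h _]; move: h; rewrite /polar /= -/w.
    set k := 2 / cos w.
    have -> : ((hinge c).2 - ((hinge c).2 - r * cos w + d * (- (k * cos w) + sin w))) * sin w
        - ((hinge c).1 + r * sin w + d * (k * sin w + cos w) - (hinge c).1) * cos w
        = - d * (cos w ^+ 2 + sin w ^+ 2) by ring.
    by rewrite cos2Dsin2; lra.
Qed.

Lemma tip_closure_Omega c w : admissible c -> `|w - theta c| <= eps c ->
  closure (Omega c) (polar c (len c) w).
Proof.
move=> hc wt; have [a1 a12 a2] := angle_bounds hc; have l0 := len_gt0 hc.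
have cw : 0 < cos w.
  apply: cos_gt0_pihalf; move: wt; rewrite ler_norml.
  by move: a1 a2; rewrite /lower_angle /upper_angle => ? ? /andP[? ?]; apply/andP; split; lra.
apply: (@leaflet_closure_Omega _ _ (sin w, - cos w)) => //=.
- by apply: polar_leaflet => //; rewrite lexx ltW.
- by rewrite oppr_lt0.
- move=> d d0 /(leafletE _ hc)[_ _]; rewrite /polar/=.
  have -> : ((hinge c).1 + len c * sin w + d * sin w - (hinge c).1) ^+ 2 +
     ((hinge c).2 - ((hinge c).2 - len c * cos w + d * - cos w)) ^+ 2 =
     (len c + d) ^+ 2 * (cos w ^+ 2 + sin w ^+ 2) by ring.
  rewrite cos2Dsin2 mulr1; nra.
Qed.

Lemma arc_polar c x : admissible c -> leaflet c x ->
  (x.1 - (hinge c).1) ^+ 2 + ((hinge c).2 - x.2) ^+ 2 = len c ^+ 2 ->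
  exists2 w, `|w - theta c| <= eps c & x = polar c (len c) w.
Proof.
move=> hc [r [w [/andP[r0 rl] wt ->]]] /= h; exists w => //; congr polar.
have l0 := len_gt0 hc.
have h2 : r ^+ 2 = len c ^+ 2.
  rewrite -h; transitivity (r ^+ 2 * (cos w ^+ 2 + sin w ^+ 2)); last by ring.
  by rewrite cos2Dsin2 mulr1.
apply: le_anti; rewrite rl leNgt; apply/negP => rl'; nra.
Qed.

Lemma closure_Omega_Gam c x : leaflet c x -> closure (Omega c) x -> Gam c x.
Proof.
move=> Lx Ox; split; first exact: subset_closure.
move=> iL; have [y [[_ nL] Ly]] := Ox _ iL.
exact: nL Ly.
Qed.

Lemma closure_vertical_slice (A : set (R * R)) x y :
  closure [set s | A (x, s)] y -> closure A (x, y).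
Proof.
move=> h V /nbhs_ballP[e /= e0 eV].
have [s [As ys]] := h (ball y e) (nbhsx_ballx y e e0).
exists (x, s); split=> //; apply: eV; split=> //=; exact: ballxx.
Qed.

Lemma closure_horizontal_slice (A : set (R * R)) x y :
  closure [set s | A (s, y)] x -> closure A (x, y).
Proof.
move=> h V /nbhs_ballP[e /= e0 eV].
have [s [As ys]] := h (ball x e) (nbhsx_ballx x e e0).
exists (s, y); split=> //; apply: eV; split=> //=; exact: ballxx.
Qed.

End leaflet_geometry.

(** * The divergence theorem for smooth fields *)

Section smooth_flux.
Variable R : realType.
Local Notation mu := (@lebesgue_measure R).
Local Notation mu2 := (mu \x mu)%E.
Implicit Type c : config R.

Lemma Omega_measurable c : admissible c -> measurable (Omega c).
Proof. by move=> hc; apply: open_measurable_plane; exact: Omega_open. Qed.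

Definition box c : set (R * R) := `[xl c, xr c]%classic `*` `[yb c, yt c]%classic.

Lemma closure_Omega_box c : closure (Omega c) `<=` box c.
Proof.
have cb : closed (box c).
  apply: compact_closed; first exact: norm_hausdorff.
  by apply: compact_setX; exact: segment_compact.
rewrite [X in _ `<=` X](closure_id _).1//; apply: closureS.
move=> x [[/andP[? ?] /andP[? ?]] _]; split; rewrite /= in_itv/=; apply/andP; split; exact: ltW.
Qed.

Lemma closure_Omega_compact c : compact (closure (Omega c)).
Proof.
apply: subclosed_compact (@closure_Omega_box c); first exact: closed_closure.
by apply: compact_setX; exact: segment_compact.
Qed.

Lemma Omega_finite_measure c : admissible c -> (mu2 (Omega c) < +oo)%E.
Proof.
move=> hc; have [lr bt] := channel_bounds hc.
have mb : measurable (box c) by apply: measurableX; exact: measurable_itv.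
apply: (@le_lt_trans _ _ (mu2 (box c))).
  apply: le_measure; rewrite ?inE//.
    exact: Omega_measurable.
  by apply: subset_trans (@closure_Omega_box c); exact: subset_closure.
have f a b : a < b -> mu `[a, b]%classic = (b - a)%:E.
  by move=> ab; rewrite lebesgue_measure_itv/= lte_fin ab EFinB.
have -> : mu2 (box c) = ((xr c - xl c)%:E * (yt c - yb c)%:E)%E.
  by apply: etrans (product_measure1E mu mu (measurable_itv `[xl c, xr c]) (measurable_itv `[yb c, yt c])) (congr2 (fun x y => x * y)%E (f _ _ lr) (f _ _ bt)).
by rewrite -EFinM ltry.
Qed.

Lemma integrable_continuous_Omega c (f : R * R -> R) : admissible c ->
  (forall x, closure (Omega c) x -> {for x, continuous f}) ->
  mu2.-integrable (Omega c) (EFin \o f).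
Proof.
move=> hc cf.
have mO := Omega_measurable hc.
have mf : measurable_fun (Omega c) f.
  apply: open_continuous_measurable_plane; first exact: Omega_open.
  by move=> x Ox; apply: cf; exact: subset_closure.
have ccf : {within closure (Omega c), continuous f}.
  by apply: continuous_in_subspaceT => x; rewrite inE; exact: cf.
have [M [_ HM]] := compact_bounded (continuous_compact ccf (@closure_Omega_compact c)).
have H := @measurable_bounded_integrable _ _ R mu2 f (Omega c) mO (Omega_finite_measure hc) mf.
apply H.
exists M; split; first exact: num_real.
move=> x Mx y Oy; apply: HM Mx _ _.
by exists y => //; exact: subset_closure.
Qed.

(** The conclusion is stated at type R * R with its product topology, which is the
form in which continuity of paths is used. *)
Lemma continuous_pair (T : topologicalType) (f g : T -> R) (x : T) :
  {for x, continuous f} -> {for x, continuous g} ->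
  {for x, continuous (fun s => (f s, g s) : R * R)}.
Proof. by move=> cf cg; exact: cvg_pair cf cg. Qed.

Lemma continuous_polar c w : continuous (fun r => polar c r w).
Proof.
move=> r.
have h := @continuous_pair R (fun r => (hinge c).1 + r * sin w)
  (fun r => (hinge c).2 - r * cos w) r.
apply: h.
  apply: cvgD; first exact: cvg_cst.
  by apply: cvgM; [exact: cvg_id|exact: cvg_cst].
apply: cvgB; first exact: cvg_cst.
by apply: cvgM; [exact: cvg_id|exact: cvg_cst].
Qed.

Lemma continuous_edge (e : R) : continuous (fun y : R => (e, y) : R * R).
Proof.
move=> y; have h := @continuous_pair R (fun=> e) id y.
by apply: h; [exact: cvg_cst|exact: cvg_id].
Qed.

Lemma is_derive_line (G : R * R -> R) (path : R -> R * R) (j : 'I_2) (s : R) :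
  (forall h, path (h *: (1 : R) + s) = h *: axis R j + path s) ->
  {for s, continuous path} -> C1_near G (path s) ->
  is_derive s (1 : R) (fun r => G (path r)) ('D_(axis R j) G (path s)) /\
  {for s, continuous (fun r => 'D_(axis R j) G (path r))}.
Proof.
move=> hp cp cG; split; last first.
  apply: (@continuous_comp _ _ _ path (fun z => 'D_(axis R j) G z)) => //.
  exact: C1_near_partial.
have d : derivable G (path s) (axis R j) by exact: C1_near_derivable.
have E : (fun h : R => h^-1 *: (((fun r => G (path r)) \o shift s) (h *: (1 : R)) - G (path s)))
   = (fun h : R => h^-1 *: ((G \o shift (path s)) (h *: axis R j) - G (path s))).
  by apply/funext => h; rewrite /= hp.
by split; [rewrite /derivable E|rewrite /derive E].
Qed.

Lemma is_derive_vertical (G : R * R -> R) (x y : R) : C1_near G (x, y) ->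
  is_derive y (1 : R) (fun s => G (x, s)) ('D_(axis R 1) G (x, y)) /\
  {for y, continuous (fun s => 'D_(axis R 1) G (x, s))}.
Proof.
apply: (@is_derive_line G (pair x) 1 y) => [h|].
  by congr (_, _) => /=; rewrite /GRing.scale/= mulr0 add0r.
by apply: continuous_pair; [exact: cvg_cst|exact: cvg_id].
Qed.

Lemma is_derive_horizontal (G : R * R -> R) (x y : R) : C1_near G (x, y) ->
  is_derive x (1 : R) (fun s => G (s, y)) ('D_(axis R 0) G (x, y)) /\
  {for x, continuous (fun s => 'D_(axis R 0) G (s, y))}.
Proof.
apply: (@is_derive_line G (pair^~ y) 0 x) => [h|].
  by congr (_, _) => /=; rewrite /GRing.scale/= mulr0 add0r.
by apply: continuous_pair; [exact: cvg_id|exact: cvg_cst].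
Qed.

(** For points of the leaflet, this characterizes the tip. *)
Definition on_arc c (x : R * R) :=
  (x.1 - (hinge c).1) ^+ 2 + ((hinge c).2 - x.2) ^+ 2 = len c ^+ 2.

(** On the vertical line at abscissa x, the integral of the derivative is the
difference of the values of G at the ends of the segment in the leaflet, since G
vanishes on both walls.  By [sector_vertical] this is a sum over the sides, and
[Rintegral_ray] integrates it in x. *)
Lemma vertical_flux c (G : R * R -> R) : admissible c ->
  (forall x, closure (Omega c) x -> C1_near G x) ->
  (forall x, walls c x -> G x = 0) ->
  (forall x, leaflet c x -> on_arc c x -> G x = 0) ->
  int_Omega c (fun x => 'D_(axis R 1) G x) =
  sin (lower_angle c) * \int[mu]_(r in `[0, len c]) G (polar c r (lower_angle c))
  - sin (upper_angle c) * \int[mu]_(r in `[0, len c]) G (polar c r (upper_angle c)).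
Proof.
move=> hc cG Gw Ga.
have [a1 a12 a2] := angle_bounds hc; have l0 := len_gt0 hc.
have [lr bt] := channel_bounds hc.
have hy : (hinge c).2 = yt c by case: hc => _ [[]].
(* The ray at angle w, parametrized by the abscissa. *)
pose ray w x := (x, (hinge c).2 - (x - (hinge c).1) / sin w * cos w).
pose g w x := Num.sg (sin w) *
  (if 0 < (x - (hinge c).1) / sin w < len c then G (ray w x) else 0).
have rayE w x : 0 < (x - (hinge c).1) / sin w -> ray w x = polar c ((x - (hinge c).1) / sin w) w.
  move=> h; rewrite /ray /polar; congr (_, _).
  rewrite divfK ?subrKC//; apply/eqP => s0.
  by move: h; rewrite s0 invr0 mulr0 ltxx.
have H w : (forall r, 0 <= r <= len c -> closure (Omega c) (polar c r w)) ->
    mu.-integrable setT (EFin \o g w) /\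
    \int[mu]_x g w x = sin w * \int[mu]_(r in `[0, len c]) G (polar c r w).
  move=> cl.
  have e r : sin w != 0 -> ray w ((hinge c).1 + sin w * r) = polar c r w.
    move=> s0; rewrite /ray /polar; congr (_, _ - _ * _); first by rewrite mulrC.
    by rewrite addrAC subrr add0r mulrAC divff// mul1r.
  have := @Rintegral_ray R (hinge c).1 (sin w) (len c) (fun x => G (ray w x)) l0.
  move=> /(_ _)[|i1 e1].
    move=> s0 r rl; apply: (@continuous_comp _ _ _ (ray w) G).
      rewrite /ray; apply: continuous_pair; first exact: cvg_id.
      apply: cvgB; first exact: cvg_cst.
      apply: cvgM; last exact: cvg_cst.
      apply: cvgM; last exact: cvg_cst.
      by apply: cvgB; [exact: cvg_id|exact: cvg_cst].
    rewrite e//; exact/C1_near_continuous/cG/cl.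
  split => //; rewrite [LHS]e1.
  have [->|s0] := eqVneq (sin w) 0; first by rewrite !mul0r.
  by congr (_ * _); apply: eq_Rintegral => r _; rewrite e.
have [i1 e1] := H _ (fun r rl => (sides_closure_Omega hc rl).1).
have [i2 e2] := H _ (fun r rl => (sides_closure_Omega hc rl).2).
rewrite -e1 -e2 -RintegralB//.
apply: (@Rintegral_vertical_slices R (Omega c) _ _ [set (hinge c).1]).
- exact: Omega_measurable.
- by apply: integrable_continuous_Omega => // x /cG; exact: C1_near_partial.
- exact: finite_set1.
move=> x /= xo.
have X0 : x - (hinge c).1 != 0 by rewrite subr_eq0; apply/eqP.
have [xin|xout] := boolP (xl c < x < xr c); last first.
  have -> : [set y | Omega c (x, y)] = set0.
    by apply/seteqP; split=> y //= [[h _] _]; move: xout; rewrite h.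
  have gE w : (forall r, 0 <= r <= len c -> leaflet c (polar c r w)) -> g w x = 0.
    move=> hw; rewrite /g; case: ifP => [/andP[h1 h2]|]; last by rewrite mulr0.
    have [|] := leaflet_bounds hc (hw ((x - (hinge c).1) / sin w) _).
      by rewrite !ltW.
    by rewrite -rayE//= => h; move: xout; rewrite h.
  rewrite integral_set0 !gE ?subrr//.
  + by move=> r; exact: upper_side_leaflet.
  + by move=> r; exact: lower_side_leaflet.
have [A [B [HAB Hphi]]] := sector_vertical a1 a12 a2 l0 X0.
have slE : [set y | Omega c (x, y)] = punctured (yb c) (yt c) ((hinge c).2 - B) ((hinge c).2 - A).
  apply/seteqP; split=> y /=.
    move=> [[/= _ h] nL]; split => // /andP[h1 h2]; apply: nL.
    by apply/(leafletE _ hc)/HAB => /=; apply/andP; split; lra.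
  move=> [h nAB]; split; first by split.
  by move=> /(leafletE _ hc)/HAB/= /andP[? ?]; apply: nAB; apply/andP; split; lra.
rewrite slE (@slice_FTC R _ _ _ _ (fun s => G (x, s)) (fun s => 'D_(axis R 1) G (x, s)))//.
- have w1 y : y = yb c \/ y = yt c -> G (x, y) = 0.
    by move=> h; apply: Gw; split => //=; case/andP: xin => ? ?; rewrite !ltW.
  rewrite (w1 _ (or_introl erefl)) (w1 _ (or_intror erefl)).
  rewrite subrr add0r lerD2l lerN2; congr EFin.
  have Ha t : sector (lower_angle c) (upper_angle c) (len c) (x - (hinge c).1) t ->
      (x - (hinge c).1) ^+ 2 + t ^+ 2 = len c ^+ 2 -> G (x, (hinge c).2 - t) = 0.
    move=> St e; apply: Ga; last by rewrite /on_arc/= opprB subrKC.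
    by apply/(leafletE _ hc); rewrite /= opprB subrKC.
  have e3 := Hphi (fun t => G (x, (hinge c).2 - t)) Ha.
  rewrite /g /ray -[RHS]opprB -e3; case: ifP => _; last by rewrite oppr0.
  by rewrite opprB.
- rewrite lerD2l lerN2 => AB.
  have LA : leaflet c (x, (hinge c).2 - A).
    by apply/(leafletE _ hc); rewrite /= opprB subrKC; apply/HAB; rewrite lexx.
  have LB : leaflet c (x, (hinge c).2 - B).
    by apply/(leafletE _ hc); rewrite /= opprB subrKC; apply/HAB; rewrite lexx andbT.
  have [_ /= /andP[hA1 hA2] hA3] := leaflet_bounds hc LA.
  have [_ /= /andP[hB1 hB2] hB3] := leaflet_bounds hc LB.
  split => //; rewrite lt_neqAle hA2 andbT; apply/eqP => h.
  by apply: xo; exact: hA3.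
- move=> s hs; apply: is_derive_vertical; apply: cG; apply: closure_vertical_slice.
  by rewrite slE.
Qed.

Lemma edges_closure_Omega c y : admissible c -> yb c <= y <= yt c ->
  closure (Omega c) (xl c, y) /\ closure (Omega c) (xr c, y).
Proof.
move=> hc; have [lr bt] := channel_bounds hc.
have [[_ _ at_] [_ [d d0 Hd]]] := hc.
suff H s : yb c < s < yt c -> closure (Omega c) (xl c, s) /\ closure (Omega c) (xr c, s).
  move=> yy; split; rewrite (closure_id (closure (Omega c))).1; try exact: closed_closure;
    apply: closure_vertical_slice; apply: (closure_near bt yy) => s /=;
    by rewrite in_itv/= => /H[].
move=> ss; split; apply: closure_horizontal_slice.
- have dd : xl c < Num.min (xr c) (xl c + d) by rewrite lt_min lr ltrDl d0.
  apply: (closure_near dd); first by rewrite lexx ltW.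
  move=> x /=; rewrite in_itv/= lt_min => /andP[x1 /andP[x2 x3]].
  split; first by split => //=; rewrite x1.
  by move=> /(Hd _ _ at_)/= /andP[? _]; lra.
- have dd : Num.max (xl c) (xr c - d) < xr c by rewrite gt_max lr ltrBlDr ltrDl d0.
  apply: (closure_near dd); first by rewrite lexx ltW.
  move=> x /=; rewrite in_itv/= gt_max => /andP[/andP[x1 x2] x3].
  split; first by split => //=; rewrite x1.
  by move=> /(Hd _ _ at_)/= /andP[_ ?]; lra.
Qed.

(** As for vertical lines, with [sector_horizontal]; the values at the lateral edges
of the channel remain. *)
Lemma horizontal_flux c (G : R * R -> R) : admissible c ->
  (forall x, closure (Omega c) x -> C1_near G x) ->
  (forall x, leaflet c x -> on_arc c x -> G x = 0) ->
  int_Omega c (fun x => 'D_(axis R 0) G x) =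
  \int[mu]_(y in `[yb c, yt c]) (G (xr c, y) - G (xl c, y))
  + (cos (lower_angle c) * \int[mu]_(r in `[0, len c]) G (polar c r (lower_angle c))
  - cos (upper_angle c) * \int[mu]_(r in `[0, len c]) G (polar c r (upper_angle c))).
Proof.
move=> hc cG Ga.
have [a1 a12 a2] := angle_bounds hc; have l0 := len_gt0 hc.
have c1 := cos1_gt0 a1 a12 a2; have c2 := cos2_gt0 a1 a12 a2.
have [lr bt] := channel_bounds hc.
have hy : (hinge c).2 = yt c by case: hc => _ [[]].
(* The ray at angle w, parametrized by the ordinate. *)
pose ray w y := ((hinge c).1 + (y - (hinge c).2) / - cos w * sin w, y).
pose g w y := Num.sg (- cos w) *
  (if 0 < (y - (hinge c).2) / - cos w < len c then G (ray w y) else 0).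
have rayE w y : 0 < cos w -> ray w y = polar c ((y - (hinge c).2) / - cos w) w.
  move=> h; rewrite /ray /polar; congr (_, _).
  by rewrite invrN mulrN mulNr divfK ?gt_eqF// opprK subrKC.
have H w : 0 < cos w -> (forall r, 0 <= r <= len c -> closure (Omega c) (polar c r w)) ->
    mu.-integrable setT (EFin \o g w) /\
    \int[mu]_y g w y = - cos w * \int[mu]_(r in `[0, len c]) G (polar c r w).
  move=> cw cl.
  have e r : ray w ((hinge c).2 + - cos w * r) = polar c r w.
    rewrite /ray /polar; congr (_ + _ * _, _); last by rewrite mulNr mulrC.
    by rewrite addrAC subrr add0r mulrAC divff ?mul1r// oppr_eq0 gt_eqF.
  have := @Rintegral_ray R (hinge c).2 (- cos w) (len c) (fun y => G (ray w y)) l0.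
  move=> /(_ _)[|i1 e1].
    move=> _ r rl; apply: (@continuous_comp _ _ _ (ray w) G).
      rewrite /ray; apply: continuous_pair; last exact: cvg_id.
      apply: cvgD; first exact: cvg_cst.
      apply: cvgM; last exact: cvg_cst.
      apply: cvgM; last exact: cvg_cst.
      by apply: cvgB; [exact: cvg_id|exact: cvg_cst].
    rewrite e//; exact/C1_near_continuous/cG/cl.
  split => //; rewrite [LHS]e1.
  by congr (_ * _); apply: eq_Rintegral => r _; rewrite e.
have [i1 e1] := H _ c1 (fun r rl => (sides_closure_Omega hc rl).1).
have [i2 e2] := H _ c2 (fun r rl => (sides_closure_Omega hc rl).2).
pose edge := (fun y => G (xr c, y) - G (xl c, y)) \_ `]yb c, yt c[%classic.
have cedge y : yb c <= y <= yt c -> {for y, continuous (fun y => G (xr c, y) - G (xl c, y))}.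
  move=> yy; have [cl cr] := edges_closure_Omega hc yy.
  have cc x : closure (Omega c) (x, y) -> {for y, continuous (fun y => G (x, y))}.
    move=> Oxy; apply: (@continuous_comp _ _ _ (fun s => (x, s)) G).
      exact: continuous_edge.
    exact/C1_near_continuous/cG.
  by apply: cvgB; [exact: cc cr|exact: cc cl].
have [iedge edgeE] := Rintegral_open_itv cedge.
have ie : mu.-integrable setT (EFin \o edge).
  by rewrite /edge -restrict_EFin; apply/(integrable_mkcond _ _).1.
have ee : \int[mu]_(y in `[yb c, yt c]) (G (xr c, y) - G (xl c, y)) = \int[mu]_y edge y.
  by rewrite -edgeE [LHS]Rintegral_mkcond.
rewrite ee.
have -> : cos (lower_angle c) * \int[mu]_(r in `[0, len c]) G (polar c r (lower_angle c))
    - cos (upper_angle c) * \int[mu]_(r in `[0, len c]) G (polar c r (upper_angle c))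
    = \int[mu]_y g (upper_angle c) y - \int[mu]_y g (lower_angle c) y.
  by rewrite e1 e2 !mulNr opprK addrC.
rewrite -RintegralB//.
have i21 : mu.-integrable setT (EFin \o (fun x => g (upper_angle c) x - g (lower_angle c) x)).
  rewrite (_ : EFin \o _ = (EFin \o g (upper_angle c)) \- (EFin \o g (lower_angle c)))%E.
    exact: integrableB.
  by apply/funext => y; rewrite /= EFinB.
rewrite -RintegralD//.
apply: (@Rintegral_horizontal_slices R (Omega c) _ _ set0).
- exact: Omega_measurable.
- by apply: integrable_continuous_Omega => // x /cG; exact: C1_near_partial.
- exact: finite_set0.
move=> y _.
have [yin|yout] := boolP (yb c < y < yt c); last first.
  have -> : [set x | Omega c (x, y)] = set0.
    by apply/seteqP; split=> x //= [[_ h] _]; move: yout; rewrite h.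
  have gE w : 0 < cos w -> (forall r, 0 <= r <= len c -> leaflet c (polar c r w)) -> g w y = 0.
    move=> cw hw; rewrite /g; case: ifP => [/andP[h1 h2]|]; last by rewrite mulr0.
    have [|_] := leaflet_bounds hc (hw ((y - (hinge c).2) / - cos w) _).
      by rewrite !ltW.
    rewrite -rayE//= => /andP[h3 h4] _; move: yout; rewrite h3/= -hy.
    move: h1; rewrite invrN mulrN oppr_gt0 pmulr_llt0 ?invr_gt0// => h1.
    by rewrite -subr_lt0 h1.
  rewrite integral_set0 !gE ?subrr ?addr0//.
  + by rewrite /edge patchE memNset//= in_itv/=; apply/negP.
  + by move=> r; exact: lower_side_leaflet.
  + by move=> r; exact: upper_side_leaflet.
have t0 : 0 < (hinge c).2 - y by rewrite subr_gt0 hy; case/andP: yin.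
have [A [B [HAB Hphi]]] := sector_horizontal a1 a12 a2 l0 t0.
have slE : [set x | Omega c (x, y)] = punctured (xl c) (xr c) ((hinge c).1 + A) ((hinge c).1 + B).
  apply/seteqP; split=> x /=.
    move=> [[/= h _] nL]; split => // /andP[h1 h2]; apply: nL.
    by apply/(leafletE _ hc)/HAB => /=; apply/andP; split; lra.
  move=> [h nAB]; split; first by split.
  by move=> /(leafletE _ hc)/HAB/= /andP[? ?]; apply: nAB; apply/andP; split; lra.
rewrite slE (@slice_FTC R _ _ _ _ (fun s => G (s, y)) (fun s => 'D_(axis R 0) G (s, y)))//.
- rewrite lerD2l /edge patchE mem_set/= ?in_itv//=; congr (EFin (_ + _)).
  have Ha X : sector (lower_angle c) (upper_angle c) (len c) X ((hinge c).2 - y) ->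
      X ^+ 2 + ((hinge c).2 - y) ^+ 2 = len c ^+ 2 -> G ((hinge c).1 + X, y) = 0.
    move=> St e; have e' : (hinge c).1 + X - (hinge c).1 = X by rewrite addrAC subrr add0r.
    apply: Ga; last by rewrite /on_arc/= e'.
    by apply/(leafletE _ hc); rewrite /= e'.
  rewrite (Hphi (fun X => G ((hinge c).1 + X, y)) Ha) /g /ray.
  have s w : (y - (hinge c).2) / - cos w = ((hinge c).2 - y) / cos w.
    by rewrite invrN mulrN -mulNr opprB.
  rewrite !s !ltr0_sg ?oppr_lt0// !mulN1r opprK addrC //.
- rewrite lerD2l => AB.
  have LL X : A <= X <= B -> leaflet c ((hinge c).1 + X, y).
    move=> XAB; apply/(leafletE _ hc); rewrite /= [_ + X - _]addrAC subrr add0r.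
    exact/HAB.
  have [|/= /andP[hA1 hA2] _ _] := leaflet_bounds hc (LL A _); first by rewrite lexx.
  have [|/= /andP[hB1 hB2] _ _] := leaflet_bounds hc (LL B _); first by rewrite lexx andbT.
  by [].
- move=> s hs; apply: is_derive_horizontal; apply: cG; apply: closure_horizontal_slice.
  by rewrite slE.
Qed.

(** The normal vectors of the two sides are eperp (lower) and - eperp (upper), which
combines the factors sin and cos of the two preceding lemmas. *)
Lemma smooth_flux c (G1 G2 : R * R -> R) : admissible c ->
  (forall x, closure (Omega c) x -> C1_near G1 x /\ C1_near G2 x) ->
  (forall x, walls c x -> G2 x = 0) ->
  (forall x, leaflet c x -> on_arc c x -> G1 x = 0 /\ G2 x = 0) ->
  int_Omega c (fun x => 'D_(axis R 0) G1 x + 'D_(axis R 1) G2 x) =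
  \int[mu]_(y in `[yb c, yt c]) (G1 (xr c, y) - G1 (xl c, y))
  + int_sides c (fun r w n => G1 (polar c r w) * n 0 0 + G2 (polar c r w) * n 1 0).
Proof.
move=> hc cG Gw Ga.
have c1 x : closure (Omega c) x -> C1_near G1 x by move=> /cG[].
have c2 x : closure (Omega c) x -> C1_near G2 x by move=> /cG[].
have mO := Omega_measurable hc.
rewrite /int_Omega [LHS]RintegralD; last 3 first.
- exact: mO.
- by apply: integrable_continuous_Omega => // x /c1; exact: C1_near_partial.
- by apply: integrable_continuous_Omega => // x /c2; exact: C1_near_partial.
have := horizontal_flux hc c1 (fun x Lx ax => (Ga x Lx ax).1).
rewrite /int_Omega => ->.
have := vertical_flux hc c2 Gw (fun x Lx ax => (Ga x Lx ax).2).
rewrite /int_Omega => ->.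
rewrite -addrA; congr (_ + _).
have iG (G : R * R -> R) w : (forall x, closure (Omega c) x -> C1_near G x) ->
    (forall r, 0 <= r <= len c -> closure (Omega c) (polar c r w)) ->
    mu.-integrable `[0, len c]%classic (EFin \o (fun r => G (polar c r w))).
  move=> cGG cl.
  apply: continuous_compact_integrable; first exact: segment_compact.
  apply: continuous_in_subspaceT => r; rewrite inE/= in_itv/= => rl.
  apply: (@continuous_comp _ _ _ (fun s => polar c s w) G); first exact: continuous_polar.
  exact/C1_near_continuous/cGG/cl.
have cl r : 0 <= r <= len c -> closure (Omega c) (polar c r (lower_angle c)).
  by move=> rl; exact: (sides_closure_Omega hc rl).1.
have cu r : 0 <= r <= len c -> closure (Omega c) (polar c r (upper_angle c)).
  by move=> rl; exact: (sides_closure_Omega hc rl).2.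
have side w (a b : R) : (forall r, 0 <= r <= len c -> closure (Omega c) (polar c r w)) ->
    \int[mu]_(r in `[0, len c]) (G1 (polar c r w) * a + G2 (polar c r w) * b) =
    a * \int[mu]_(r in `[0, len c]) G1 (polar c r w) +
    b * \int[mu]_(r in `[0, len c]) G2 (polar c r w).
  move=> clw; rewrite RintegralD//; last 2 first.
  - rewrite (_ : EFin \o _ = (fun r => (EFin \o (fun r => G1 (polar c r w))) r * a%:E)%E)//.
    by apply: integrableZr => //; exact: iG.
  - rewrite (_ : EFin \o _ = (fun r => (EFin \o (fun r => G2 (polar c r w))) r * b%:E)%E)//.
    by apply: integrableZr => //; exact: iG.
  by rewrite !RintegralZr//; try exact: iG; rewrite [_ * a]mulrC [_ * b]mulrC.
rewrite /int_sides -/(lower_angle c) -/(upper_angle c) !side//.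
rewrite /eperp /col2 !mxE /=; ring.
Qed.

End smooth_flux.

(** * Cut-off functions *)

Section cutoff.
Variable R : realType.
Implicit Types (t : R) (x s : R * R) (S : seq (R * R)).

(** The positive part, whose square is continuously differentiable. *)
Definition pos t : R := (t + `|t|) / 2.

Lemma pos_ge0 t : 0 <= pos t.
Proof. by rewrite /pos; have := ler_norm (- t); rewrite normrN; lra. Qed.

Lemma posE t : 0 <= t -> pos t = t.
Proof. by move=> t0; rewrite /pos ger0_norm//; lra. Qed.

Lemma pos0 t : t <= 0 -> pos t = 0.
Proof. by move=> t0; rewrite /pos ler0_norm//; lra. Qed.

Lemma ler_pos t : t <= pos t.
Proof. by rewrite /pos; have := ler_norm t; lra. Qed.

Lemma continuous_pos : continuous pos.
Proof.
move=> t; apply: cvgM; last exact: cvg_cst.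
by apply: cvgD; [exact: cvg_id|exact: norm_continuous].
Qed.

Lemma is_derive_sqr_pos t : is_derive t (1 : R) (fun u => pos u ^+ 2) (2 * pos t).
Proof.
have [t0|t0|->] := ltgtP t 0.
- rewrite pos0 ?ltW// mulr0.
  apply: (@near_eq_is_derive _ _ _ (cst 0)) => //.
  have := lt_nbhsl t0.
  by apply: filterS => u u0; rewrite pos0 ?ltW// expr0n.
- rewrite posE ?ltW//.
  apply: (@near_eq_is_derive _ _ _ (fun u : R => u ^+ 2 : R)) => //.
    have := lt_nbhsr t0.
    by apply: filterS => u u0; rewrite posE ?ltW.
  have e : t%:A = t :> R by exact: mulr1.
  by apply: is_derive_eq; rewrite e; ring.
- rewrite pos0// mulr0.
  have c : (h^-1 *: (((fun u => pos u ^+ 2) \o shift 0) (h *: (1 : R)) - pos 0 ^+ 2))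
      @[h --> 0^'] --> (0 : R).
    have : pos h @[h --> (0 : R)^'] --> (0 : R).
      have cp : pos h @[h --> (0 : R)] --> (0 : R).
        by have := @continuous_pos 0; rewrite /continuous_at pos0.
      exact: cvg_within_filter cp.
    apply: cvg_trans; apply: near_eq_cvg; near=> h.
    rewrite /= addr0 [h *: 1]mulr1 (pos0 (lexx 0)) expr0n subr0.
    have h0 : h != 0 by near: h; exact: nbhs_dnbhs_neq.
    have [hp|hn] := leP 0 h; first by rewrite posE// expr2 [RHS]mulKf.
    by rewrite pos0 ?ltW// expr0n [RHS]mulr0.
  split; first by apply/cvg_ex; exists 0.
  exact: cvg_lim.
Unshelve. all: by end_near. Qed.

(** A C1 profile that vanishes on t <= 1 and tends to 1 at infinity. *)
Definition ramp t : R := 1 - (1 + pos (t - 1) ^+ 2)^-1.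
Definition dramp t : R := 2 * pos (t - 1) * (1 + pos (t - 1) ^+ 2) ^- 2.

Let den_gt0 t : 0 < 1 + pos t ^+ 2.
Proof. by apply: ltr_wpDr => //; exact: sqr_ge0. Qed.

Lemma is_derive_ramp t : is_derive t (1 : R) ramp (dramp t).
Proof.
have dp : is_derive t (1 : R) (fun u => pos (u - 1) ^+ 2) (2 * pos (t - 1)).
  have d1 : is_derive t (1 : R) (fun u : R => u - 1) 1.
    by apply: is_derive_eq; rewrite subr0.
  have := @is_derive1_comp _ (fun u => pos u ^+ 2) (fun u => u - 1) t _ _
    (is_derive_sqr_pos (t - 1)) d1.
  by rewrite mulr1.
have dn : 1 + pos (t - 1) ^+ 2 != 0 by rewrite gt_eqF.
rewrite /ramp /dramp; apply: is_derive_eq.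
by rewrite !add0r !mul1r scaleNr opprK [LHS]mulrC.
Qed.

Lemma continuous_dramp : continuous dramp.
Proof.
move=> t.
have cp : {for t, continuous (fun u : R => pos (u - 1))}.
  apply: (@continuous_comp _ _ _ (fun u : R => u - 1) pos); last exact: continuous_pos.
  by apply: cvgB; [exact: cvg_id|exact: cvg_cst].
apply: cvgM; first by apply: cvgM; [exact: cvg_cst|exact: cp].
apply: cvgV; first by rewrite gt_eqF// exprn_gt0.
have cd : 1 + pos (u - 1) ^+ 2 @[u --> t] --> 1 + pos (t - 1) ^+ 2.
  by apply: cvgD; [exact: cvg_cst|apply: cvgM; exact: cp].
by apply: cvgM; exact: cd.
Qed.

Lemma ramp_itv t : 0 <= ramp t <= 1.
Proof.
have d0 := den_gt0 (t - 1); rewrite /ramp; apply/andP; split.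
  by rewrite subr_ge0 invf_le1// lerDl sqr_ge0.
by rewrite gerBl invr_ge0 ltW.
Qed.

Lemma ramp0 t : t <= 1 -> ramp t = 0.
Proof. by move=> t1; rewrite /ramp pos0 ?subr_le0// expr0n addr0 invr1 subrr. Qed.

Lemma den_ge t : t / 2 <= 1 + pos (t - 1) ^+ 2.
Proof.
have := ler_pos (t - 1); have := pos_ge0 (t - 1); set p := pos _ => p0 tp; nra.
Qed.

(** This bounds the gradient of ramp (n |x - s|^2) by a multiple of 1 / |x - s|
that does not depend on n; the last factor makes it tend to 0 as n grows. *)
Lemma dramp_bound t : `|t * dramp t| <= 3 * (1 + pos (t - 1) ^+ 2)^-1.
Proof.
have p0 := pos_ge0 (t - 1); have d0 := den_gt0 (t - 1).
have [t1|t1] := leP t 1.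
  by rewrite /dramp (pos0 (t := t - 1)) ?subr_le0// mulr0 mul0r mulr0 normr0 expr0n addr0 invr1; lra.
have pt : pos (t - 1) = t - 1 by rewrite posE// subr_ge0 ltW.
rewrite /dramp; move: p0 d0; rewrite pt; set q := 1 + (t - 1) ^+ 2 => p0 d0.
rewrite ger0_norm; last first.
  by apply: mulr_ge0; [lra|apply: mulr_ge0; [lra|rewrite invr_ge0 exprn_ge0// ltW]].
(* 3 q - 2 t (t - 1) = (t - 2)^2 + 2, where q = 1 + (t - 1)^2. *)
rewrite mulrA -subr_ge0.
have -> : 3 / q - t * (2 * (t - 1)) / q ^+ 2 = (3 * q - t * (2 * (t - 1))) / q ^+ 2.
  by field; rewrite gt_eqF.
apply: mulr_ge0; last by rewrite invr_ge0 exprn_ge0// ltW.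
rewrite /q; have := sqr_ge0 (t - 2); nra.
Qed.

(** The norm of R * R is the maximum norm, which is not differentiable; the squared
Euclidean distance is. *)
Definition sqdist s x := (x.1 - s.1) ^+ 2 + (x.2 - s.2) ^+ 2.

Lemma prod_normE x : `|x| = Num.max `|x.1| `|x.2|.
Proof. by []. Qed.

Lemma sqdist_ge s x : `|x - s| ^+ 2 <= sqdist s x.
Proof.
have e u : u ^+ 2 = `|u| ^+ 2 :> R by rewrite real_normK ?num_real.
rewrite /sqdist [(x.1 - _) ^+ 2]e [(x.2 - _) ^+ 2]e.
rewrite prod_normE /=.
case: (leP `|x.1 - s.1| `|x.2 - s.2|) => h.
  by rewrite lerDr sqr_ge0.
by rewrite lerDl sqr_ge0.
Qed.

Lemma coord_le (x : R * R) : `|x.1| <= `|x| /\ `|x.2| <= `|x|.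
Proof. by rewrite prod_normE !le_max !lexx orbT. Qed.

Lemma derive_sqdist s x j : differentiable (sqdist s) x /\
  'D_(axis R j) (sqdist s) x = 2 * ((axis R j).1 * (x.1 - s.1) + (axis R j).2 * (x.2 - s.2)).
Proof.
split; first exact: C1_near_differentiable (C1_near_sqdist s x).
have c1 : C1_near (fun y : R * R => y.1 - s.1) x.
  by apply: C1_nearD; [exact: C1_near_fst|exact: C1_near_cst].
have c2 : C1_near (fun y : R * R => y.2 - s.2) x.
  by apply: C1_nearD; [exact: C1_near_snd|exact: C1_near_cst].
have dB (f : R * R -> R) (k : R) v : differentiable f x -> 'D_v (fun y => f y - k) x = 'D_v f x.
  move=> df; have := @deriveB _ _ _ f (cst k) x v (diff_derivable df) (derivable_cst _ _ _).
  by rewrite derive_cst subr0.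
have -> : 'D_(axis R j) (sqdist s) x =
    'D_(axis R j) (fun y => (y.1 - s.1) * (y.1 - s.1)) x +
    'D_(axis R j) (fun y => (y.2 - s.2) * (y.2 - s.2)) x.
  apply: deriveD; apply: C1_near_derivable; [exact: C1_nearM|exact: C1_nearM].
have [e1 e2] := (C1_near_differentiable c1, C1_near_differentiable c2).
rewrite (derive_mul _ e1 e1) (derive_mul _ e2 e2).
rewrite !dB; [|exact: differentiable_snd|exact: differentiable_fst].
rewrite derive_fst derive_snd; ring.
Qed.

(** The function vanishes in the disc of radius (n + 1)^(-1/2) about s. *)
Definition cut1 s (n : nat) x := ramp (n.+1%:R * sqdist s x).

Lemma C1_near_cut1 s n x : C1_near (cut1 s n) x.
Proof.
apply: (@C1_near_comp1 _ (fun y => n.+1%:R * sqdist s y) ramp dramp).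
- by apply: C1_nearM; [exact: C1_near_cst|exact: C1_near_sqdist].
- exact: is_derive_ramp.
- exact: continuous_dramp.
Qed.

Lemma derive_cut1 s n x j : x != s ->
  `|'D_(axis R j) (cut1 s n) x| <=
    6 * `|x - s|^-1 * (1 + pos (n.+1%:R * sqdist s x - 1) ^+ 2)^-1.
Proof.
move=> xs; have [dq Dq] := derive_sqdist s x j.
have n0 : 0 < n.+1%:R :> R by rewrite ltr0n.
have df : differentiable (fun y => n.+1%:R * sqdist s y) x.
  by apply: C1_near_differentiable; apply: C1_nearM; [exact: C1_near_cst|exact: C1_near_sqdist].
have [_ ->] := derive_comp1 (axis R j) df (is_derive_ramp (n.+1%:R * sqdist s x)).
have -> : 'D_(axis R j) (fun y => n.+1%:R * sqdist s y) x = n.+1%:R * 'D_(axis R j) (sqdist s) x.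
  by apply: deriveMl; exact: diff_derivable.
rewrite Dq; set v := _ + _.
have r0 : 0 < `|x - s| by rewrite normr_gt0 subr_eq0.
have q0 : 0 < sqdist s x by apply: lt_le_trans (sqdist_ge s x); rewrite exprn_gt0.
have vr : `|v| <= `|x - s|.
  have [h1 h2] := coord_le (x - s).
  by rewrite /v /axis; case: ifP => _ /=; rewrite ?mul1r ?mul0r ?addr0 ?add0r.
have b := dramp_bound (n.+1%:R * sqdist s x).
set d := dramp _ in b *; set D := _^-1 in b *.
have D0 : 0 <= D.
  by rewrite /D invr_ge0 ltW.
have -> : d * (n.+1%:R * (2 * v)) = (n.+1%:R * sqdist s x * d) * (2 * v / sqdist s x).
  by field; rewrite gt_eqF.
rewrite normrM; have -> : 6 * `|x - s|^-1 * D = 3 * D * (2 * `|x - s|^-1) by ring.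
have e : `|2 * v / sqdist s x| = 2 * (`|v| / sqdist s x).
  by rewrite !normrM normfV (gtr0_norm q0) (ger0_norm (ler0n R 2)) mulrA.
apply: ler_pM => //; rewrite e ler_pM2l//.
rewrite ler_pdivrMr// (le_trans vr)//.
apply: le_trans (_ : `|x - s|^-1 * `|x - s| ^+ 2 <= _).
  by rewrite expr2 mulKf// gt_eqF.
by rewrite ler_pM2l ?invr_gt0//; exact: sqdist_ge.
Qed.

Lemma den_cvg (q : R) : 0 < q ->
  (1 + pos (n.+1%:R * q - 1) ^+ 2)^-1 @[n --> \oo] --> (0 : R).
Proof.
move=> q0.
have h : 2 / q * n.+1%:R^-1 @[n --> \oo] --> (0 : R).
  rewrite -[X in _ --> X](mulr0 (2 / q)).
  by apply: cvgM; [exact: cvg_cst|exact: cvg_harmonic].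
apply: (squeeze_cvgr _ (cvg_cst 0) h).
apply: nearW => n; have d0 := den_gt0 (n.+1%:R * q - 1).
have n0 : 0 < n.+1%:R :> R by rewrite ltr0n.
apply/andP; split; first by rewrite invr_ge0 ltW.
have -> : 2 / q * n.+1%:R^-1 = (n.+1%:R * q / 2)^-1.
  by field; rewrite !gt_eqF.
by rewrite lef_pV2 ?posrE ?divr_gt0 ?mulr_gt0//; exact: den_ge.
Qed.

Lemma cut1_near0 s n : \forall y \near s, cut1 s n y = 0.
Proof.
have c : {for s, continuous (fun y => n.+1%:R * sqdist s y)}.
  by apply: C1_near_continuous; apply: C1_nearM; [exact: C1_near_cst|exact: C1_near_sqdist].
have e : n.+1%:R * sqdist s s < 1 by rewrite /sqdist !subrr expr0n addr0 mulr0.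
apply: (near_imply _ (c _ (lt_nbhsl e))) => y h.
by apply: ramp0; exact: ltW h.
Qed.

Definition cut S n x := \prod_(s <- S) cut1 s n x.

Lemma C1_near_cut S n x : C1_near (cut S n) x.
Proof. by apply: C1_near_prod => s; exact: C1_near_cut1. Qed.

Lemma cut_itv S n x : 0 <= cut S n x <= 1.
Proof.
apply/andP; split; first by apply: prodr_ge0 => s _; case/andP: (ramp_itv (n.+1%:R * sqdist s x)).
rewrite /cut; elim: S => [|s S IH]; first by rewrite big_nil.
have /andP[r0 r1] := ramp_itv (n.+1%:R * sqdist s x).
rewrite big_cons -[leRHS]mulr1; apply: ler_pM => //.
by apply: prodr_ge0 => i _; case/andP: (ramp_itv (n.+1%:R * sqdist i x)).
Qed.

Lemma cut_near0 S n s : s \in S -> \forall y \near s, cut S n y = 0.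
Proof.
move=> sS; apply: (near_imply _ (cut1_near0 s n)) => y h.
by rewrite /cut (big_rem s)//= h mul0r.
Qed.

Lemma derive_cut_cons s S n x j : 'D_(axis R j) (cut (s :: S) n) x =
  cut1 s n x * 'D_(axis R j) (cut S n) x + cut S n x * 'D_(axis R j) (cut1 s n) x.
Proof.
have -> : cut (s :: S) n = fun y => cut1 s n y * cut S n y.
  by apply/funext => y; rewrite /cut big_cons.
by rewrite derive_mul; [|exact: C1_near_differentiable (C1_near_cut1 s n x)|exact: C1_near_differentiable (C1_near_cut S n x)].
Qed.

Lemma derive_cut_nil n x j : 'D_(axis R j) (cut [::] n) x = 0.
Proof.
have -> : cut [::] n = cst 1 by apply/funext => y; rewrite /cut big_nil.
exact: derive_cst.
Qed.

(** The bound is uniform in n, as dominated convergence requires. *)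
Lemma derive_cut_le S n x j : x \notin S ->
  `|'D_(axis R j) (cut S n) x| <= 6 * \sum_(s <- S) `|x - s|^-1.
Proof.
elim: S => [_|s S IH]; first by rewrite derive_cut_nil normr0 big_nil mulr0.
rewrite inE negb_or => /andP[xs xS].
rewrite derive_cut_cons big_cons mulrDr addrC; apply: le_trans (ler_normD _ _) _.
have h1 : `|cut1 s n x| <= 1 by have := ramp_itv (n.+1%:R * sqdist s x) => /andP[? ?]; rewrite ger0_norm.
have h2 : `|cut S n x| <= 1 by have := cut_itv S n x => /andP[? ?]; rewrite ger0_norm.
rewrite !normrM; apply: lerD.
  rewrite -[leRHS]mul1r; apply: ler_pM => //.
  apply: le_trans (derive_cut1 n j xs) _.
  rewrite -[leRHS]mulr1; apply: ler_wpM2l; first by apply: mulr_ge0 => //; rewrite invr_ge0.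
  by rewrite invf_le1// lerDl sqr_ge0.
by rewrite -[leRHS]mul1r; apply: ler_pM => //; exact: IH.
Qed.

Lemma cut_cvg S x : x \notin S -> cut S n x @[n --> \oo] --> (1 : R).
Proof.
elim: S => [_|s S IH].
  by rewrite (_ : (fun n => _) = fun=> 1); [exact: cvg_cst|apply/funext => n; rewrite /cut big_nil].
rewrite inE negb_or => /andP[xs xS].
rewrite (_ : (fun n => _) = fun n => cut1 s n x * cut S n x); last first.
  by apply/funext => n; rewrite /cut big_cons.
rewrite -[X in _ --> X](mulr1 1); apply: cvgM; last exact: IH.
rewrite -[X in _ --> X](subr0 1); apply: cvgB; first exact: cvg_cst.
apply: den_cvg; apply: lt_le_trans (sqdist_ge s x).
by rewrite exprn_gt0// normr_gt0 subr_eq0.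
Qed.

Lemma derive_cut_cvg S x j : x \notin S ->
  'D_(axis R j) (cut S n) x @[n --> \oo] --> (0 : R).
Proof.
elim: S => [_|s S IH].
  rewrite (_ : (fun n => _) = fun=> 0); first exact: cvg_cst.
  by apply/funext => n; rewrite derive_cut_nil.
rewrite inE negb_or => /andP[xs xS].
rewrite (_ : (fun n => _) = fun n => cut1 s n x * 'D_(axis R j) (cut S n) x
    + cut S n x * 'D_(axis R j) (cut1 s n) x); last first.
  by apply/funext => n; rewrite derive_cut_cons.
have c1 : cut1 s n x @[n --> \oo] --> (1 : R).
  have := @cut_cvg [:: s] x; rewrite inE => /(_ xs).
  rewrite (_ : (fun n => cut [:: s] n x) = fun n => cut1 s n x)//.
  by apply/funext => n; rewrite /cut big_seq1.
have q0 : 0 < sqdist s x.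
  by apply: lt_le_trans (sqdist_ge s x); rewrite exprn_gt0// normr_gt0 subr_eq0.
have d1 : 'D_(axis R j) (cut1 s n) x @[n --> \oo] --> (0 : R).
  have u : 6 * `|x - s|^-1 * (1 + pos (n.+1%:R * sqdist s x - 1) ^+ 2)^-1 @[n --> \oo] --> (0 : R).
    rewrite -[X in _ --> X](mulr0 (6 * `|x - s|^-1)).
    by apply: cvgM; [exact: cvg_cst|exact: den_cvg].
  apply: norm_cvg0; apply: (squeeze_cvgr _ (cvg_cst 0) u).
  by apply: nearW => n; rewrite normr_ge0 derive_cut1.
rewrite -[X in _ --> X](_ : 1 * 0 + 1 * 0 = 0); last by rewrite !mulr0 addr0.
by apply: cvgD; apply: cvgM => //; [exact: IH|exact: cut_cvg].
Qed.

End cutoff.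

(** * The blow-up weight *)

Section blowup_theory.
Variable R : realType.
Local Notation mu := (@lebesgue_measure R).
Local Notation mu2 := (mu \x mu)%E.
Implicit Types (c : config R) (S : seq (R * R)) (x s : R * R).

(** The distance to S truncated at 1; the truncation makes powers of it monotone in
the exponent. *)
Definition sdist S x := \big[Num.min/1]_(s <- S) `|x - s|.

Lemma sdist_cons s S x : sdist (s :: S) x = Num.min `|x - s| (sdist S x).
Proof. exact: big_cons. Qed.

Lemma sdist_le1 S x : sdist S x <= 1.
Proof.
elim: S => [|s S IH]; first by rewrite /sdist big_nil.
by rewrite sdist_cons ge_min IH orbT.
Qed.

Lemma sdist_gt0 S x : x \notin S -> 0 < sdist S x.
Proof.
elim: S => [_|s S IH]; first by rewrite /sdist big_nil.
rewrite inE negb_or => /andP[xs xS].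
by rewrite sdist_cons lt_min IH// andbT normr_gt0 subr_eq0.
Qed.

Lemma sdist_le S x s : s \in S -> sdist S x <= `|x - s|.
Proof.
elim: S => // t S IH; rewrite inE sdist_cons ge_min => /predU1P[->|/IH ->].
  by rewrite lexx.
by rewrite orbT.
Qed.

Lemma blowup_cons g s S x : blowup (s :: S) g x = `|x - s| `^ g + blowup S g x.
Proof. by rewrite /blowup big_cons addrCA. Qed.

Lemma blowup_ge1 g S x : 1 <= blowup S g x.
Proof. by rewrite lerDl; apply: sumr_ge0 => s _; exact: powR_ge0. Qed.

Lemma blowup_ge0 g S x : 0 <= blowup S g x.
Proof. by apply: le_trans (blowup_ge1 g S x). Qed.

Lemma sdist_powR_le g S x : x \notin S -> sdist S x `^ g <= blowup S g x.
Proof.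
elim: S => [_|s S IH].
  by rewrite /sdist /blowup !big_nil addr0 powR1.
rewrite inE negb_or => /andP[xs xS]; rewrite sdist_cons blowup_cons.
have [h|h] := leP `|x - s| (sdist S x).
  by rewrite lerDl; exact: blowup_ge0.
by apply: le_trans (IH xS) _; rewrite lerDr powR_ge0.
Qed.

Lemma sum_inv_le S x : x \notin S ->
  \sum_(s <- S) `|x - s|^-1 <= (size S)%:R * (sdist S x)^-1.
Proof.
move=> xS; have d0 := sdist_gt0 xS.
rewrite -sum1_size natr_sum mulr_suml; rewrite !big_seq; apply: ler_sum => s sS.
rewrite mul1r lef_pV2 ?posrE//; first exact: sdist_le.
by apply: lt_le_trans d0 _; exact: sdist_le.
Qed.

(** On a bounded set the weight is at most a multiple of a power of the distance to S,
which turns products of weights into a weight ([blowup_mul]).  For g >= 0 the weight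
is bounded, whence the exponent min g 0. *)
Lemma blowup_le_sdist g S (M : R) : 0 <= M -> exists2 K, 0 <= K &
  forall x, x \notin S -> (forall s, s \in S -> `|x - s| <= M) ->
  blowup S g x <= K * sdist S x `^ (Num.min g 0).
Proof.
move=> M0; exists (1 + (size S)%:R * (1 + M `^ g)).
  by apply: addr_ge0 => //; apply: mulr_ge0 => //; apply: addr_ge0 => //; exact: powR_ge0.
move=> x xS xM; have d0 := sdist_gt0 xS; have d1 := sdist_le1 S x.
set P := _ `^ Num.min g 0.
have P1 : 1 <= P.
  rewrite -[leLHS](powRr0 (sdist S x)); apply: ger_powR; first by rewrite d0.
  by rewrite ge_min lexx orbT.
have t s : s \in S -> `|x - s| `^ g <= (1 + M `^ g) * P.
  move=> sS; have ds := sdist_le x sS; have Mg := powR_ge0 M g.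
  have [g0|g0] := leP 0 g.
    apply: (@le_trans _ _ (M `^ g)); first by apply: ge0_ler_powR; rewrite ?nnegrE ?xM.
    rewrite -[leLHS]mulr1; apply: ler_pM => //; lra.
  apply: (@le_trans _ _ P); last by rewrite ler_peMl//; lra.
  have g0' := ltW g0.
  have e : Num.min g 0 = g by exact: min_l.
  by rewrite /P e; exact: powR_le_neg.
rewrite /blowup mulrDl mul1r; apply: lerD => //.
apply: (@le_trans _ _ (\sum_(s <- S) (1 + M `^ g) * P)).
  by rewrite big_seq [leRHS]big_seq; apply: ler_sum.
by rewrite big_const_seq count_predT iter_addr_0 -[leRHS]mulrA mulr_natl.
Qed.

Lemma continuous_blowup g S x : x \notin S -> {for x, continuous (blowup S g)}.
Proof.
elim: S => [_|s S IH].
  rewrite (_ : blowup [::] g = cst 1); first exact: cvg_cst.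
  by apply/funext => y; rewrite /blowup big_nil addr0.
rewrite inE negb_or => /andP[xs xS].
rewrite (_ : blowup (s :: S) g = fun y => `|y - s| `^ g + blowup S g y); last first.
  by apply/funext => y; rewrite blowup_cons.
by apply: cvgD; [exact: continuous_powR_dist|exact: IH].
Qed.

Lemma integrable_blowup_Omega c S g : admissible c -> -2 < g -> g <= 0 ->
  mu2.-integrable (Omega c) (EFin \o blowup S g).
Proof.
move=> hc g2 g0.
have mO := Omega_measurable hc.
elim: S => [|s S IH].
  apply: integrable_continuous_Omega => // x _.
  rewrite (_ : blowup [::] g = cst 1); first exact: cvg_cst.
  by apply/funext => y; rewrite /blowup big_nil addr0.
have -> : EFin \o blowup (s :: S) g = ((fun x => (`|x - s| `^ g)%:E) \+ (EFin \o blowup S g))%E.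
  by apply/funext => x; rewrite /= blowup_cons EFinD.
apply: integrableD => //.
have H := integrable_powR_plane (xl c) (xr c) (yb c) (yt c) s g2 g0.
apply: integrableS H => //.
  by apply: measurableX; exact: measurable_itv.
by apply: subset_trans (@closure_Omega_box R c); exact: subset_closure.
Qed.

Lemma integrable_finite_exceptions (D N : set R) (f : R -> R) :
  measurable D -> finite_set N -> mu.-integrable (D `\` N) (EFin \o f) ->
  mu.-integrable D (EFin \o f).
Proof.
move=> mD fN i.
have fDN : finite_set (D `&` N) by apply: sub_finite_set fN => x [].
have mN := finite_set_measurable fN.
rewrite -(setUIDK D N); apply: integrable_setU => //.
- exact: finite_set_measurable.
- exact: measurableD.
apply: null_set_integrable; last exact: lebesgue_measure_finite_set.
- exact: finite_set_measurable.
- apply/measurable_EFinP; apply: (measurable_fun_finite_exceptions _ fDN).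
    exact: finite_set_measurable.
  by rewrite setDv; exact: measurable_fun_set0.
Qed.

(** The path leaves each point s at least at speed k, which bounds |path r - s| from
below by k |r - r0 s|. *)
Lemma integrable_blowup_path (path : R -> R * R) (k a b g : R) (r0 : R * R -> R) S :
  0 < k -> -1 < g -> g <= 0 -> continuous path ->
  (forall r s, k * `|r - r0 s| <= `|path r - s|) ->
  mu.-integrable `[a, b]%classic (EFin \o (blowup S g \o path)).
Proof.
move=> k0 g1 g0 cp Hk.
elim: S => [|s S IH].
  apply: continuous_compact_integrable; first exact: segment_compact.
  apply: continuous_subspaceT => x.
  rewrite (_ : _ \o _ = cst 1); first exact: cvg_cst.
  by apply/funext => y; rewrite /blowup /= big_nil addr0.
have -> : EFin \o (blowup (s :: S) g \o path) =
   ((fun r => (`|path r - s| `^ g)%:E) \+ (EFin \o (blowup S g \o path)))%E.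
  by apply/funext => x; rewrite /= blowup_cons EFinD.
apply: integrableD => //.
apply: (@integrable_finite_exceptions _ [set r0 s] (fun r => `|path r - s| `^ g)).
- exact: measurable_itv.
- exact: finite_set1.
have mD : measurable (`[a, b]%classic `\ r0 s).
  by apply: measurableD; [exact: measurable_itv|exact: measurable_set1].
have rr r : r != r0 s -> 0 < k * `|r - r0 s|.
  by move=> h; apply: mulr_gt0 => //; rewrite normr_gt0 subr_eq0.
have i1 : mu.-integrable (`[a, b]%classic `\ r0 s) (EFin \o (fun r => k `^ g * `|r - r0 s| `^ g)).
  apply: integrable_scale => //.
  have := integrable_powR_dist a b (r0 s) g1.
  by apply: integrableS => //.
apply: le_integrable i1 => //.
- apply/measurable_EFinP.
  have oN : open (~` [set r0 s]).
    by apply: closed_openC; apply: accessible_closed_set1; apply: hausdorff_accessible; exact: norm_hausdorff.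
  have mo : measurable_fun (~` [set r0 s]) (fun r => `|path r - s| `^ g).
    apply: open_continuous_measurable_fun => // r; rewrite inE/= => /eqP rs.
    apply: (@continuous_powR_comp R _ (fun r => `|path r - s|) g r); last exact: lt_le_trans (rr _ rs) (Hk r s).
    by apply: cvg_norm; apply: cvgB; [exact: cp|exact: cvg_cst].
  apply: measurable_funS mo; first exact: open_measurable.
  by move=> r [].
- move=> r [_ /eqP rs]; rewrite lee_fin ger0_norm ?powR_ge0//.
  rewrite ger0_norm ?mulr_ge0 ?powR_ge0//.
  rewrite -(powRM _ (ltW k0) (normr_ge0 _)).
  by apply: powR_le_neg => //; exact: rr.
Qed.

Lemma closure_ge0 (A : set (R * R)) (g : R * R -> R) x :
  closure A x -> {for x, continuous g} -> (forall y, A y -> 0 <= g y) -> 0 <= g x.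
Proof.
move=> Ax cg H; rewrite leNgt; apply/negP => gx.
have [y [Ay]] := Ax _ (cg _ (lt_nbhsl gx)).
by rewrite /= ltNge H.
Qed.

End blowup_theory.

(** * Removing the cut-off along paths *)

Section cut_limits.
Variable R : realType.
Local Notation mu := (@lebesgue_measure R).
Implicit Types (c : config R) (S : seq (R * R)) (x s : R * R).

Lemma Omega_dist_bound c S : exists2 M, 0 <= M &
  forall x s, closure (Omega c) x -> s \in S -> `|x - s| <= M.
Proof.
have [B [_ HB]] := compact_bounded (@closure_Omega_compact R c).
exists (`|B| + 1 + \sum_(s <- S) `|s|).
  by rewrite !addr_ge0// sumr_ge0.
move=> x s Ox sS; apply: le_trans (ler_normB _ _) _; apply: lerD.
  by apply: HB => //; have := ler_norm B; lra.
by rewrite (big_rem s)//= lerDl sumr_ge0.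
Qed.

(** The field itself may be arbitrary at the points of S, near which the cut-off is
identically zero. *)
Lemma C1_near_cutM S n (F : R * R -> R) x :
  (x \notin S -> C1_near F x) -> C1_near (fun y => cut S n y * F y) x.
Proof.
move=> cF; have [xS|xS] := boolP (x \in S); last first.
  by apply: C1_nearM; [exact: C1_near_cut|exact: cF].
apply: C1_near_eq (C1_near_cst 0 x).
by apply: (near_imply _ (cut_near0 n xS)) => y ->; rewrite mul0r.
Qed.

(** The bounds of the hypotheses hold in Omega only; on its boundary off S they
follow by continuity. *)
Lemma closure_bound c S (g K : R) (F : R * R -> R) x :
  (forall x, closure (Omega c) x -> x \notin S -> C1_near F x) ->
  (forall x, Omega c x -> `|F x| <= K * blowup S g x) ->
  closure (Omega c) x -> x \notin S -> `|F x| <= K * blowup S g x.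
Proof.
move=> cF bF Ox xS; rewrite -subr_ge0.
apply: (@closure_ge0 _ (Omega c) (fun y => K * blowup S g y - `|F y|)) => //.
  apply: cvgB.
    by apply: cvgM; [exact: cvg_cst|exact: continuous_blowup].
  by apply: cvg_norm; exact/C1_near_continuous/cF.
by move=> y Oy; rewrite subr_ge0; exact: bF.
Qed.

Section along_a_path.
Variables (c : config R) (S : seq (R * R)) (g K k a b : R).
Variables (path : R -> R * R) (r0 : R * R -> R).
Hypotheses (k0 : 0 < k) (g1 : -1 < g) (g0 : g <= 0).
Hypotheses (cp : continuous path) (K0 : 0 <= K).
Hypothesis Hk : forall r s, k * `|r - r0 s| <= `|path r - s|.
Hypothesis Hp : forall r, a <= r <= b -> closure (Omega c) (path r).

Lemma path_exceptions : finite_set [set r | path r \in S].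
Proof.
apply: (@sub_finite_set _ _ (r0 @` [set` S])); last exact: finite_image.
move=> r /= rS; exists (path r) => //.
have := Hk r (path r); rewrite subrr normr0 pmulr_rle0// normr_le0 subr_eq0.
by move=> /eqP.
Qed.

Lemma path_integrable (f : R -> R) :
  (forall r, a <= r <= b -> path r \notin S -> {for r, continuous f}) ->
  (forall r, a <= r <= b -> path r \notin S -> `|f r| <= K * blowup S g (path r)) ->
  mu.-integrable `[a, b]%classic (EFin \o f).
Proof.
move=> cf bf.
have fN := path_exceptions.
apply: (integrable_finite_exceptions _ fN); first exact: measurable_itv.
have mN := finite_set_measurable fN.
have mD : measurable (`[a, b]%classic `\` [set r | path r \in S]).
  by apply: measurableD => //; exact: measurable_itv.
have i1 : mu.-integrable (`[a, b]%classic `\` [set r | path r \in S])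
    (EFin \o (fun r => K * blowup S g (path r))).
  apply: integrable_scale => //.
  have := @integrable_blowup_path R path k a b g r0 S k0 g1 g0 cp Hk.
  by apply: integrableS => //; exact: measurable_itv.
apply: le_integrable i1 => //.
- apply/measurable_EFinP; apply: subspace_continuous_measurable_fun => //.
  apply: continuous_in_subspaceT => r; rewrite inE /= in_itv/= => -[rab /negP rS].
  exact: cf.
- move=> r [/=]; rewrite in_itv/= => rab /negP rS; rewrite lee_fin.
  rewrite [leRHS]ger0_norm; first exact: bf.
  by apply: mulr_ge0 => //; exact: blowup_ge0.
Qed.

Variable H : R * R -> R.
Hypothesis cH : forall x, closure (Omega c) x -> x \notin S -> C1_near H x.
Hypothesis bH : forall x, Omega c x -> `|H x| <= K * blowup S g x.

Lemma path_field_integrable : mu.-integrable `[a, b]%classic (EFin \o (H \o path)).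
Proof.
apply: path_integrable => r rab rS.
  by apply: continuous_comp; [exact: cp|apply/C1_near_continuous/cH => //; exact: Hp].
by apply: (closure_bound cH bH) => //; exact: Hp.
Qed.

Lemma path_cut_continuous n r : a <= r <= b ->
  {for r, continuous (fun r => cut S n (path r) * H (path r))}.
Proof.
move=> rab; apply: (@continuous_comp _ _ _ path (fun y => cut S n y * H y)); first exact: cp.
by apply: C1_near_continuous; apply: C1_near_cutM => rS; apply: cH => //; exact: Hp.
Qed.

Lemma path_cut_integrable n :
  mu.-integrable `[a, b]%classic (EFin \o (fun r => cut S n (path r) * H (path r))).
Proof.
apply: continuous_compact_integrable; first exact: segment_compact.
by apply: continuous_in_subspaceT => r; rewrite inE/= in_itv/=; exact: path_cut_continuous.
Qed.

(** Dominated convergence; the points of S on the path, where the cut-off kills the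
field for all n, form a finite set of parameters. *)
Lemma path_cut_cvg :
  \int[mu]_(r in `[a, b]) (cut S n (path r) * H (path r)) @[n --> \oo] -->
  \int[mu]_(r in `[a, b]) H (path r).
Proof.
have fN := path_exceptions.
pose f r := if path r \in S then 0 else H (path r).
have -> : \int[mu]_(r in `[a, b]) H (path r) = \int[mu]_(r in `[a, b]) f r.
  apply: (@Rintegral_finite_exceptions _ _ [set r | path r \in S]) => //.
    by have := measurable_int _ path_field_integrable => /measurable_EFinP.
  by move=> r _ /negP rS; rewrite /f (negbTE rS).
have mn n : measurable_fun `[a, b]%classic (fun r => cut S n (path r) * H (path r)).
  by have := measurable_int _ (path_cut_integrable n) => /measurable_EFinP.
have lim r : `[a, b]%classic r -> cut S n (path r) * H (path r) @[n --> \oo] --> f r.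
  move=> _; rewrite /f; have [rS|rS] := boolP (path r \in S).
    rewrite (_ : (fun n => _) = fun=> 0); first exact: cvg_cst.
    by apply/funext => n; rewrite (nbhs_singleton (cut_near0 n rS)) mul0r.
  rewrite -[X in _ --> X]mul1r; apply: cvgM; last exact: cvg_cst.
  exact: cut_cvg.
have mf : measurable_fun `[a, b]%classic f.
  by apply: measurable_fun_cvg lim.
apply: (@Rintegral_dominated_cvg R _ _ mu _ _ f (fun r => K * blowup S g (path r))) => //.
- apply: integrable_scale; first exact: measurable_itv.
  exact: (@integrable_blowup_path R path k a b g r0 S k0 g1 g0 cp Hk).
move=> n r /=; rewrite in_itv/= => rab.
have /andP[c0 c1] := cut_itv S n (path r).
rewrite normrM ger0_norm//.
have [rS|rS] := boolP (path r \in S).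
  rewrite (nbhs_singleton (cut_near0 n rS)) mul0r.
  by apply: mulr_ge0 => //; exact: blowup_ge0.
apply: le_trans (closure_bound cH bH (Hp rab) rS).
by rewrite ler_piMl.
Qed.

End along_a_path.
End cut_limits.

(** * The divergence theorem for singular fields *)

Section singular_flux.
Variable R : realType.
Local Notation mu := (@lebesgue_measure R).
Local Notation mu2 := (mu \x mu)%E.
Implicit Types (c : config R) (S : seq (R * R)) (x s : R * R).

Lemma eq_ler (u v : R) : u = v -> u <= v.
Proof. by move=> ->. Qed.

(** The parameter of the point of the ray with the same ordinate as s is
((hinge c).2 - s.2) / cos w; ordinates move at speed cos w along the ray. *)
Lemma polar_dist c w r s : 0 < cos w ->
  cos w * `|r - ((hinge c).2 - s.2) / cos w| <= `|polar c r w - s|.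
Proof.
move=> cw; apply: le_trans (coord_le (polar c r w - s)).2.
rewrite -[X in X * _]gtr0_norm// -normrM mulrBr [cos w * (_ / _)]mulrC divfK ?gt_eqF//.
rewrite /polar/= -normrN; apply: eq_ler; congr `| _ |; ring.
Qed.

Lemma edge_dist (e r : R) s : 1 * `|r - s.2| <= `|(e, r) - s|.
Proof. by rewrite mul1r; exact: (coord_le ((e, r) - s)).2. Qed.

(** The divergence of the truncated field is the truncated divergence plus the
field times the gradient of the cut-off.  The latter tends to 0 pointwise, and is
dominated by sdist^g / sdist <= blowup (g - 1). *)
Lemma singular_flux c S (g K : R) (F1 F2 : R * R -> R) : admissible c ->
  (forall s, s \in S -> ~ Omega c s) -> -1 < g -> g <= 0 -> 0 <= K ->
  (forall x, closure (Omega c) x -> x \notin S -> C1_near F1 x /\ C1_near F2 x) ->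
  (forall x, Omega c x ->
     `|F1 x| <= K * blowup S g x /\ `|F2 x| <= K * blowup S g x) ->
  (forall x, Omega c x ->
     `|'D_(axis R 0) F1 x + 'D_(axis R 1) F2 x| <= K * blowup S (g - 1) x) ->
  (forall x, walls c x -> x \notin S -> F2 x = 0) ->
  (forall x, leaflet c x -> on_arc c x -> x \notin S -> F1 x = 0 /\ F2 x = 0) ->
  int_Omega c (fun x => 'D_(axis R 0) F1 x + 'D_(axis R 1) F2 x) =
  \int[mu]_(y in `[yb c, yt c]) (F1 (xr c, y) - F1 (xl c, y))
  + int_sides c (fun r w n => F1 (polar c r w) * n 0 0 + F2 (polar c r w) * n 1 0).
Proof.
move=> hc SO g1 g0 K0 cF bF bdiv Fw Fa.
have [a1 a12 a2] := angle_bounds hc.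
have cw1 := cos1_gt0 a1 a12 a2; have cw2 := cos2_gt0 a1 a12 a2.
have mO := Omega_measurable hc.
have cF1 x : closure (Omega c) x -> x \notin S -> C1_near F1 x by move=> Ox /(cF _ Ox)[].
have cF2 x : closure (Omega c) x -> x \notin S -> C1_near F2 x by move=> Ox /(cF _ Ox)[].
have bF1 x : Omega c x -> `|F1 x| <= K * blowup S g x by move=> /bF[].
have bF2 x : Omega c x -> `|F2 x| <= K * blowup S g x by move=> /bF[].
have OS x : Omega c x -> x \notin S by move=> Ox; apply/negP => /SO.
pose G1 n x := cut S n x * F1 x; pose G2 n x := cut S n x * F2 x.
have cG n x : closure (Omega c) x -> C1_near (G1 n) x /\ C1_near (G2 n) x.
  by move=> Ox; split; apply: C1_near_cutM => xS; [exact: cF1|exact: cF2].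
have cut0 n x : x \in S -> cut S n x = 0.
  by move=> xS; exact: (nbhs_singleton (cut_near0 n xS)).
have flux n : int_Omega c (fun x => 'D_(axis R 0) (G1 n) x + 'D_(axis R 1) (G2 n) x) =
  \int[mu]_(y in `[yb c, yt c]) (G1 n (xr c, y) - G1 n (xl c, y))
  + int_sides c (fun r w m => G1 n (polar c r w) * m 0 0 + G2 n (polar c r w) * m 1 0).
  apply: (smooth_flux hc (cG n)).
    move=> x wx; rewrite /G2; have [xS|xS] := boolP (x \in S); first by rewrite cut0// mul0r.
    by rewrite Fw// mulr0.
  move=> x Lx ax; rewrite /G1 /G2; have [xS|xS] := boolP (x \in S); first by rewrite cut0// !mul0r.
  by have [-> ->] := Fa x Lx ax xS; rewrite !mulr0.
have clr y : yb c <= y <= yt c -> closure (Omega c) (xr c, y).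
  by move=> yy; exact: (edges_closure_Omega hc yy).2.
have cll y : yb c <= y <= yt c -> closure (Omega c) (xl c, y).
  by move=> yy; exact: (edges_closure_Omega hc yy).1.
have edge_cvg : \int[mu]_(y in `[yb c, yt c]) (G1 n (xr c, y) - G1 n (xl c, y))
    @[n --> \oo] --> \int[mu]_(y in `[yb c, yt c]) (F1 (xr c, y) - F1 (xl c, y)).
  have L := path_cut_cvg ltr01 g1 g0 (@continuous_edge R _) K0 (edge_dist (xl c)) cll cF1 bF1.
  have Rr := path_cut_cvg ltr01 g1 g0 (@continuous_edge R _) K0 (edge_dist (xr c)) clr cF1 bF1.
  rewrite RintegralB; last 3 first.
  - exact: measurable_itv.
  - exact: (path_field_integrable ltr01 g1 g0 (@continuous_edge R _) K0 (edge_dist (xr c)) clr cF1 bF1).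
  - exact: (path_field_integrable ltr01 g1 g0 (@continuous_edge R _) K0 (edge_dist (xl c)) cll cF1 bF1).
  rewrite (_ : (fun n => _) = (fun n => \int[mu]_(y in `[yb c, yt c]) G1 n (xr c, y)
      - \int[mu]_(y in `[yb c, yt c]) G1 n (xl c, y))).
    exact: cvgB Rr L.
  apply/funext => n; rewrite RintegralB//.
  - exact: (path_cut_integrable (@continuous_edge R _) clr cF1 n).
  - exact: (path_cut_integrable (@continuous_edge R _) cll cF1 n).
have side_cvg w (p q : R) : 0 < cos w ->
    (forall r, 0 <= r <= len c -> closure (Omega c) (polar c r w)) ->
    \int[mu]_(r in `[0, len c]) (G1 n (polar c r w) * p + G2 n (polar c r w) * q)
    @[n --> \oo] -->
    \int[mu]_(r in `[0, len c]) (F1 (polar c r w) * p + F2 (polar c r w) * q).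
  move=> cw clw; pose H x := F1 x * p + F2 x * q.
  have cH x : closure (Omega c) x -> x \notin S -> C1_near H x.
    move=> Ox xS; apply: C1_nearD; apply: C1_nearM; try exact: C1_near_cst.
      exact: cF1.
    exact: cF2.
  have bH x : Omega c x -> `|H x| <= K * (`|p| + `|q|) * blowup S g x.
    move=> Ox; rewrite mulrAC mulrDr; apply: le_trans (ler_normD _ _) _.
    by rewrite !normrM; apply: lerD; apply: ler_wpM2r => //; [exact: bF1|exact: bF2].
  have K0' : 0 <= K * (`|p| + `|q|) by rewrite mulr_ge0// addr_ge0.
  have := path_cut_cvg cw g1 g0 (@continuous_polar R c w) K0' (fun r s => @polar_dist c w r s cw) clw cH bH.
  rewrite (_ : (fun n => _) = (fun n => \int[mu]_(r in `[0, len c])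
     (G1 n (polar c r w) * p + G2 n (polar c r w) * q)))//.
  apply/funext => n; apply: eq_Rintegral => r _.
  by rewrite /H /G1 /G2 mulrDr !mulrA.
have sides_cvg : int_sides c (fun r w m => G1 n (polar c r w) * m 0 0 + G2 n (polar c r w) * m 1 0)
    @[n --> \oo] -->
    int_sides c (fun r w m => F1 (polar c r w) * m 0 0 + F2 (polar c r w) * m 1 0).
  apply: cvgD.
    by apply: side_cvg => // r rl; exact: (sides_closure_Omega hc rl).1.
  by apply: side_cvg => // r rl; exact: (sides_closure_Omega hc rl).2.
have [M M0 HM] := Omega_dist_bound c S.
have [K1 K10 HK1] := blowup_le_sdist g S M0.
(* 12 is twice the constant of [derive_cut_le], for the two components. *)
pose K2 := K + 12 * (size S)%:R * K * K1.
have K20 : 0 <= K2 by rewrite /K2 addr_ge0// !mulr_ge0.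
have DG n x : Omega c x -> 'D_(axis R 0) (G1 n) x + 'D_(axis R 1) (G2 n) x =
    cut S n x * ('D_(axis R 0) F1 x + 'D_(axis R 1) F2 x)
    + (F1 x * 'D_(axis R 0) (cut S n) x + F2 x * 'D_(axis R 1) (cut S n) x).
  move=> Ox; have Ox' := subset_closure Ox; have xS := OS _ Ox.
  have dc := C1_near_differentiable (C1_near_cut S n x).
  rewrite /G1 /G2 !derive_mul//; try exact: C1_near_differentiable (cF1 _ Ox' xS);
    try exact: C1_near_differentiable (cF2 _ Ox' xS).
  set A0 := 'D__ F1 x; set A1 := 'D__ F2 x; set B0 := 'D__ _ x; set B1 := 'D__ _ x.
  move: A0 A1 B0 B1 (cut S n x) (F1 x) (F2 x) => A0 A1 B0 B1 k u1 u2; ring.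
have vol_cvg : int_Omega c (fun x => 'D_(axis R 0) (G1 n) x + 'D_(axis R 1) (G2 n) x)
    @[n --> \oo] --> int_Omega c (fun x => 'D_(axis R 0) F1 x + 'D_(axis R 1) F2 x).
  have HD := @Rintegral_dominated_cvg R _ _ mu2 (Omega c)
    (fun n x => 'D_(axis R 0) (G1 n) x + 'D_(axis R 1) (G2 n) x)
    (fun x => 'D_(axis R 0) F1 x + 'D_(axis R 1) F2 x) (fun x => K2 * blowup S (g - 1) x) mO.
  apply HD; clear HD.
  - move=> n; apply: open_continuous_measurable_plane; first exact: Omega_open.
    move=> x /subset_closure /(cG n)[h1 h2].
    by apply: cvgD; exact: C1_near_partial.
  - apply: open_continuous_measurable_plane; first exact: Omega_open.
    move=> x Ox; have [h1 h2] := cF x (subset_closure Ox) (OS _ Ox).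
    by apply: cvgD; exact: C1_near_partial.
  - move=> x Ox; have xS := OS _ Ox.
    rewrite (_ : (fun n => _) = fun n => cut S n x * ('D_(axis R 0) F1 x + 'D_(axis R 1) F2 x)
       + (F1 x * 'D_(axis R 0) (cut S n) x + F2 x * 'D_(axis R 1) (cut S n) x)); last first.
      by apply/funext => n; rewrite DG.
    set d := _ + _; rewrite -[X in _ --> X](_ : 1 * d + (F1 x * 0 + F2 x * 0) = d); last by ring.
    apply: cvgD; first by apply: cvgM; [exact: cut_cvg|exact: cvg_cst].
    by apply: cvgD; apply: cvgM; try exact: cvg_cst; exact: derive_cut_cvg.
  - have i := @integrable_blowup_Omega R c S (g - 1) hc.
    by apply: integrable_scale; [exact: mO|apply: i; lra].
  move=> n x Ox; have xS := OS _ Ox; rewrite DG//.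
  have d0 := sdist_gt0 xS.
  have /andP[c0 c1] := cut_itv S n x.
  have s1 := sum_inv_le xS.
  have b1 : blowup S g x <= K1 * sdist S x `^ g.
    have := HK1 x xS (fun s sS => HM x s (subset_closure Ox) sS).
    by rewrite min_l.
  have b2 : sdist S x `^ g * (sdist S x)^-1 <= blowup S (g - 1) x.
    rewrite -(powR_inv1 (ltW d0)) -powRD; last by apply/implyP => _; rewrite gt_eqF.
    exact: sdist_powR_le.
  have FD (F : R * R -> R) j : `|F x| <= K * blowup S g x ->
      `|F x * 'D_(axis R j) (cut S n) x| <= 6 * (size S)%:R * K * K1 * blowup S (g - 1) x.
    move=> bFx; rewrite normrM.
    apply: (@le_trans _ _ ((K * (K1 * sdist S x `^ g)) * (6 * ((size S)%:R * (sdist S x)^-1)))).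
      apply: ler_pM => //.
        by apply: le_trans bFx _; apply: ler_wpM2l.
      by apply: le_trans (derive_cut_le n j xS) _; apply: ler_wpM2l.
    rewrite (_ : _ * _ = 6 * (size S)%:R * K * K1 * (sdist S x `^ g * (sdist S x)^-1)); last by ring.
    by apply: ler_wpM2l => //; rewrite !mulr_ge0.
  have e1 := FD F1 0 (bF1 _ Ox); have e2 := FD F2 1 (bF2 _ Ox).
  apply: le_trans (ler_normD _ _) _.
  rewrite /K2 mulrDl; apply: lerD.
    by rewrite normrM ger0_norm//; apply: le_trans (bdiv _ Ox); rewrite ler_piMl.
  apply: le_trans (ler_normD _ _) _.
  by apply: le_trans (lerD e1 e2) _; apply: eq_ler; ring.
have rhs_cvg := cvgD edge_cvg sides_cvg.
have E := funext flux.
rewrite E in vol_cvg.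
exact: (cvg_unique (@Rhausdorff R) vol_cvg (rhs_cvg _)).
Qed.

End singular_flux.

(** * Work of the stress of a Stokes flow *)

Section stokes_fields.
Variable R : realType.
Local Notation mu := (@lebesgue_measure R).
Local Notation mu2 := (mu \x mu)%E.
Implicit Types (c : config R) (S : seq (R * R)) (x s : R * R).
Implicit Types (v w : R * R -> 'cV[R]_2) (p q : R * R -> R).

Lemma sum2 (V : nmodType) (f : 'I_2 -> V) : \sum_(i < 2) f i = f 0 + f 1.
Proof. by rewrite big_ord_recl big_ord1; congr (_ + f _); exact: val_inj. Qed.

Lemma mulmx2 (A : 'M[R]_2) (n : 'cV[R]_2) i : (A *m n) i 0 = A i 0 * n 0 0 + A i 1 * n 1 0.
Proof. by rewrite mxE sum2. Qed.

Lemma dotE (m n : 'cV[R]_2) : dot m n = m 0 0 * n 0 0 + m 1 0 * n 1 0.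
Proof. exact: sum2. Qed.

Lemma entry_norm (m n : nat) (A : 'M[R]_(m, n)) i j : `|A i j| <= `|A|.
Proof.
rewrite [leRHS]mx_normrE.
exact: (le_bigmax _ (fun ij : 'I_m * 'I_n => `|A ij.1 ij.2|) (i, j)).
Qed.

(** Points may be added to S; this is used for the two corners of the tip, where the
boundary of the leaflet has no tangent. *)
Lemma regular_cons c s S a v p : regular c S a v p -> regular c (s :: S) a v p.
Proof.
move=> [h1 [C h2]]; split.
  by move=> x Ox; rewrite inE negb_or => /andP[_]; exact: h1.
exists `|C| => x /h2[b1 b2 b3].
have M e (t : R) : t <= C * blowup S e x -> t <= `|C| * blowup (s :: S) e x.
  move=> h; apply: le_trans h _; apply: (@le_trans _ _ (`|C| * blowup S e x)).
    by apply: ler_wpM2r; [exact: blowup_ge0|exact: ler_norm].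
  by apply: ler_wpM2l => //; rewrite blowup_cons lerDr powR_ge0.
by split; exact: M.
Qed.

Lemma normM_le (F G C1 C2 K B1 B2 B : R) : 0 <= C1 -> 0 <= C2 ->
  B1 * B2 <= K * B -> `|F| <= C1 * B1 -> `|G| <= C2 * B2 ->
  `|F * G| <= C1 * C2 * K * B.
Proof.
move=> C10 C20 hB hF hG; rewrite normrM; apply: le_trans (ler_pM _ _ hF hG) _ => //.
by rewrite mulrACA -[leRHS]mulrA; apply: ler_wpM2l; [exact: mulr_ge0|exact: hB].
Qed.

Lemma blowup_mul c S (p1 p2 e : R) :
  (forall s, s \in S -> ~ Omega c s) ->
  e <= Num.min p1 0 + Num.min p2 0 ->
  exists2 K, 0 <= K & forall x, Omega c x ->
    blowup S p1 x * blowup S p2 x <= K * blowup S e x.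
Proof.
move=> SO he.
have [M M0 HM] := Omega_dist_bound c S.
have [K1 K10 H1] := blowup_le_sdist p1 S M0.
have [K2 K20 H2] := blowup_le_sdist p2 S M0.
exists (K1 * K2); first exact: mulr_ge0.
move=> x Ox; have xS : x \notin S by apply/negP => /SO.
have d0 := sdist_gt0 xS; have d1 := sdist_le1 S x.
have Hx s : s \in S -> `|x - s| <= M by move=> sS; apply: HM => //; exact: subset_closure.
apply: (@le_trans _ _ ((K1 * sdist S x `^ Num.min p1 0) * (K2 * sdist S x `^ Num.min p2 0))).
  by apply: ler_pM; rewrite ?blowup_ge0//; [exact: H1|exact: H2].
rewrite mulrACA -powRD; last by apply/implyP => _; rewrite gt_eqF.
apply: ler_wpM2l; first exact: mulr_ge0.
apply: le_trans (sdist_powR_le e xS).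
by apply: ger_powR => //; rewrite d0.
Qed.

Lemma regular_velocity c S a v p i : regular c S a v p ->
  forall x, closure (Omega c) x -> x \notin S ->
  [/\ C1_near (fun y => v y i 0) x,
      (forall j, C1_near (fun y => grad v y i j) x) & C1_near p x].
Proof.
move=> [h _] x Ox xS; have [/(_ i)[c1 c2] c3] := h x Ox xS.
split; [exact: c1| |exact: c3] => j; apply: C1_near_eq (c2 j).
by apply: near_everywhere => y; rewrite mxE.
Qed.

Lemma regular_bounds c S a v p : regular c S a v p ->
  exists2 C, 0 <= C & forall x i j, Omega c x ->
  [/\ `|v x i 0| <= C * blowup S a x,
      `|grad v x i j| <= C * blowup S (a - 1) x & `|p x| <= C * blowup S (a - 1) x].
Proof.
move=> [_ [C H]]; exists `|C| => // x i j /H[b1 b2 b3].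
have M e (t : R) : t <= C * blowup S e x -> t <= `|C| * blowup S e x.
  move=> h; apply: le_trans h _.
  by apply: ler_wpM2r; [exact: blowup_ge0|exact: ler_norm].
split; apply: M => //; [exact: le_trans (entry_norm _ _ _) b1|exact: le_trans (entry_norm _ _ _) b2].
Qed.

Lemma symgradE v x i j : symgrad v x i j = 2^-1 * (grad v x i j + grad v x j i).
Proof. by rewrite !mxE. Qed.

Lemma stressE nu v p x i j :
  stress nu v p x i j = nu * (2^-1 * (grad v x i j + grad v x j i)) + p x *+ (i == j).
Proof. by rewrite !mxE. Qed.

Lemma stress_C1 nu c S a v p i j : regular c S a v p ->
  forall x, closure (Omega c) x -> x \notin S ->
  C1_near (fun y => stress nu v p y i j) x.
Proof.
move=> rv x Ox xS.
have [_ /(_ j) ci cp] := regular_velocity i rv Ox xS.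
have [_ /(_ i) cj _] := regular_velocity j rv Ox xS.
have -> : (fun y => stress nu v p y i j) = (fun y => nu * (2^-1 * (grad v y i j + grad v y j i))
    + p y * (i == j)%:R).
  by apply/funext => y; rewrite stressE mulr_natr.
apply: C1_nearD (C1_nearM cp (C1_near_cst _ x)).
exact: C1_nearM (C1_near_cst _ x) (C1_nearM (C1_near_cst _ x) (C1_nearD ci cj)).
Qed.

Lemma stress_bound nu c S a v p : regular c S a v p ->
  exists2 C, 0 <= C & forall x i j, Omega c x ->
    `|stress nu v p x i j| <= C * blowup S (a - 1) x.
Proof.
move=> /regular_bounds[C C0 H]; exists (`|nu| * C + C).
  by rewrite addr_ge0// mulr_ge0.
move=> x i j Ox; rewrite stressE mulrDl.
have [_ b1 b3] := H x i j Ox; have [_ b2 _] := H x j i Ox.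
apply: le_trans (ler_normD _ _) _; apply: lerD.
  rewrite normrM -mulrA; apply: ler_wpM2l => //.
  rewrite normrM gtr0_norm ?invr_gt0//.
  by have := ler_normD (grad v x i j) (grad v x j i); lra.
case: (i == j) => //=; rewrite ?mulr1n// mulr0n normr0.
by rewrite mulr_ge0// blowup_ge0.
Qed.

(** The j-th component of T w, where T is the (symmetric) stress of (v, p). *)
Definition sflux nu v p w j x := \sum_(i < 2) stress nu v p x i j * w x i 0.

Lemma derive_sum2 (F : 'I_2 -> R * R -> R) x (e : R * R) : (forall i, differentiable (F i) x) ->
  'D_e (fun y => \sum_(i < 2) F i y) x = \sum_(i < 2) 'D_e (F i) x.
Proof.
move=> dF; have -> : (fun y => \sum_(i < 2) F i y) = F 0 + F 1.
  by apply/funext => y; rewrite sum2.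
by rewrite sum2 deriveD//; exact: diff_derivable.
Qed.

Lemma sflux_C1 nu c S a b v p w q j : regular c S a v p -> regular c S b w q ->
  forall x, closure (Omega c) x -> x \notin S -> C1_near (sflux nu v p w j) x.
Proof.
move=> rv rw x Ox xS; apply: (@C1_near_sum2 _ (fun i y => stress nu v p y i j * w y i 0)) => i.
apply: C1_nearM; first exact: stress_C1 rv _ Ox xS.
by have [] := regular_velocity i rw Ox xS.
Qed.

Lemma sflux_div nu c S a b v p w q : regular c S a v p -> regular c S b w q ->
  forall x, closure (Omega c) x -> x \notin S ->
  'D_(axis R 0) (sflux nu v p w 0) x + 'D_(axis R 1) (sflux nu v p w 1) x =
  ddot (stress nu v p x) (grad w x) + dot (divt (stress nu v p) x) (w x).
Proof.
move=> rv rw x Ox xS.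
have cT i j := C1_near_differentiable (stress_C1 nu i j rv Ox xS).
have cw i : differentiable (fun y => w y i 0) x.
  by have [/C1_near_differentiable] := regular_velocity i rw Ox xS.
have D j : 'D_(axis R j) (sflux nu v p w j) x =
    \sum_(i < 2) (stress nu v p x i j * grad w x i j +
       w x i 0 * 'D_(axis R j) (fun y => stress nu v p y i j) x).
  rewrite (@derive_sum2 (fun i y => stress nu v p y i j * w y i 0)); last first.
    by move=> i; exact: differentiableM.
  by apply: eq_bigr => i _; rewrite derive_mul// [grad w x i j]mxE.
have dT i : divt (stress nu v p) x i 0 = 'D_(axis R 0) (fun y => stress nu v p y i 0) x
    + 'D_(axis R 1) (fun y => stress nu v p y i 1) x by rewrite mxE sum2.
rewrite !D /ddot /dot !sum2 !dT.
move: ('D__ _ x) ('D__ _ x) ('D__ _ x) ('D__ _ x) (stress _ _ _ _) (grad _ _) (w x).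
by move=> d00 d10 d01 d11 T G W; ring.
Qed.

(** The pressure contributes p div w = 0, and symgrad v is symmetric. *)
Lemma ddot_stress nu v p w x : divv w x = 0 ->
  ddot (stress nu v p x) (grad w x) = nu * ddot (symgrad v x) (symgrad w x).
Proof.
rewrite /divv /mxtrace sum2 /ddot !sum2.
move: (stressE nu v p x) (symgradE v x) (symgradE w x).
move: (stress nu v p x) (symgrad v x) (symgrad w x) (grad v x) (grad w x).
move=> T SV SW V W hT hV hW dw; rewrite !hT !hV !hW /= mulr1n !mulr0n.
have -> : W 0 0 = - W 1 1 by lra.
by field.
Qed.

Lemma integrable_Omega_bound c S (e K : R) (f : R * R -> R) : admissible c ->
  -2 < e -> e <= 0 -> (forall x, Omega c x -> {for x, continuous f}) ->
  (forall x, Omega c x -> `|f x| <= K * blowup S e x) ->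
  mu2.-integrable (Omega c) (EFin \o f).
Proof.
move=> hc e2 e0 cf bf.
have mO := Omega_measurable hc.
have mf : measurable_fun (Omega c) f.
  by apply: open_continuous_measurable_plane => //; exact: Omega_open.
have i : mu2.-integrable (Omega c) (EFin \o (fun x => K * blowup S e x)).
  by apply: integrable_scale; [exact: mO|exact: integrable_blowup_Omega].
have H := @le_integrable _ _ R mu2 (Omega c) mO (EFin \o f) _
  ((measurable_EFinP _ _).2 mf) _ i.
apply H => x Ox; rewrite lee_fin; apply: le_trans (bf _ Ox) _; exact: ler_norm.
Qed.

Variables (nu a b : R) (c : config R) (S : seq (R * R)).
Hypotheses (hc : admissible c) (SO : forall s, s \in S -> ~ Omega c s).
Hypotheses (nu0 : 0 < nu) (a0 : 0 < a) (b0 : -1 < b) (ab0 : 0 < a + b).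
Variables (v w f : R * R -> 'cV[R]_2) (p q : R * R -> R).
Hypotheses (rv : regular c S a v p) (rw : regular c S b w q).

Let g := Num.min (a - 1) 0 + Num.min b 0.

(** The exponent g of the flux T w: since a > 0, b > -1 and a + b > 0, each of the
four cases of the two minima gives g > -1. *)
Lemma flux_exponent : -1 < g /\ g <= 0.
Proof.
have h1 := a0; have h2 := b0; have h3 := ab0.
by rewrite /g; have [?|?] := leP (a - 1) 0; have [?|?] := leP b 0; split; lra.
Qed.

Lemma sflux_bound : exists2 K, 0 <= K &
  forall x j, Omega c x -> `|sflux nu v p w j x| <= K * blowup S g x.
Proof.
have [C1 C10 H1] := stress_bound nu rv.
have [C2 C20 H2] := regular_bounds rw.
have [K K0 HK] := blowup_mul SO (lexx g).
exists (2 * (C1 * C2 * K)); first by rewrite !mulr_ge0.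
move=> x j Ox.
have T i : `|stress nu v p x i j * w x i 0| <= C1 * C2 * K * blowup S g x.
  have [b1 _ _] := H2 x i j Ox.
  exact: normM_le C10 C20 (HK x Ox) (H1 x i j Ox) b1.
rewrite /sflux sum2; apply: le_trans (ler_normD _ _) _.
by apply: le_trans (lerD (T 0) (T 1)) _; apply: eq_ler; ring.
Qed.

(** The exponent g - 1 exceeds -2, which makes the bound integrable over Omega. *)
Lemma strain_work_bound : exists2 K, 0 <= K &
  forall x, Omega c x -> `|ddot (stress nu v p x) (grad w x)| <= K * blowup S (g - 1) x.
Proof.
have [C1 C10 H1] := stress_bound nu rv.
have [C2 C20 H2] := regular_bounds rw.
have he : g - 1 <= Num.min (a - 1) 0 + Num.min (b - 1) 0.
  by rewrite /g -addrA lerD2l; have [?|?] := leP b 0; have [?|?] := leP (b - 1) 0; lra.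
have [K K0 HK] := blowup_mul SO he.
exists (4 * (C1 * C2 * K)); first by rewrite !mulr_ge0.
move=> x Ox.
have T i j : `|stress nu v p x i j * grad w x i j| <= C1 * C2 * K * blowup S (g - 1) x.
  have [_ b1 _] := H2 x i j Ox.
  exact: normM_le C10 C20 (HK x Ox) (H1 x i j Ox) b1.
rewrite /ddot !sum2.
apply: le_trans (ler_normD _ _) _.
apply: le_trans (lerD (ler_normD _ _) (ler_normD _ _)) _.
apply: le_trans (lerD (lerD (T 0 0) (T 0 1)) (lerD (T 1 0) (T 1 1))) _.
by apply: eq_ler; ring.
Qed.

Hypothesis bf : exists2 C, 0 <= C & forall x i, Omega c x -> `|f x i 0| <= C * blowup S (a - 1) x.
Hypothesis eqv : forall x, Omega c x -> - divt (stress nu v p) x = f x.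
Hypothesis divw : forall x, Omega c x -> divv w x = 0.
Hypothesis w_walls : forall x, walls c x -> x \notin S -> w x = 0.
Hypothesis w_arc : forall x, leaflet c x -> on_arc c x -> x \notin S -> w x = 0.

Lemma force_work_bound : exists2 K, 0 <= K &
  forall x, Omega c x -> `|dot (f x) (w x)| <= K * blowup S (g - 1) x.
Proof.
have [C1 C10 H1] := bf.
have [C2 C20 H2] := regular_bounds rw.
have he : g - 1 <= Num.min (a - 1) 0 + Num.min b 0 by rewrite -/g lerBlDr lerDl.
have [K K0 HK] := blowup_mul SO he.
exists (2 * (C1 * C2 * K)); first by rewrite !mulr_ge0.
move=> x Ox.
have T i : `|f x i 0 * w x i 0| <= C1 * C2 * K * blowup S (g - 1) x.
  have [b1 _ _] := H2 x i i Ox.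
  exact: normM_le C10 C20 (HK x Ox) (H1 x i Ox) b1.
rewrite /dot sum2; apply: le_trans (ler_normD _ _) _.
by apply: le_trans (lerD (T 0) (T 1)) _; apply: eq_ler; ring.
Qed.

(** The divergence theorem for the flux T w, where
div (T w) = T : grad w + div T . w = nu symgrad v : symgrad w - f . w. *)
Lemma stress_flux :
  nu * int_Omega c (fun x => ddot (symgrad v x) (symgrad w x))
  - int_Omega c (fun x => dot (f x) (w x)) =
  \int[mu]_(y in `[yb c, yt c]) (sflux nu v p w 0 (xr c, y) - sflux nu v p w 0 (xl c, y))
  + int_sides c (fun r t n => dot (stress nu v p (polar c r t) *m n) (w (polar c r t))).
Proof.
have [g1 g0] := flux_exponent.
have [K1 K10 H1] := sflux_bound.
have [K2 K20 H2] := strain_work_bound.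
have [K3 K30 H3] := force_work_bound.
have OS x : Omega c x -> x \notin S by move=> Ox; apply/negP => /SO.
have mO := Omega_measurable hc.
have sE t n (r : R) : dot (stress nu v p (polar c r t) *m n) (w (polar c r t)) =
    sflux nu v p w 0 (polar c r t) * n 0 0 + sflux nu v p w 1 (polar c r t) * n 1 0.
  by rewrite dotE !mulmx2 /sflux !sum2; ring.
have dv x : Omega c x -> 'D_(axis R 0) (sflux nu v p w 0) x + 'D_(axis R 1) (sflux nu v p w 1) x =
    ddot (stress nu v p x) (grad w x) - dot (f x) (w x).
  move=> Ox; rewrite (sflux_div nu rv rw (subset_closure Ox) (OS _ Ox)); congr (_ + _).
  by rewrite -(eqv Ox) /dot !sum2 !mxE; ring.
have cflux j x : closure (Omega c) x -> x \notin S -> C1_near (sflux nu v p w j) x.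
  exact: (@sflux_C1 nu c S a b v p w q j rv rw x).
have cw x i : Omega c x -> {for x, continuous (fun y => w y i 0)}.
  move=> Ox; have [h _ _] := regular_velocity i rw (subset_closure Ox) (OS _ Ox).
  exact: C1_near_continuous.
have cT x i j : Omega c x -> {for x, continuous (fun y => stress nu v p y i j)}.
  move=> Ox; exact: C1_near_continuous (stress_C1 nu i j rv (subset_closure Ox) (OS _ Ox)).
have cG x i j : Omega c x -> {for x, continuous (fun y => grad w y i j)}.
  move=> Ox; have [_ h _] := regular_velocity i rw (subset_closure Ox) (OS _ Ox).
  exact: C1_near_continuous.
have cddot x : Omega c x -> {for x, continuous (fun y => ddot (stress nu v p y) (grad w y))}.
  move=> Ox; rewrite (_ : (fun y => _) = fun y =>
     (stress nu v p y 0 0 * grad w y 0 0 + stress nu v p y 0 1 * grad w y 0 1) +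
     (stress nu v p y 1 0 * grad w y 1 0 + stress nu v p y 1 1 * grad w y 1 1)); last first.
    by apply/funext => y; rewrite /ddot !sum2.
  by apply: cvgD; apply: cvgD; apply: cvgM; try exact: cT; exact: cG.
have cdiv x : Omega c x -> {for x, continuous (fun y =>
    'D_(axis R 0) (sflux nu v p w 0) y + 'D_(axis R 1) (sflux nu v p w 1) y)}.
  move=> Ox; apply: cvgD; apply: C1_near_partial; apply: cflux; try exact: subset_closure; exact: OS.
have i1 : mu2.-integrable (Omega c) (EFin \o (fun x => ddot (stress nu v p x) (grad w x))).
  by apply: (@integrable_Omega_bound c S (g - 1) K2) => //; lra.
have e1 : nu * int_Omega c (fun x => ddot (symgrad v x) (symgrad w x)) =
    int_Omega c (fun x => ddot (stress nu v p x) (grad w x)).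
  have nu0' := nu0.
  rewrite /int_Omega (_ : \int[mu2]_(x in Omega c) ddot (symgrad v x) (symgrad w x) =
     \int[mu2]_(x in Omega c) (nu^-1 * ddot (stress nu v p x) (grad w x))).
    by rewrite RintegralZl// mulVKf// gt_eqF.
  apply: eq_Rintegral => x; rewrite inE => Ox.
  by rewrite (@ddot_stress nu v p w x (divw Ox)) mulKf// gt_eqF.
have idiv : mu2.-integrable (Omega c) (EFin \o (fun x =>
    'D_(axis R 0) (sflux nu v p w 0) x + 'D_(axis R 1) (sflux nu v p w 1) x)).
  apply: (@integrable_Omega_bound c S (g - 1) (K2 + K3)) => //; try lra.
  move=> x Ox; rewrite dv// mulrDl; apply: le_trans (ler_normB _ _) _.
  by apply: lerD; [exact: H2|exact: H3].
have if_ : mu2.-integrable (Omega c) (EFin \o (fun x => dot (f x) (w x))).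
  pose Y x := ddot (stress nu v p x) (grad w x).
  pose Z x := 'D_(axis R 0) (sflux nu v p w 0) x + 'D_(axis R 1) (sflux nu v p w 1) x.
  have i2 : mu2.-integrable (Omega c) ((EFin \o Y) \- (EFin \o Z))%E.
    by apply: integrableB.
  apply: eq_integrable i2 => // x; rewrite inE => Ox.
  by rewrite /= /Z dv// -EFinB; congr EFin; rewrite /Y; ring.
have F := @singular_flux R c S g (K1 + K2 + K3) (sflux nu v p w 0) (sflux nu v p w 1)
  hc SO g1 g0.
rewrite e1 /int_Omega -RintegralB//.
transitivity (int_Omega c (fun x => 'D_(axis R 0) (sflux nu v p w 0) x + 'D_(axis R 1) (sflux nu v p w 1) x)).
  by apply: eq_Rintegral => x; rewrite inE => Ox; rewrite dv.
have KL x e : K1 * blowup S e x <= (K1 + K2 + K3) * blowup S e x.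
  by apply: ler_wpM2r; [exact: blowup_ge0|lra].
rewrite F.
- by congr (_ + _); rewrite /int_sides; congr (_ + _); apply: eq_Rintegral => r _; rewrite sE.
- by rewrite !addr_ge0.
- by move=> x Ox xS; split; exact: cflux.
- by move=> x Ox; split; apply: le_trans (KL _ _); exact: H1.
- move=> x Ox; rewrite dv//; apply: le_trans (ler_normB _ _) _.
  apply: le_trans (lerD (H2 _ Ox) (H3 _ Ox)) _.
  by rewrite -mulrDl; apply: ler_wpM2r; [exact: blowup_ge0|lra].
- by move=> x wx xS; rewrite /sflux (w_walls wx xS) sum2 !mxE !mulr0 addr0.
- by move=> x Lx ax xS; rewrite /sflux (w_arc Lx ax xS) !sum2 !mxE !mulr0 addr0.
Qed.

End stokes_fields.

(** * Derivatives along the boundary of the leaflet *)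

Section boundary_identities.
Variable R : realType.
Implicit Types (c : config R) (S : seq (R * R)) (x : R * R).
Implicit Types (u v w : R * R -> 'cV[R]_2) (p q : R * R -> R).

Lemma near_notin S x : x \notin S -> \forall y \near x, y \notin S.
Proof.
elim: S => [_|s S IH]; first exact: near_everywhere.
rewrite inE negb_or => /andP[xs xS].
have h1 : \forall y \near x, y <> s.
  by apply: open_nbhs_nbhs; split; [exact: open_setC1_plane|exact/eqP].
have h2 := IH xS.
have h3 : nbhs x ([set y | y <> s] `&` [set y | y \notin S]) by exact: filterI.
by apply: near_imply h3 => y [/eqP ys yS]; rewrite inE negb_or ys.
Qed.

(** The chain rule along a curve (ga, gb) on which phi is constant. *)
Lemma tangential_derivative (phi : R * R -> R) (ga gb : R -> R) (t va vb : R) :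
  differentiable phi (ga t, gb t) ->
  is_derive t (1 : R) ga va -> is_derive t (1 : R) gb vb ->
  (\forall s \near t, phi (ga s, gb s) = 0) ->
  va * 'D_(axis R 0) phi (ga t, gb t) + vb * 'D_(axis R 1) phi (ga t, gb t) = 0.
Proof.
move=> dphi [/derivable1_diffP da ea] [/derivable1_diffP db eb] h0.
pose gam (s : R) := (ga s, gb s).
have dg : differentiable gam t by exact: differentiable_pair.
have dc : differentiable (phi \o gam) t by exact: differentiable_comp.
have e0 : 'D_(1 : R) (phi \o gam) t = 0.
  by rewrite (near_eq_derive (g := cst 0) _ h0) derive_cst.
move: e0; rewrite deriveE// diff_comp//=.
have -> : 'd gam t (1 : R) = (va, vb).
  by rewrite /gam diff_pair// -!deriveE// ea eb.
by rewrite -deriveE// derive_partials.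
Qed.

Lemma grad_tangential (W : R * R -> 'cV[R]_2) (ga gb : R -> R) (t va vb : R) :
  (forall i, differentiable (fun y => W y i 0) (ga t, gb t)) ->
  is_derive t (1 : R) ga va -> is_derive t (1 : R) gb vb ->
  (\forall s \near t, W (ga s, gb s) = 0) ->
  forall i, grad W (ga t, gb t) i 0 * va + grad W (ga t, gb t) i 1 * vb = 0.
Proof.
move=> dW da db h0 i; rewrite !mxE mulrC [X in _ + X]mulrC.
apply: tangential_derivative => //.
by apply: filterS h0 => s ->; rewrite mxE.
Qed.

Lemma is_derive_polar c (r t : R) :
  [/\ is_derive t (1 : R) (fun t => (hinge c).1 + r * sin t) (r * cos t),
      is_derive t (1 : R) (fun t => (hinge c).2 - r * cos t) (r * sin t),
      is_derive r (1 : R) (fun r => (hinge c).1 + r * sin t) (sin t) &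
      is_derive r (1 : R) (fun r => (hinge c).2 - r * cos t) (- cos t)].
Proof.
have e (k : R) : k%:A = k :> R by exact: mulr1.
split; apply: is_derive_eq; rewrite ?e /GRing.scale/=; ring.
Qed.

Lemma PhiE c r t : Phi c (polar c r t) = r *: eperp t.
Proof.
apply/matrixP => i j; rewrite /Phi /eperp /polar /col2 !mxE /=.
by case: ifP => _; ring.
Qed.

Lemma dot_eperp (t : R) : dot (eperp t) (eperp t) = 1.
Proof. by rewrite dotE !mxE /= -!expr2 cos2Dsin2. Qed.

(** The tip is an arc of circle about the hinge, and Phi is its velocity. *)
Lemma grad_arc c S (W : R * R -> 'cV[R]_2) t : admissible c ->
  lower_angle c < t < upper_angle c -> polar c (len c) t \notin S ->
  (forall i, differentiable (fun y => W y i 0) (polar c (len c) t)) ->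
  (forall x, Gam c x -> x \notin S -> W x = 0) ->
  grad W (polar c (len c) t) *m Phi c (polar c (len c) t) = 0.
Proof.
move=> hc /andP[t1 t2] xS dW W0.
have [d1 d2 _ _] := is_derive_polar c (len c) t.
have l0 := len_gt0 hc.
have near0 : \forall s \near t, W (polar c (len c) s) = 0.
  have ct : {for t, continuous (fun s => polar c (len c) s)}.
    have h := @continuous_pair R R (fun s => (hinge c).1 + len c * sin s)
      (fun s => (hinge c).2 - len c * cos s) t.
    case: d1 => /derivable1_diffP/differentiable_continuous c1 _.
    case: d2 => /derivable1_diffP/differentiable_continuous c2 _.
    by apply: h.
  have h1 := ct _ (near_notin xS).
  have h2 := lt_nbhsr t1; have h3 := lt_nbhsl t2.
  near=> s.
  have s1 : lower_angle c < s by near: s.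
  have s2 : s < upper_angle c by near: s.
  have sw : `|s - theta c| <= eps c.
    by move: s1 s2; rewrite /lower_angle /upper_angle ler_norml => ? ?; apply/andP; split; lra.
  apply: W0; last by near: s.
  apply: closure_Omega_Gam; last exact: tip_closure_Omega.
  by apply: polar_leaflet => //; rewrite lexx ltW.
have G := @grad_tangential W (fun s => (hinge c).1 + len c * sin s)
  (fun s => (hinge c).2 - len c * cos s) t _ _ dW d1 d2 near0.
apply/matrixP => i j; rewrite (ord1 j) mulmx2 PhiE !mxE /=.
by have := G i; rewrite !mxE.
Unshelve. all: by end_near. Qed.

Lemma side_Gam c r t : admissible c -> t = lower_angle c \/ t = upper_angle c ->
  0 <= r <= len c -> closure (Omega c) (polar c r t) /\ Gam c (polar c r t).
Proof.
move=> hc ht rl; have [h1 h2] := sides_closure_Omega hc rl.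
case: ht => ->; split => //; apply: closure_Omega_Gam => //.
  exact: lower_side_leaflet.
exact: upper_side_leaflet.
Qed.

Lemma grad_side c S (W : R * R -> 'cV[R]_2) r t : admissible c ->
  t = lower_angle c \/ t = upper_angle c ->
  0 < r < len c -> polar c r t \notin S ->
  (forall i, differentiable (fun y => W y i 0) (polar c r t)) ->
  (forall x, Gam c x -> x \notin S -> W x = 0) ->
  forall i, grad W (polar c r t) i 0 * sin t - grad W (polar c r t) i 1 * cos t = 0.
Proof.
move=> hc ht /andP[r1 r2] xS dW W0 i.
have [_ _ d1 d2] := is_derive_polar c r t.
have near0 : \forall s \near r, W (polar c s t) = 0.
  have h1 : \forall s \near r, polar c s t \notin S.
    exact: (@continuous_polar R c t r _ (near_notin xS)).
  have h2 := lt_nbhsr r1; have h3 := lt_nbhsl r2.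
  near=> s.
  have s1 : 0 < s by near: s.
  have s2 : s < len c by near: s.
  apply: W0; last by near: s.
  by have [|//] := side_Gam hc ht (r := s) _; rewrite !ltW.
have := @grad_tangential W (fun s => (hinge c).1 + s * sin t)
  (fun s => (hinge c).2 - s * cos t) r _ _ dW d1 d2 near0 i.
by rewrite mulrN.
Unshelve. all: by end_near. Qed.

End boundary_identities.

(** * Pointwise identities on the straight sides *)

Section sides.
Variable R : realType.
Implicit Types (c : config R) (S : seq (R * R)) (x : R * R).
Implicit Types (u v w z : R * R -> 'cV[R]_2) (p q : R * R -> R).

Lemma Vn_side c (r t sg : R) n : n = sg *: eperp t -> Vn c (polar c r t) n = sg * r.
Proof.
move=> ->; rewrite /Vn PhiE.
have := dot_eperp t; rewrite !dotE !mxE /= => h.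
by rewrite -[RHS]mulr1 -h; ring.
Qed.

(** Put g = (grad u) e with e = eperp t.  The tangential condition gives
grad u = g e^T, so that symgrad u : symgrad z = (symgrad z) e . g.  The stress adds
the term q e . g to nu (symgrad z) e . g, and e . g = div u = 0. *)
Lemma side_strain_work nu c u z q (r t sg : R) n : n = sg *: eperp t ->
  (forall i, grad u (polar c r t) i 0 * sin t - grad u (polar c r t) i 1 * cos t = 0) ->
  divv u (polar c r t) = 0 ->
  dot (stress nu z q (polar c r t) *m n) (- (grad u (polar c r t) *m Phi c (polar c r t))) =
  - nu * (ddot (symgrad u (polar c r t)) (symgrad z (polar c r t)) * Vn c (polar c r t) n).
Proof.
move=> nE; rewrite (Vn_side c r nE) PhiE; set x := polar c r t.
rewrite /divv /mxtrace sum2 dotE !mulmx2 [(- (_ *m _)) 0 0]mxE [(- (_ *m _)) 1 0]mxE.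
rewrite !mulmx2 /ddot !sum2.
move: (stressE nu z q x) (symgradE u x) (symgradE z x).
move: (stress nu z q x) (symgrad u x) (symgrad z x) (grad u x) (grad z x) (q x).
move=> T SU SZ U Z k hT hU hZ tang dv; rewrite !hT !hU !hZ.
pose g i := U i 0 * cos t + U i 1 * sin t.
have cs := cos2Dsin2 t.
have e0 i : U i 0 = g i * cos t.
  rewrite -[LHS]mulr1 -cs /g; have := tang i; set G0 := U i 0; set G1 := U i 1 => h.
  have -> : G0 * (cos t ^+ 2 + sin t ^+ 2) = G0 * cos t ^+ 2 + G0 * sin t * sin t by ring.
  have -> : G0 * sin t = G1 * cos t by lra.
  by ring.
have e1 i : U i 1 = g i * sin t.
  rewrite -[LHS]mulr1 -cs /g; have := tang i; set G0 := U i 0; set G1 := U i 1 => h.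
  have -> : G1 * (cos t ^+ 2 + sin t ^+ 2) = G1 * cos t * cos t + G1 * sin t ^+ 2 by ring.
  have -> : G1 * cos t = G0 * sin t by lra.
  by ring.
move: dv; rewrite !e0 !e1; move: (g 0) (g 1) => g0 g1 dv.
rewrite nE !mxE /= mulr1n !mulr0n.
set Z00 := Z 0 0; set Z01 := Z 0 1; set Z10 := Z 1 0; set Z11 := Z 1 1.
transitivity (- (sg * r * k * (cos t ^+ 2 + sin t ^+ 2)) * (g0 * cos t + g1 * sin t)
  + - nu * ((2^-1 * (g0 * cos t + g0 * cos t) * (2^-1 * (Z00 + Z00)) +
      2^-1 * (g0 * sin t + g1 * cos t) * (2^-1 * (Z01 + Z10)) +
     (2^-1 * (g1 * cos t + g0 * sin t) * (2^-1 * (Z10 + Z01)) +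
      2^-1 * (g1 * sin t + g1 * sin t) * (2^-1 * (Z11 + Z11)))) * (sg * r * (cos t ^+ 2 + sin t ^+ 2)))).
  by field.
by rewrite dv cs !mulr1 mulr0 add0r.
Qed.

Lemma Phi_C1 c i x : C1_near (fun y => Phi c y i 0) x.
Proof.
have [->|i0] := eqVneq i 0.
  rewrite (_ : (fun y => _) = fun y : R * R => -1 * y.2 + (hinge c).2); last first.
    by apply/funext => y; rewrite /Phi /col2 mxE /=; ring.
  by apply: C1_nearD; [apply: C1_nearM; [exact: C1_near_cst|exact: C1_near_snd]|exact: C1_near_cst].
rewrite (_ : (fun y => _) = fun y : R * R => 1 * y.1 + - (hinge c).1); last first.
  by apply/funext => y; rewrite /Phi /col2 mxE (negbTE i0); ring.
by apply: C1_nearD; [apply: C1_nearM; [exact: C1_near_cst|exact: C1_near_fst]|exact: C1_near_cst].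
Qed.

Lemma grad_Phi c x : [/\ grad (Phi c) x 0 0 = 0, grad (Phi c) x 0 1 = -1,
  grad (Phi c) x 1 0 = 1 & grad (Phi c) x 1 1 = 0].
Proof.
have e0 : (fun y => Phi c y 0 0) = (cst (hinge c).2 - (fun y : R * R => y.2)).
  by apply/funext => y; rewrite /Phi /col2 mxE.
have e1 : (fun y => Phi c y 1 0) = ((fun y : R * R => y.1) - cst (hinge c).1).
  by apply/funext => y; rewrite /Phi /col2 mxE.
have d1 (v : R * R) : derivable (fun y : R * R => y.1) x v.
  by apply: diff_derivable; exact: differentiable_fst.
have d2 (v : R * R) : derivable (fun y : R * R => y.2) x v.
  by apply: diff_derivable; exact: differentiable_snd.
have D0 (k : R * R) : 'D_k (fun y => Phi c y 0 0) x = - k.2.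
  by rewrite e0 deriveB//; rewrite derive_cst derive_snd sub0r.
have D1 (k : R * R) : 'D_k (fun y => Phi c y 1 0) x = k.1.
  by rewrite e1 deriveB//; rewrite derive_cst derive_fst subr0.
by split; rewrite mxE ?D0 ?D1 /axis/= ?oppr0.
Qed.

Lemma grad_sub (v w : R * R -> 'cV[R]_2) x i j :
  differentiable (fun y => v y i 0) x -> differentiable (fun y => w y i 0) x ->
  grad (fun y => v y - w y) x i j = grad v x i j - grad w x i j.
Proof.
move=> dv dw; have -> : grad (fun y => v y - w y) x i j = 'D_(axis R j) (fun y => v y i 0 - w y i 0) x.
  by rewrite mxE; congr ('D__ _ x); apply/funext => y; rewrite 2!mxE.
by rewrite [grad v x i j]mxE [grad w x i j]mxE -deriveB//; exact: diff_derivable.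
Qed.

(** Since Phi = (sg r) n with |sg| = 1, the term (grad z) Phi is V (grad z) n,
while (grad Phi) Phi = - r e_ and r = |V|.  The pressure disappears because n
and e_ are orthogonal. *)
Lemma side_traction_split nu c u p z (r t sg : R) n : n = sg *: eperp t -> `|sg| = 1 -> 0 <= r ->
  (forall i, differentiable (fun y => z y i 0) (polar c r t)) ->
  dot (stress nu u p (polar c r t) *m n)
    (- (grad (fun y => z y - Phi c y) (polar c r t) *m Phi c (polar c r t))) =
  - (dot (stress nu u p (polar c r t) *m n) (grad z (polar c r t) *m n) * Vn c (polar c r t) n
     + nu * (dot (symgrad u (polar c r t) *m n) (e_ t) * `|Vn c (polar c r t) n|)).
Proof.
move=> nE sg1 r0 dz.
have ss : sg * sg = 1 by rewrite -expr2 -(real_normK (num_real sg)) sg1 expr1n.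
rewrite (Vn_side c r nE) normrM sg1 mul1r (ger0_norm r0) PhiE.
set x := polar c r t in dz *.
have [P00 P01 P10 P11] := grad_Phi c x.
have G i j := @grad_sub z (Phi c) x i j (dz i) (C1_near_differentiable (Phi_C1 c i x)).
rewrite !dotE !mulmx2 ![(- (_ *m _)) _ _]mxE !mulmx2 !G P00 P01 P10 P11.
rewrite !stressE !symgradE.
set U00 := grad u x 0 0; set U01 := grad u x 0 1; set U10 := grad u x 1 0; set U11 := grad u x 1 1.
set Z00 := grad z x 0 0; set Z01 := grad z x 0 1; set Z10 := grad z x 1 0; set Z11 := grad z x 1 1.
rewrite nE !mxE /= mulr1n !mulr0n.
have cs := cos2Dsin2 t.
set C := cos t in cs *; set D := sin t in cs *.
have key (A B : R) : (r * C) * A + (r * D) * B = (sg * r) * (A * (sg * C) + B * (sg * D)).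
  transitivity (sg * sg * (r * C * A + r * D * B)); first by rewrite ss mul1r.
  by ring.
set T0 := (nu * (2^-1 * (U00 + U00)) + p x) * (sg * C) + (nu * (2^-1 * (U01 + U10)) + 0) * (sg * D).
set T1 := (nu * (2^-1 * (U10 + U01)) + 0) * (sg * C) + (nu * (2^-1 * (U11 + U11)) + p x) * (sg * D).
have K0 := key Z00 Z01; have K1 := key Z10 Z11.
transitivity (- (T0 * ((r * C) * Z00 + (r * D) * Z01) + T1 * ((r * C) * Z10 + (r * D) * Z11))
   - r * (T0 * D - T1 * C)); first by ring.
rewrite K0 K1 /T0 /T1.
by field.
Qed.

End sides.

(** * Integrability on the straight sides *)

Section side_integrals.
Variable R : realType.
Local Notation mu := (@lebesgue_measure R).
Implicit Types (c : config R) (S : seq (R * R)) (x : R * R).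
Implicit Types (u v w z : R * R -> 'cV[R]_2) (p q : R * R -> R).

Lemma regular_differentiable c S a v p i x : regular c S a v p ->
  closure (Omega c) x -> x \notin S -> differentiable (fun y => v y i 0) x.
Proof.
by move=> rv Ox xS; have [/C1_near_differentiable] := regular_velocity i rv Ox xS.
Qed.

(** The solenoidal condition extends to the boundary by continuity. *)
Lemma divv_closure c S a v p x : regular c S a v p ->
  (forall y, Omega c y -> divv v y = 0) ->
  closure (Omega c) x -> x \notin S -> divv v x = 0.
Proof.
move=> rv dv Ox xS.
have cd : {for x, continuous (divv v)}.
  rewrite (_ : divv v = fun y => grad v y 0 0 + grad v y 1 1); last first.
    by apply/funext => y; rewrite /divv /mxtrace sum2.
  have [_ h0 _] := regular_velocity 0 rv Ox xS.
  have [_ h1 _] := regular_velocity 1 rv Ox xS.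
  by apply: cvgD; [exact: C1_near_continuous (h0 0)|exact: C1_near_continuous (h1 1)].
have a1 : 0 <= divv v x by apply: (closure_ge0 Ox cd) => y /dv ->.
have a2 : 0 <= - divv v x.
  by apply: (closure_ge0 (g := fun y => - divv v y) Ox); [exact: cvgN|move=> y /dv ->; rewrite oppr0].
by apply: le_anti; rewrite a1 -oppr_ge0 a2.
Qed.

Lemma cos_side_gt0 c t : admissible c -> t = lower_angle c \/ t = upper_angle c -> 0 < cos t.
Proof.
move=> hc ht; have [a1 a12 a2] := angle_bounds hc.
by case: ht => ->; [exact: cos1_gt0 a1 a12 a2|exact: cos2_gt0 a1 a12 a2].
Qed.

Lemma side_traction_integrable nu a b c S v w p q t n : admissible c ->
  (forall s, s \in S -> ~ Omega c s) -> 0 < a -> -1 < b -> 0 < a + b ->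
  regular c S a v p -> regular c S b w q -> t = lower_angle c \/ t = upper_angle c ->
  mu.-integrable `[0, len c]%classic
    (EFin \o (fun r => dot (stress nu v p (polar c r t) *m n) (w (polar c r t)))).
Proof.
move=> hc SO a0 b0 ab rv rw ht.
have [g1 g0] := flux_exponent a0 b0 ab.
have [K K0 HK] := sflux_bound nu SO rv rw.
have ct := cos_side_gt0 hc ht.
pose H x := sflux nu v p w 0 x * n 0 0 + sflux nu v p w 1 x * n 1 0.
have -> : (fun r => dot (stress nu v p (polar c r t) *m n) (w (polar c r t))) =
    H \o (fun r => polar c r t).
  by apply/funext => r; rewrite /H /= dotE !mulmx2 /sflux !sum2; ring.
apply: (@path_field_integrable R c S _ (K * (`|n 0 0| + `|n 1 0|)) (cos t) 0 (len c)
  _ (fun s => ((hinge c).2 - s.2) / cos t) ct g1 g0 (@continuous_polar R c t)).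
- by rewrite mulr_ge0// addr_ge0.
- by move=> r s; exact: polar_dist.
- by move=> r rl; have [] := side_Gam hc ht rl.
- move=> x Ox xS.
  have cf j := @sflux_C1 R nu c S a b v p w q j rv rw x Ox xS.
  by apply: C1_nearD; apply: C1_nearM; try exact: C1_near_cst; exact: cf.
- move=> x Ox; rewrite mulrAC mulrDr; apply: le_trans (ler_normD _ _) _.
  by rewrite !normrM; apply: lerD; apply: ler_wpM2r => //; exact: HK.
Qed.

(** Integrability along the sides then also covers tractions in a fixed direction. *)
Lemma regular_cst c S (e : 'cV[R]_2) : regular c S 0 (fun=> e) (fun=> 0).
Proof.
have D0 (k : R) (d : R * R) x : 'D_d (fun=> k : R) x = 0 by exact: derive_cst.
split=> [x _ _|].
  split; last exact: C1_near_cst.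
  move=> i; split=> [|j]; first exact: C1_near_cst.
  by apply: C1_near_eq (C1_near_cst 0 x); apply: near_everywhere => y; exact: D0.
have le g x (k : R) : 0 <= k -> k <= k * blowup S g x.
  by move=> k0; rewrite ler_peMr// blowup_ge1.
exists `|e| => x _; split; first exact: le.
  rewrite (_ : grad _ _ = 0) ?normr0 ?mulr_ge0 ?blowup_ge0//.
  by apply/matrixP => i j; rewrite !mxE D0.
by rewrite normr0 mulr_ge0// blowup_ge0.
Qed.

(** The pressure disappears because eperp t and e_ t are orthogonal. *)
Lemma stress_eperp nu u p x (t sg : R) n : n = sg *: eperp t ->
  dot (stress nu u p x *m n) (e_ t) = nu * dot (symgrad u x *m n) (e_ t).
Proof.
move=> ->; rewrite !dotE !mulmx2.
move: (stressE nu u p x) (symgradE u x); move: (stress nu u p x) (symgrad u x) (grad u x) (p x).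
by move=> T SU U k hT hU; rewrite !hT !hU !mxE /= mulr1n !mulr0n; ring.
Qed.

(** In the direction e_ the strain is the traction divided by nu. *)
Lemma side_strain_integrable c S u p (nu a t sg : R) n : admissible c ->
  (forall s, s \in S -> ~ Omega c s) -> 0 < nu -> 0 < a -> regular c S a u p ->
  t = lower_angle c \/ t = upper_angle c -> n = sg *: eperp t ->
  mu.-integrable `[0, len c]%classic
    (EFin \o (fun r => dot (symgrad u (polar c r t) *m n) (e_ t) * r)).
Proof.
move=> hc SO nu0 a0 ru ht nE.
have a00 : 0 < a + 0 by rewrite addr0.
have n10 : -1 < 0 :> R by rewrite oppr_lt0.
have i := side_traction_integrable nu n hc SO a0 n10 a00 ru (regular_cst c S (e_ t)) ht.
have m : measurable (`[0, len c]%classic : set R) by exact: measurable_itv.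
have bid : [bounded id r : R | r in `[0, len c]%classic].
  exists (len c); split=> [|M lM r /=]; first exact: num_real.
  rewrite in_itv/= => /andP[r0 r1]; rewrite ger0_norm//.
  exact: le_trans r1 (ltW lM).
have mid : measurable_fun (`[0, len c]%classic : set R) (id : R -> R) by exact: measurable_id.
pose F r := dot (stress nu u p (polar c r t) *m n) (e_ t).
have -> : EFin \o (fun r => dot (symgrad u (polar c r t) *m n) (e_ t) * r) =
    (fun r => (nu^-1)%:E * ((EFin \o F) \* (EFin \o id)) r)%E.
  apply/funext => r /=; rewrite -!EFinM; congr EFin.
  by rewrite /F (stress_eperp nu u p _ nE) -mulrA mulKf// gt_eqF.
have j : mu.-integrable `[0, len c]%classic ((EFin \o F) \* (EFin \o id))%E.
  by apply: integrableMl.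
by apply: integrableZl.
Qed.

End side_integrals.

(** * Integrals over the sides and over the edges of the channel *)

Section side_and_edge_integrals.
Variable R : realType.
Local Notation mu := (@lebesgue_measure R).
Implicit Types (c : config R) (S : seq (R * R)) (x : R * R).
Implicit Types (u v w z : R * R -> 'cV[R]_2) (p q : R * R -> R).

Lemma side_exceptions c S t : 0 < cos t ->
  finite_set ([set r | polar c r t \in S] `|` [set 0; len c]).
Proof.
move=> ct; rewrite finite_setU; split; last first.
  by rewrite finite_setU; split; exact: finite_set1.
exact: (path_exceptions S ct (fun r s => @polar_dist R c t r s ct)).
Qed.

(** The end points of the side are added to the exceptions, since the derivative
along the side is only controlled in its interior. *)
Lemma side_Rintegral c S t (F G : R -> R) : admissible c ->
  t = lower_angle c \/ t = upper_angle c ->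
  mu.-integrable `[0, len c]%classic (EFin \o F) ->
  (forall r, 0 < r < len c -> polar c r t \notin S -> F r = G r) ->
  \int[mu]_(r in `[0, len c]) F r = \int[mu]_(r in `[0, len c]) G r.
Proof.
move=> hc ht iF FG; have ct := cos_side_gt0 hc ht.
have fN := side_exceptions c S ct.
apply: (Rintegral_finite_exceptions _ fN).
- exact: measurable_itv.
- by have := measurable_int _ iF => /measurable_EFinP.
move=> r /=; rewrite in_itv/= => /andP[r0 r1] nN; apply: FG; last first.
  by apply/negP => rS; apply: nN; left.
apply/andP; split; rewrite lt_neqAle; apply/andP; split => //; apply/eqP => h.
  by apply: nN; right; left.
by apply: nN; right; right.
Qed.

Lemma side_strain_work_integral nu a b c S u p z q du dq t sg n : admissible c ->
  (forall s, s \in S -> ~ Omega c s) -> 0 < nu -> 0 < a -> -1 < b -> 0 < a + b ->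
  regular c S a u p -> regular c S a z q -> regular c S b du dq ->
  t = lower_angle c \/ t = upper_angle c -> n = sg *: eperp t ->
  (forall x, Omega c x -> divv u x = 0) ->
  (forall x, Gam c x -> x \notin S -> u x = 0) ->
  (forall x, Gam c x -> x \notin S -> du x = - (grad u x *m Phi c x)) ->
  \int[mu]_(r in `[0, len c])
    (ddot (symgrad u (polar c r t)) (symgrad z (polar c r t)) * Vn c (polar c r t) n) =
  - nu^-1 * \int[mu]_(r in `[0, len c]) dot (stress nu z q (polar c r t) *m n) (du (polar c r t)).
Proof.
move=> hc SO nu0 a0 b0 ab ru rz rdu ht nE divu u0 duE.
have i1 := side_traction_integrable nu n hc SO a0 b0 ab rz rdu ht.
rewrite -RintegralZl//.
apply/esym; apply: (@side_Rintegral c S t) => //.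
  by apply: integrable_scale => //; exact: measurable_itv.
move=> r rl rS; have rl' : 0 <= r <= len c by case/andP: rl => ? ?; rewrite !ltW.
have [Ox Gx] := side_Gam hc ht rl'.
have du_ i := regular_differentiable i ru Ox rS.
rewrite (duE _ Gx rS) (@side_strain_work R nu c u z q r t sg n nE); last 2 first.
- exact: (grad_side hc ht rl rS du_ u0).
- exact: (divv_closure ru divu Ox rS).
by rewrite mulNr (mulNr nu) mulrN opprK mulKf// gt_eqF.
Qed.

(** The identity of [side_traction_split] is integrated in the form A = - H2 - nu B.
A, which contains grad z, is integrable because H2 and B are. *)
Lemma side_traction_split_integral nu a b c S u p z q dz dq t sg n : admissible c ->
  (forall s, s \in S -> ~ Omega c s) -> 0 < nu -> 0 < a -> -1 < b -> 0 < a + b ->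
  regular c S a u p -> regular c S a z q -> regular c S b dz dq ->
  t = lower_angle c \/ t = upper_angle c -> n = sg *: eperp t -> `|sg| = 1 ->
  (forall x, Gam c x -> x \notin S ->
     dz x = - (grad (fun y => z y - Phi c y) x *m Phi c x)) ->
  \int[mu]_(r in `[0, len c]) dot (stress nu u p (polar c r t) *m n) (dz (polar c r t)) =
  - (\int[mu]_(r in `[0, len c]) (dot (stress nu u p (polar c r t) *m n)
        (grad z (polar c r t) *m n) * Vn c (polar c r t) n)
     + nu * \int[mu]_(r in `[0, len c])
        (dot (symgrad u (polar c r t) *m n) (e_ t) * `|Vn c (polar c r t) n|)).
Proof.
move=> hc SO nu0 a0 b0 ab ru rz rdz ht nE sg1 dzE.
pose H2 r := dot (stress nu u p (polar c r t) *m n) (dz (polar c r t)).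
pose B r := dot (symgrad u (polar c r t) *m n) (e_ t) * r.
have i2 : mu.-integrable `[0, len c]%classic (EFin \o H2).
  exact: (side_traction_integrable nu n hc SO a0 b0 ab ru rdz ht).
have iB : mu.-integrable `[0, len c]%classic (EFin \o B).
  exact: (side_strain_integrable hc SO nu0 a0 ru ht nE).
have m : measurable (`[0, len c]%classic : set R) by exact: measurable_itv.
have -> : \int[mu]_(r in `[0, len c])
    (dot (symgrad u (polar c r t) *m n) (e_ t) * `|Vn c (polar c r t) n|) =
    \int[mu]_(r in `[0, len c]) B r.
  apply: eq_Rintegral => r; rewrite inE/= in_itv/= => /andP[r0 _].
  by rewrite (Vn_side c r nE) normrM sg1 mul1r (ger0_norm r0).
have inB : mu.-integrable `[0, len c]%classic (EFin \o (fun r => nu * B r)).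
  exact: integrable_scale.
have iN2 : mu.-integrable `[0, len c]%classic (EFin \o (fun r => - H2 r)).
  rewrite (_ : EFin \o _ = -%E \o (EFin \o H2))%E//; exact: integrableN.
have iD : mu.-integrable `[0, len c]%classic (EFin \o (fun r => - H2 r - nu * B r)).
  rewrite (_ : EFin \o _ = ((EFin \o (fun r => (- H2 r)%R)) \- (EFin \o (fun r => (nu * B r)%R)))%E)//.
  exact: integrableB.
have -> : \int[mu]_(r in `[0, len c]) (dot (stress nu u p (polar c r t) *m n)
        (grad z (polar c r t) *m n) * Vn c (polar c r t) n) =
    \int[mu]_(r in `[0, len c]) (- H2 r - nu * B r).
  apply/esym; apply: (@side_Rintegral c S t) => // r rl rS.
  have rl' : 0 <= r <= len c by case/andP: rl => ? ?; rewrite !ltW.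
  have [Ox Gx] := side_Gam hc ht rl'.
  have dz_ i := regular_differentiable i rz Ox rS.
  have /andP[r0 _] := rl'.
  rewrite /H2 (dzE _ Gx rS) (@side_traction_split R nu c u p z r t sg n nE sg1 r0 dz_).
  rewrite /B (Vn_side c r nE) normrM sg1 mul1r (ger0_norm r0).
  by ring.
have -> : \int[mu]_(r in `[0, len c]) (- H2 r - nu * B r) =
    - (\int[mu]_(r in `[0, len c]) H2 r) - nu * \int[mu]_(r in `[0, len c]) B r.
  have -> := etrans (RintegralB _ iN2 inB) (erefl _); last by exact: measurable_itv.
  have -> := etrans (RintegralZl nu _ iB) (erefl _); last by exact: measurable_itv.
  have eN : \int[mu]_(r in `[0, len c]) (- H2 r) = - \int[mu]_(r in `[0, len c]) H2 r.
    by rewrite -mulN1r -RintegralZl//; apply: eq_Rintegral => r _; rewrite mulN1r.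
  by rewrite -eN.
by ring.
Qed.

Lemma edge_frontier c y : admissible c -> yb c <= y <= yt c ->
  frontier (channel c) (xl c, y) /\ frontier (channel c) (xr c, y).
Proof.
move=> hc yy; have [h1 h2] := edges_closure_Omega hc yy.
have sub : Omega c `<=` channel c by move=> x [].
split; split; try by apply: closureS sub _ _.
- by move=> /interior_subset[/= /andP[]]; rewrite ltxx.
- by move=> /interior_subset[/= /andP[_]]; rewrite ltxx.
Qed.

(** The lateral edges split into DN, where the traction is given, and DD, where w
vanishes.  The walls belong to DD and do not contribute to the right-hand side. *)
Lemma edges_traction nu a b c S DD DN v p w q h : admissible c ->
  (forall s, s \in S -> ~ Omega c s) -> 0 < a -> -1 < b -> 0 < a + b ->
  regular c S a v p -> regular c S b w q ->
  boundary_partition c DD DN ->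
  (forall x, DD x -> x \notin S -> w x = 0) ->
  (forall x, DN x -> x \notin S -> stress nu v p x *m normal_channel c x = h x) ->
  \int[mu]_(y in `[yb c, yt c]) (sflux nu v p w 0 (xr c, y) - sflux nu v p w 0 (xl c, y)) =
  int_outer c DN (fun x => dot (h x) (w x)).
Proof.
move=> hc SO a0 b0 ab rv rw [DU DI _ _ wD] w0 hE.
have [lr bt] := channel_bounds hc.
have [g1 g0] := flux_exponent a0 b0 ab.
have [K K0 HK] := sflux_bound nu SO rv rw.
have cf x : closure (Omega c) x -> x \notin S -> C1_near (sflux nu v p w 0) x.
  exact: (@sflux_C1 R nu c S a b v p w q 0 rv rw x).
have i (e : R) : (forall y, yb c <= y <= yt c -> closure (Omega c) (e, y)) ->
    mu.-integrable `[yb c, yt c]%classic (EFin \o (fun y => sflux nu v p w 0 (e, y))).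
  move=> cl; exact: (path_field_integrable ltr01 g1 g0 (@continuous_edge R e) K0 (edge_dist e) cl cf (fun x => HK x 0)).
have ir := i (xr c) (fun y yy => (edges_closure_Omega hc yy).2).
have il := i (xl c) (fun y yy => (edges_closure_Omega hc yy).1).
have m : measurable (`[yb c, yt c]%classic : set R) by exact: measurable_itv.
have wall y : y = yb c \/ y = yt c -> [set x | xl c <= x <= xr c /\ DN (x, y)] = set0.
  move=> hy; apply/seteqP; split => x //= [xx dn].
  have : (DD `&` DN) (x, y) by split => //; apply: wD; split.
  by rewrite DI.
rewrite /int_outer !wall; [|by right|by left].
rewrite !Rintegral_set0 !addr0.
have E (e : R) (sg : R) :
    (forall y, yb c <= y <= yt c -> frontier (channel c) (e, y)) ->
    (forall y, DN (e, y) -> (e, y) \notin S ->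
       dot (h (e, y)) (w (e, y)) = sg * sflux nu v p w 0 (e, y)) ->
    mu.-integrable `[yb c, yt c]%classic (EFin \o (fun y => sflux nu v p w 0 (e, y))) ->
    \int[mu]_(y in [set y | yb c <= y <= yt c /\ DN (e, y)]) dot (h (e, y)) (w (e, y)) =
    sg * \int[mu]_(y in `[yb c, yt c]) sflux nu v p w 0 (e, y).
  move=> fr He ie.
  have -> : [set y | yb c <= y <= yt c /\ DN (e, y)] = `[yb c, yt c]%classic `&` [set y | DN (e, y)].
    by apply/seteqP; split=> y /=; rewrite in_itv.
  rewrite Rintegral_mkcondr -RintegralZl//; apply/esym.
  have fN : finite_set [set y | (e, y) \in S].
    exact: (path_exceptions S ltr01 (fun r s => @edge_dist R e r s)).
  apply: (Rintegral_finite_exceptions m fN).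
    have i2 : mu.-integrable `[yb c, yt c]%classic (EFin \o (fun y => sg * sflux nu v p w 0 (e, y))).
      exact: integrable_scale.
    by have := measurable_int _ i2 => /measurable_EFinP.
  move=> y /=; rewrite in_itv/= => yy /negP yS; rewrite patchE.
  have [dn|dn] := pselect (DN (e, y)).
    by rewrite mem_set// He.
  rewrite memNset//.
  have : (DD `|` DN) (e, y) by rewrite DU; exact: fr.
  case=> // dd; rewrite /sflux (w0 _ dd yS) sum2 !mxE !mulr0 addr0 mulr0 //.
rewrite (E (xl c) (-1)) //; last 2 first.
- by move=> y yy; exact: (edge_frontier hc yy).1.
- move=> y dn yS; rewrite -(hE _ dn yS) dotE !mulmx2 /sflux sum2.
  by rewrite /normal_channel /= eqxx /col2 !mxE /=; ring.
rewrite (E (xr c) 1) //; last 2 first.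
- by move=> y yy; exact: (edge_frontier hc yy).2.
- move=> y dn yS; rewrite -(hE _ dn yS) dotE !mulmx2 /sflux sum2.
  by rewrite /normal_channel /= gt_eqF// eqxx /col2 !mxE /=; ring.
by rewrite RintegralB// mul1r mulN1r addrC.
Qed.

End side_and_edge_integrals.

(** * The shape derivative *)

Section assembly.
Variable R : realType.
Local Notation mu := (@lebesgue_measure R).
Implicit Types (c : config R) (S : seq (R * R)) (x : R * R).
Implicit Types (u v w z W f h g : R * R -> 'cV[R]_2) (p q : R * R -> R).

Lemma frontier_not_Omega c S : admissible c -> [set` S] `<=` frontier (Omega c) ->
  forall s, s \in S -> ~ Omega c s.
Proof.
move=> hc hS s /hS[_ nI] Os; apply: nI.
exact: open_nbhs_nbhs (conj (Omega_open hc) Os).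
Qed.

Lemma force_bound c S s1 s2 a f : regular_force c S a f ->
  exists2 C, 0 <= C &
    forall x i, Omega c x -> `|f x i 0| <= C * blowup (s1 :: s2 :: S) (a - 1) x.
Proof.
move=> [_ [C HC]]; exists `|C| => // x i Ox.
apply: le_trans (entry_norm _ _ _) _; apply: le_trans (HC x Ox) _.
apply: (@le_trans _ _ (`|C| * blowup S (a - 1) x)).
  by apply: ler_wpM2r (ler_norm C); exact: blowup_ge0.
apply: ler_wpM2l => //; rewrite !blowup_cons addrA lerDr.
by rewrite addr_ge0// powR_ge0.
Qed.

(** The boundary condition of w is that of a shape derivative: w = - (grad W) Phi,
where W vanishes on the boundary of the leaflet (W = u or W = z - Phi).  Then w
vanishes on the tip by [grad_arc], so that only the sides are left.  The corners
of the tip are adjoined to S for this purpose. *)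
Lemma green_formula nu a b c DD DN S f bv gv h v p W w q : admissible c ->
  boundary_partition c DD DN -> [set` S] `<=` frontier (Omega c) ->
  0 < nu -> 0 < a -> -1 < b -> 0 < a + b ->
  regular_force c S a f -> regular c S a v p -> regular c S b w q ->
  mixed_stokes c DD DN S nu f bv gv h v p ->
  (forall x, Omega c x -> divv w x = 0) ->
  (forall x, DD x -> x \notin S -> w x = 0) ->
  (forall x i, closure (Omega c) x -> x \notin S -> differentiable (fun y => W y i 0) x) ->
  (forall x, Gam c x -> x \notin S -> W x = 0) ->
  (forall x, Gam c x -> x \notin S -> w x = - (grad W x *m Phi c x)) ->
  nu * int_Omega c (fun x => ddot (symgrad v x) (symgrad w x))
  - int_Omega c (fun x => dot (f x) (w x)) =
  int_outer c DN (fun x => dot (h x) (w x))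
  + int_sides c (fun r t n => dot (stress nu v p (polar c r t) *m n) (w (polar c r t))).
Proof.
move=> hc hD hS nu0 a0 b0 ab hf rv rw [eqv _ _ hN] divw wD dW W0 wE.
have SO := frontier_not_Omega hc hS.
have l0 := len_gt0 hc.
have ll : 0 <= len c <= len c by rewrite (ltW l0) lexx.
pose s1 := polar c (len c) (lower_angle c).
pose s2 := polar c (len c) (upper_angle c).
have SO' s : s \in s1 :: s2 :: S -> ~ Omega c s.
  rewrite !inE => /orP[/eqP ->|/orP[/eqP ->|sS]]; last exact: SO.
    by move=> [_]; apply; exact: lower_side_leaflet.
  by move=> [_]; apply; exact: upper_side_leaflet.
have rv' := regular_cons s1 (regular_cons s2 rv).
have rw' := regular_cons s1 (regular_cons s2 rw).
have eqv' x : Omega c x -> - divt (stress nu v p) x = f x by move=> /eqv[].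
have [_ _ _ _ wDD] := hD.
rewrite (stress_flux hc SO' nu0 a0 b0 ab rv' rw' (force_bound s1 s2 hf) eqv' divw).
- by congr (_ + _); exact: (edges_traction hc SO a0 b0 ab rv rw hD wD hN).
- move=> x wx; rewrite !inE !negb_or => /and3P[_ _ xS].
  by apply: wD => //; exact: wDD.
move=> x Lx ax; rewrite !inE !negb_or => /and3P[x1 x2 xS].
have [t tt xE] := arc_polar hc Lx ax.
have Ox : closure (Omega c) x by rewrite xE; exact: tip_closure_Omega.
rewrite (wE _ (closure_Omega_Gam Lx Ox) xS) xE (@grad_arc R c S W t hc).
- by rewrite oppr0.
- move: tt; rewrite ler_norml /lower_angle /upper_angle => /andP[t1 t2].
  apply/andP; split; rewrite lt_neqAle; apply/andP; split; try lra.
    by apply: contra x1 => /eqP h1; rewrite xE /s1 /lower_angle h1.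
  by apply: contra x2 => /eqP h1; rewrite xE /s2 /upper_angle -h1.
- by rewrite -xE.
- by move=> i; rewrite -xE; exact: dW.
- exact: W0.
Qed.

Lemma Rintegral_zero d (T : measurableType d) (m : {measure set T -> \bar R}) (D : set T) :
  \int[m]_(x in D) (0 : R) = 0.
Proof. by rewrite /Rintegral integral0. Qed.

Lemma Vn_tip c t : Vn c (polar c (len c) t) (- e_ t) = 0.
Proof. by rewrite /Vn PhiE dotE !mxE /=; ring. Qed.

Lemma int_tip_Vn c (F : R * R -> R) :
  int_tip c (fun r t n => F (polar c r t) * Vn c (polar c r t) n) = 0.
Proof.
rewrite /int_tip (_ : \int[mu]_(t in _) _ = \int[mu]_(t in `[theta c - eps c, theta c + eps c]) 0).
  exact: Rintegral_zero.
by apply: eq_Rintegral => t _; rewrite Vn_tip mulr0 mul0r.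
Qed.

Lemma ddotC (A B : 'M[R]_2) : ddot A B = ddot B A.
Proof. by rewrite /ddot; apply: eq_bigr => i _; apply: eq_bigr => j _; rewrite mulrC. Qed.

Lemma regular_force0 c S a : regular_force c S a (fun=> 0 : 'cV[R]_2).
Proof.
split; first by apply: continuous_subspaceT => x; exact: cvg_cst.
by exists 0 => x _; rewrite normr0 mul0r.
Qed.

Lemma dot0v (v : 'cV[R]_2) : dot 0 v = 0.
Proof. by rewrite dotE !mxE !mul0r addr0. Qed.

Lemma int_Omega0 c : int_Omega c (fun=> 0 : R) = 0.
Proof. exact: Rintegral_zero. Qed.

Lemma int_outer0 c (A : set (R * R)) : int_outer c A (fun=> 0 : R) = 0.
Proof. by rewrite /int_outer !Rintegral_zero !addr0. Qed.

(** The bookkeeping of the theorem.  SA, tA and SF, tF are the integrals over the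
sides and the tip of the terms in V without and with f, X and Y are the strain
integrals with du and dz, and P, Q are the tractions against du and dz. *)
Lemma cancellation (nu SA tA SF tF X Y Z O P Q T B : R) : 0 < nu ->
  tA = 0 -> tF = 0 -> SA = - nu^-1 * P ->
  nu * X = P -> nu * Y - Z = O + Q -> Q = - (T + nu * B) ->
  - nu * (SA + tA) + (SF + tF) - nu * X - nu * Y + Z + O = T + nu * B + SF.
Proof.
move=> nu0 -> -> -> -> hY hQ; rewrite !addr0 mulrA mulrNN mulfV ?gt_eqF// mul1r.
by rewrite hQ in hY; lra.
Qed.

End assembly.

Theorem proposition3p2 (R : realType) (c : config R)
  (DD DN : set (R * R)) (S : seq (R * R)) (nu a b : R)
  (f g h u z du dz : R * R -> 'cV[R]_2) (p q dp dq : R * R -> R)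
  (hc : admissible c) (hD : boundary_partition c DD DN) (hnu : 0 < nu)
  (hS : [set` S] `<=` frontier (Omega c))
  (ha : 0 < a) (hb : -1 < b) (hab : 0 < a + b)
  (hf : regular_force c S a f)
  (hu : regular c S a u p) (hz : regular c S a z q)
  (hdu : regular c S b du dp) (hdz : regular c S b dz dq)
  (state : mixed_stokes c DD DN S nu f (fun=> 0) g h u p)
  (g_walls : forall x, walls c x -> g x = 0)
  (adjoint : mixed_stokes c DD DN S nu (fun=> 0) (Phi c) (fun=> 0) (fun=> 0)
     z q)
  (state' : mixed_stokes c DD DN S nu (fun=> 0)
     (fun x => - (grad u x *m Phi c x)) (fun=> 0) (fun=> 0) du dp)
  (adjoint' : mixed_stokes c DD DN S nu (fun=> 0)
     (fun x => - (grad (fun y => z y - Phi c y) x *m Phi c x))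
     (fun=> 0) (fun=> 0) dz dq) :
  shape_derivative c DN nu f h u z du dz =
    int_sides c (fun r w n => let x := polar c r w in
      dot (stress nu u p x *m n) (grad z x *m n) * Vn c x n)
    + nu * int_sides c (fun r w n => let x := polar c r w in
        dot (symgrad u x *m n) (e_ w) * `|Vn c x n|)
    + int_sides c (fun r w n => let x := polar c r w in
        dot (f x) (z x) * Vn c x n).
Proof.
have SO := frontier_not_Omega hc hS.
have [equ u0 _ _] := state.
have [_ zPhi _ _] := adjoint.
have [eqdu duE duD _] := state'.
have [eqdz dzE dzD _] := adjoint'.
have divu x : Omega c x -> divv u x = 0 by move=> /equ[].
have green_du : nu * int_Omega c (fun x => ddot (symgrad du x) (symgrad z x)) =
    int_sides c (fun r t n => dot (stress nu z q (polar c r t) *m n) (du (polar c r t))).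
  have := green_formula hc hD hS hnu ha hb hab (regular_force0 c S a) hz hdu adjoint
    (fun x Ox => (eqdu x Ox).2) duD (fun x i => @regular_differentiable R c S a u p i x hu) u0 duE.
  have -> : (fun x => dot 0 (du x)) = fun=> 0 by apply/funext => x; exact: dot0v.
  rewrite int_Omega0 int_outer0 subr0 add0r => <-; congr (_ * int_Omega c _).
  by apply/funext => x; exact: ddotC.
have dz_diff x i : closure (Omega c) x -> x \notin S ->
    differentiable (fun y => (z y - Phi c y) i 0) x.
  move=> Ox xS.
  have -> : (fun y => (z y - Phi c y) i 0) = (fun y => z y i 0) \- (fun y => Phi c y i 0).
    by apply/funext => y; rewrite /= 2!mxE.
  apply: differentiableB; first exact: (regular_differentiable i hz Ox xS).
  exact: C1_near_differentiable (Phi_C1 c i x).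
have green_dz : nu * int_Omega c (fun x => ddot (symgrad u x) (symgrad dz x))
    - int_Omega c (fun x => dot (f x) (dz x)) =
    int_outer c DN (fun x => dot (h x) (dz x)) +
    int_sides c (fun r t n => dot (stress nu u p (polar c r t) *m n) (dz (polar c r t))).
  have zPhi0 x : Gam c x -> x \notin S -> z x - Phi c x = 0.
    by move=> Gx xS; rewrite zPhi// subrr.
  exact: (green_formula hc hD hS hnu ha hb hab hf hu hdz state (fun x Ox => (eqdz x Ox).2) dzD dz_diff zPhi0 dzE).
have lE : eperp (lower_angle c) = 1 *: eperp (lower_angle c) by rewrite scale1r.
have uE : - eperp (upper_angle c) = (-1) *: eperp (upper_angle c) by rewrite scaleN1r.
have n1 : `|-1 : R| = 1 by rewrite normrN normr1.
have sl := side_strain_work_integral hc SO hnu ha hb hab hu hz hdu (or_introl erefl) lE divu u0 duE.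
have su := side_strain_work_integral hc SO hnu ha hb hab hu hz hdu (or_intror erefl) uE divu u0 duE.
have tl := side_traction_split_integral hc SO hnu ha hb hab hu hz hdz (or_introl erefl) lE (normr1 R) dzE.
have tu := side_traction_split_integral hc SO hnu ha hb hab hu hz hdz (or_intror erefl) uE n1 dzE.
have strain_work : int_sides c (fun r t n => let x := polar c r t in
      ddot (symgrad u x) (symgrad z x) * Vn c x n) =
    - nu^-1 * int_sides c (fun r t n => dot (stress nu z q (polar c r t) *m n) (du (polar c r t))).
  exact: etrans (congr2 +%R sl su) (esym (mulrDr _ _ _)).
have traction : int_sides c (fun r t n => dot (stress nu u p (polar c r t) *m n) (dz (polar c r t))) =
    - (int_sides c (fun r w n => let x := polar c r w in
         dot (stress nu u p x *m n) (grad z x *m n) * Vn c x n)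
       + nu * int_sides c (fun r w n => let x := polar c r w in
         dot (symgrad u x *m n) (e_ w) * `|Vn c x n|)).
  have reorder (A B A' B' : R) : - (A + nu * B) + - (A' + nu * B') = - (A + A' + nu * (B + B')).
    by ring.
  exact: etrans (congr2 +%R tl tu) (reorder _ _ _ _).
have tip := int_tip_Vn c (fun x => ddot (symgrad u x) (symgrad z x)).
have tipf := int_tip_Vn c (fun x => dot (f x) (z x)).
exact: (cancellation _ hnu tip tipf strain_work green_du green_dz traction).
Qed.
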